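(* Let $G\in C^1((0,\infty))$ be an $N$-function with $G\in\Delta_2\cap\nabla_2$ and $g=G'$. Let $\Omega\subset\mathbb{R}^n$, $n\ge2$, be a bounded open set and let $\mu$ be a nonnegative bounded Radon measure compactly supported in $\Omega$. Then $$\mu\in (W^{1,G}_0(\Omega))'$$ if and only if $$\int_\Omega\mathcal{W}^\mu_G(x,R)\,d\mu(x)<\infty\quad\text{for some } R>0.$$
   Context: $N$-function: a convex $G:[0,\infty)\to[0,\infty)$ vanishing only at $0$ with $\lim_{t\to0}G(t)/t=0$ and $\lim_{t\to\infty}G(t)/t=\infty$. For $G\in C^1((0,\infty))$ and $g=G'$, the condition $G\in\Delta_2\cap\nabla_2$ means $1<i_G:=\inf_{t>0}\frac{tg(t)}{G(t)}\le s_G:=\sup_{t>0}\frac{tg(t)}{G(t)}<\infty$. The function $g$ is taken to be strictly increasing, so that $g^{-1}$ is defined. $L^G(\Omega)$ is the Orlicz space with Luxemburg norm $\|f\|_{L^G}=\inf\{\lambda>0:\int_\Omega G(|f|/\lambda)\,dx\le1\}$; $W^{1,G}(\Omega)$ is the space of $f\in W^{1,1}_{loc}(\Omega)$ with $|f|,|Df|\in L^G(\Omega)$, with norm $\inf\{\lambda>0:\int_\Omega G(|f|/\lambda)\,dx+\int_\Omega G(|Df|/\lambda)\,dx\le1\}$; $W_0^{1,G}(\Omega)$ is the closure of $C_0^\infty(\Omega)$ in this norm, and $(W_0^{1,G}(\Omega))'$ its dual. $\mu\in(W^{1,G}_0(\Omega))'$ means that $\phi\mapsto\int_\Omega\phi\,d\mu$,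 $\phi\in C_0^\infty(\Omega)$, extends to a bounded linear functional on $W^{1,G}_0(\Omega)$. Wolff potential: $\mathcal{W}^{\mu}_G(x,R)=\int_0^Rg^{-1}\left(\frac{\mu(B(x,r))}{r^{n-1}}\right)dr$, with $\mu$ extended by zero outside $\Omega$. *)

(* Defs.v *)
From HB Require Import structures.
From mathcomp Require Import all_boot all_order all_algebra.
From mathcomp Require Import all_classical all_reals all_analysis.
From mathcomp Require Import measurable_realfun.
Set Implicit Arguments.
Unset Strict Implicit.
Unset Printing Implicit Defensive.
Import Order.TTheory GRing.Theory Num.Theory.
Import numFieldNormedType.Exports.
Local Open Scope classical_set_scope.
Local Open Scope ring_scope.

(* R^n is 'rV[R]_n; its topology is that of the sup norm of the library, which
   is the Euclidean one, and it carries the Borel sigma-algebra. *)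
HB.instance Definition _ (R : realType) (n : nat) :=
  @isMeasurable.Build default_measure_display 'rV[R]_n
    <<s @open 'rV[R]_n >> (@sigma_algebra0 _ setT _) (@sigma_algebraC _ _)
    (@sigma_algebra_bigcup _ setT _).

Lemma measurable_rVE (R : realType) n : @measurable _ 'rV[R]_n = <<s @open 'rV[R]_n >>.
Proof. by []. Qed.

Lemma measurable_rV d (T : measurableType d) (R : realType) n (f : T -> 'rV[R]_n) :
  (forall i, measurable_fun setT (fun t => f t ord0 i)) -> measurable_fun setT f.
Proof.
move=> mf; apply: (measurability _ (measurable_rVE R n)).
move=> _ [U oU <-]; rewrite setTI.
pose B (p : 'rV[rat]_n * nat) : set 'rV[R]_n :=
  ball (map_mx ratr p.1 : 'rV[R]_n) (p.2.+1%:R^-1 : R).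
have -> : f @^-1` U =
    \bigcup_p (if `[< B p `<=` U >] then f @^-1` B p else set0).
  apply/seteqP; split=> t /=; last first.
    by case=> p _; case: ifPn => // /asboolP BU; exact: BU.
  move=> Uft; have /nbhs_ballP[e /= e0 eU] : nbhs (f t) U by exact: open_nbhs_nbhs.
  have [k ke] : exists k : nat, k.+1%:R^-1 < e / 2.
    have [k _ /(_ k (leqnn k))] := near_infty_natSinv_lt (PosNum (divr_gt0 e0 (ltr0Sn R 1))).
    by exists k.
  have k0 : 0 < k.+1%:R^-1 :> R by rewrite invr_gt0.
  have /choice[q qf] : forall i, exists q : rat, ball (ratr q : R) k.+1%:R^-1 (f t ord0 i).
    move=> i; have /rat_in_itvoo[q] : f t ord0 i - k.+1%:R^-1 < f t ord0 i + k.+1%:R^-1.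
      by rewrite ltrD2l gtrN.
    by rewrite in_itv /= => qi; exists q; rewrite /ball /= ltr_distl; exact: qi.
  have Bt : ball (map_mx ratr (\row_i q i) : 'rV[R]_n) k.+1%:R^-1 (f t).
    by split=> // i j; rewrite !mxE (ord1 i); exact: qf.
  exists (\row_i q i, k) => //; case: asboolP => [//|]; case.
  move=> y By; apply: eU.
  have le := @le_ball R 'rV[R]_n.
  exact: ball_splitr (le _ _ _ (ltW ke) _ Bt) (le _ _ _ (ltW ke) _ By).
apply: countable_bigcupT_measurable => // p.
case: ifPn => // _.
have -> : f @^-1` B p =
   \bigcap_i ((fun t => f t ord0 i) @^-1` ball (ratr (p.1 ord0 i) : R) (p.2.+1%:R^-1 : R)).
  apply/seteqP; split=> t /=.
    by case=> _ h i _; have := h ord0 i; rewrite mxE.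
  move=> h; split; first by rewrite invr_gt0.
  by move=> i j; rewrite mxE (ord1 i); exact: h.
apply: fin_bigcap_measurable => [|i _]; first exact: finite_finset.
rewrite -[X in measurable X]setTI; apply: mf => //.
exact: open_measurable (ball_open _ _).
Qed.

Lemma measurable_coord (R : realType) n (i : 'I_n) :
  measurable_fun setT (fun x : 'rV[R]_n => x ord0 i).
Proof.
apply: (measurability _ (RGenOpens.measurableE R)).
move=> _ [_ [a [b ->] <-]]; rewrite setTI.
apply: sub_sigma_algebra; have /continuousP := @coord_continuous R 1 n ord0 i.
by apply; exact: interval_open.
Qed.

Definition rV_cons {R : realType} {n} (p : measurableTypeR R * 'rV[R]_n) : 'rV[R]_n.+1 :=
  row_mx p.1%:M p.2.

Lemma measurable_rV_cons (R : realType) n :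
  measurable_fun setT (@rV_cons R n).
Proof.
apply: measurable_rV => i; case: (@split_ordP 1 n i) => j ->.
  rewrite (_ : (fun _ => _) = fst); first exact: measurable_fst.
  by apply/funext => p; apply: etrans (row_mxEl _ _ _ _) _; rewrite mxE (ord1 j).
rewrite (_ : (fun _ => _) = (fun x : 'rV[R]_n => x ord0 j) \o snd).
  by apply: measurableT_comp; [exact: measurable_coord|exact: measurable_snd].
by apply/funext => p; exact: row_mxEr.
Qed.

Definition rV_uncons {R : realType} {n} (x : 'rV[R]_n.+1) : measurableTypeR R * 'rV[R]_n :=
  (x ord0 ord0, \row_i x ord0 (lift ord0 i)).

Lemma measurable_rV_uncons (R : realType) n :
  measurable_fun setT (@rV_uncons R n).
Proof.
apply: measurable_fun_pair; first exact: measurable_coord.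
apply: measurable_rV => i.
rewrite (_ : (fun _ => _) = (fun x : 'rV[R]_n.+1 => x ord0 (lift ord0 i))).
  exact: measurable_coord.
by apply/funext => x; rewrite mxE.
Qed.

Lemma rV_consK (R : realType) n : cancel (@rV_cons R n) rV_uncons.
Proof.
case=> a v; rewrite /rV_uncons; congr pair.
  rewrite (_ : ord0 = @lshift 1 n ord0); last exact/val_inj.
  by apply: etrans (row_mxEl _ _ _ _) _; rewrite mxE.
apply/rowP => i; rewrite mxE.
rewrite (_ : lift ord0 i = @rshift 1 n i); last exact/val_inj.
exact: row_mxEr.
Qed.

Section lebesgue_succ.
Context {R : realType} {n : nat} (m : {sigma_finite_measure set 'rV[R]_n -> \bar R}).

Definition lebesgue_succ : set 'rV[R]_n.+1 -> \bar R :=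
  pushforward (@lebesgue_measure R \x m)%E (@rV_cons R n).

Let lebesgue_succ0 : lebesgue_succ set0 = 0%E.
Proof. by rewrite /lebesgue_succ /pushforward preimage_set0 measure0. Qed.

Let lebesgue_succ_ge0 A : (0 <= lebesgue_succ A)%E.
Proof. exact: (measure_ge0 (@lebesgue_measure R \x m)%E). Qed.

Let measurable_preimage_cons (A : set 'rV[R]_n.+1) :
  measurable A -> measurable (@rV_cons R n @^-1` A).
Proof.
by move=> mA; rewrite -[X in measurable X]setTI; exact: measurable_rV_cons.
Qed.

Let lebesgue_succ_sigma_additive : semi_sigma_additive lebesgue_succ.
Proof.
move=> F mF tF mUF; rewrite /lebesgue_succ /pushforward preimage_bigcup.
apply: measure_semi_sigma_additive.
- by move=> k; exact: measurable_preimage_cons.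
- apply/trivIsetP => /= i j _ _ ij; rewrite -preimage_setI.
  by move/trivIsetP : tF => /(_ _ _ Logic.I Logic.I ij) ->; rewrite preimage_set0.
- by rewrite -preimage_bigcup; exact: measurable_preimage_cons.
Qed.

HB.instance Definition _ := isMeasure.Build _ _ _ lebesgue_succ
  lebesgue_succ0 lebesgue_succ_ge0 lebesgue_succ_sigma_additive.

Let lebesgue_succ_sigma_finite : sigma_finite setT lebesgue_succ.
Proof.

have /sigma_finiteP[F [FT ndF Foo]] := sigma_finiteT (@lebesgue_measure R).
have /sigma_finiteP[G [GT ndG Goo]] := sigma_finiteT m.
exists (fun k => rV_uncons @^-1` (F k `*` G k)).
  apply/esym/seteqP; split=> // x _.
  have [i _ Fi] : (\bigcup_i F i) (rV_uncons x).1 by rewrite -FT.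
  have [j _ Gj] : (\bigcup_i G i) (rV_uncons x).2 by rewrite -GT.
  exists (maxn i j) => //; split.
    by move: (rV_uncons x).1 Fi; exact/subsetPset/ndF/leq_maxl.
  by move: (rV_uncons x).2 Gj; exact/subsetPset/ndG/leq_maxr.
move=> k; have [mF Fk] := Foo k; have [mG Gk] := Goo k; split.
  rewrite -[X in measurable X]setTI.
  by apply: measurable_rV_uncons => //; exact: measurableX.
rewrite /lebesgue_succ /pushforward -comp_preimage.
rewrite (_ : rV_uncons \o _ = id); last by apply/funext => p; exact: rV_consK.
rewrite preimage_id product_measure1E //.
by rewrite lte_mul_pinfty// ge0_fin_numE.
Qed.

HB.instance Definition _ := Measure_isSigmaFinite.Build _ _ _ lebesgue_succ
  lebesgue_succ_sigma_finite.

End lebesgue_succ.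

Fixpoint lebesgue_measure_rV (R : realType) (n : nat) :
    {sigma_finite_measure set 'rV[R]_n -> \bar R} :=
  if n is k.+1 then lebesgue_succ (lebesgue_measure_rV R k)
  else @dirac _ 'rV[R]_0 0 R.

Lemma lebesgue_measure_rV_box (R : realType) n (A : 'I_n -> set R) :
  (forall i, measurable (A i)) ->
  lebesgue_measure_rV R n [set x | forall i, A i (x ord0 i)] =
  (\prod_(i < n) lebesgue_measure (A i))%E.
Proof.
elim: n A => [|n IH] A mA.
  by rewrite big_ord0 /= diracE mem_set // => -[].
rewrite big_ord_recl -(IH (fun i => A (lift ord0 i))) //=.
have mB : measurable [set x : 'rV[R]_n | forall i, A (lift ord0 i) (x ord0 i)].
  rewrite (_ : [set x | _] =
    \bigcap_i ((fun x : 'rV[R]_n => x ord0 i) @^-1` A (lift ord0 i))); last first.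
    by apply/seteqP; split=> x /= h i; [move=> _|]; exact: h.
  apply: fin_bigcap_measurable => [|i _]; first exact: finite_finset.
  by rewrite -[X in measurable X]setTI; exact: measurable_coord.
rewrite -product_measure1E //; last exact: mA.
apply: (congr1 (@lebesgue_measure R \x lebesgue_measure_rV R n)%E).
have c0 (p : measurableTypeR R * 'rV[R]_n) : rV_cons p ord0 ord0 = p.1.
  by have /(congr1 fst) := rV_consK p.
have cS (p : measurableTypeR R * 'rV[R]_n) i :
    rV_cons p ord0 (lift ord0 i) = p.2 ord0 i.
  by have /(congr1 snd)/rowP/(_ i) := rV_consK p; rewrite mxE.
apply/seteqP; split=> p /=.
  by move=> h; split=> [|i]; rewrite -?c0 -?cS.
move=> [h0 h] i; case: (unliftP ord0 i) => [j ->|->]; first by rewrite cS.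
by rewrite c0.
Qed.

Section test_functions.
Context {R : realType} {n : nat}.
Implicit Types (f : 'rV[R]_n -> R) (Omega : set 'rV[R]_n).

Definition eucl_norm (x : 'rV[R]_n) : R :=
  Num.sqrt (\sum_(i < n) x ord0 i ^+ 2).

Definition eucl_ball (x : 'rV[R]_n) (r : R) : set 'rV[R]_n :=
  [set y | eucl_norm (y - x) < r].

Definition partial (i : 'I_n) f : 'rV[R]_n -> R :=
  fun x => 'D_(delta_mx ord0 i) f x.

Definition smooth f := forall s : seq 'I_n,
  continuous (foldr partial f s) /\
  forall i x, derivable (foldr partial f s) x (delta_mx ord0 i).

Definition fun_support f : set 'rV[R]_n := closure [set x | f x != 0].

Definition test_function Omega f :=
  [/\ smooth f, compact (fun_support f) & fun_support f `<=` Omega].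

End test_functions.

(* In this section functions on Omega are represented by functions on R^n,
   whose values outside Omega are never used, and not by classes modulo
   equality almost everywhere: the norms below are seminorms. *)
Section orlicz_sobolev.
Context {R : realType} {n : nat} (G : R -> R) (Omega : set 'rV[R]_n).
Local Notation leb := (lebesgue_measure_rV R n).
Implicit Types (f u : 'rV[R]_n -> R) (v : 'rV[R]_n -> 'rV[R]_n).

Definition integrable_loc f := forall K : set 'rV[R]_n,
  compact K -> K `<=` Omega -> leb.-integrable K (EFin \o f).

Definition is_weak_gradient f v :=
  (forall i, integrable_loc (fun x => v x ord0 i)) /\
  forall i phi, test_function Omega phi ->
    \int[leb]_(x in Omega) (f x * partial i phi x) =
    - \int[leb]_(x in Omega) (v x ord0 i * phi x).

Definition sobolev11_loc f :=
  integrable_loc f /\ exists v, is_weak_gradient f v.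

Definition weak_gradient f : 'rV[R]_n -> 'rV[R]_n :=
  xget (fun=> 0) [set v | is_weak_gradient f v].

Definition orlicz_modular f (l : R) : \bar R :=
  (\int[leb]_(x in Omega) (G (`|f x| / l))%:E)%E.

Definition luxemburg_norm f : \bar R :=
  ereal_inf [set l%:E | l in
    [set l : R | 0 < l /\ (orlicz_modular f l <= 1)%E]].

Definition orlicz f :=
  measurable_fun Omega f /\ (luxemburg_norm f < +oo)%E.

Definition norm_gradient f : 'rV[R]_n -> R :=
  fun x => eucl_norm (weak_gradient f x).

Definition sobolev f :=
  [/\ sobolev11_loc f, orlicz f & orlicz (norm_gradient f)].

Definition sobolev_norm f : \bar R :=
  ereal_inf [set l%:E | l in [set l : R | 0 < l /\
    (orlicz_modular f l + orlicz_modular (norm_gradient f) l <= 1)%E]].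

Definition sobolev0 u := sobolev u /\
  forall e : R, 0 < e -> exists phi, test_function Omega phi /\
    (sobolev_norm (fun x => u x - phi x)%R < e%:E)%E.

(* By boundedness such an L takes the same value on functions that agree almost
   everywhere in Omega. *)
Definition bounded_linear_functional (L : ('rV[R]_n -> R) -> R) :=
  (forall (a : R) u w, sobolev0 u -> sobolev0 w ->
     L (fun x => a * u x + w x) = a * L u + L w) /\
  exists C : R, forall u, sobolev0 u ->
    (`|L u|%:E <= C%:E * sobolev_norm u)%E.

Definition in_dual (mu : {measure set 'rV[R]_n -> \bar R}) :=
  exists L : ('rV[R]_n -> R) -> R, bounded_linear_functional L /\
    forall phi, test_function Omega phi ->
      L phi = \int[mu]_(x in Omega) phi x.

End orlicz_sobolev.

Section N_functions.
Context {R : realType}.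
Implicit Type G : R -> R.

(* Only the values of G on [0, +oo[ are relevant. *)
Definition N_function G :=
  [/\ @convex_function R R^o [set t | 0 <= t] G,
      (forall t, 0 <= t -> 0 <= G t),
      (forall t, 0 <= t -> (G t = 0 <-> t = 0)),
      G t / t @[t --> 0^'+] --> 0
    & G t / t @[t --> +oo] --> +oo].

Definition C1_pos G := forall t, 0 < t ->
  derivable G t 1 /\ {for t, continuous (derive1 G)}.

Definition lower_index G : \bar R :=
  ereal_inf [set (t * derive1 G t / G t)%:E | t in [set t : R | 0 < t]].

Definition upper_index G : \bar R :=
  ereal_sup [set (t * derive1 G t / G t)%:E | t in [set t : R | 0 < t]].

Definition Delta2_nabla2 G :=
  [/\ (1 < lower_index G)%E, (lower_index G <= upper_index G)%E
    & (upper_index G < +oo)%E].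

(* The inverse of g : [0, +oo[ -> [0, +oo[ extended by g 0 = 0; the default
   value of xget provides the inverse of 0, as g > 0 on ]0, +oo[. *)
Definition inverse_pos (g : R -> R) (s : R) : R :=
  xget 0 [set t | 0 < t /\ g t = s].

End N_functions.

Section radon_measures.
Context {R : realType} {n : nat} (mu : {measure set 'rV[R]_n -> \bar R}).

Definition radon :=
  (forall K : set 'rV[R]_n, compact K -> (mu K < +oo)%E) /\
  (forall A : set 'rV[R]_n, measurable A ->
     mu A = ereal_sup [set mu K | K in [set K | compact K /\ K `<=` A]]).

Definition measure_support : set 'rV[R]_n :=
  [set x | forall U, open U -> U x -> (0 < mu U)%E].

(* A measure on Omega is represented by its extension by zero to R^n. *)
Definition compactly_supported_in (Omega : set 'rV[R]_n) :=
  [/\ mu (~` Omega) = 0%E, compact measure_support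
    & measure_support `<=` Omega].

Definition wolff_potential (G : R -> R) (x : 'rV[R]_n) (r0 : R) : \bar R :=
  (\int[lebesgue_measure]_(r in `]0%R, r0[)
     (inverse_pos (derive1 G) (fine (mu (eucl_ball x r)) / r ^+ n.-1))%:E)%E.

End radon_measures.

(* Main.v *)
Require Import Defs.
From HB Require Import structures.
From mathcomp Require Import all_boot all_order all_algebra.
From mathcomp Require Import all_classical all_reals all_analysis.
From mathcomp Require Import measurable_realfun ring lra.
Set Implicit Arguments.
Unset Strict Implicit.
Unset Printing Implicit Defensive.
Import Order.TTheory GRing.Theory Num.Theory.
Import numFieldNormedType.Exports.
Local Open Scope classical_set_scope.
Local Open Scope ring_scope.

(* Let h be the inverse of g = G'; by the bounds on t g(t) / G(t), the functions
   G, g and h have polynomial growth. For r_k = rho / 2^k, with Q(x, r) the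
   closed cube of centre x and half-side r, the integral of the Wolff potential
   with respect to mu is comparable to the dyadic energy
     E = \sum_k r_k \int h(d_k) dmu,   d_k(x) = mu(Q(x, r_k)) / r_k^(n-1).
   In both directions E controls sums over k because d_k is comparable to an
   average of mu at scale r_k, so that Fubini bounds the integral of d_k h(d_j),
   j <= k, by r_k \int h(d_j) dmu up to a constant, and the factor r_k is
   summable against the polynomial growth of g and h.

   If mu is in the dual, test it on u = \sum_(k < N) r_k w_k, where w_k is a
   superposition of bumps of size r_k, of heights h(d_k), centred on a lattice.
   Then \int u dmu >= E_N, the partial sum of E, while u and |Du| are bounded by
   multiples of U = \sum_(k < N) h(d_k) and \int G(U) <= C (E_N + 1). As i_G > 1
   this bounds the norm of u by C (1 + E_N)^(1 / i_G), so that
   E_N <= C (1 + E_N)^(1 / i_G) and E_N is bounded independently of N.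

   Conversely, let A_k u be the mollification of u at scale r_k. The functional is
   L u = lim_k \int A_k u dmu. Indeed A_k u - A_(k+1) u is the integral of Du
   against a kernel of size r_k^(1-n), so by Fubini
     \sum_k \int |A_k u - A_(k+1) u| dmu <= C \int |Du| \sum_k d_k,
   and Young's inequality for G and its conjugate bounds the right-hand side by
   C (1 + E) if \int G(|Du|) <= 1. Hence the limit exists and is bounded by the
   norm of u; for a test function, A_k u tends to u. *)

(** * N-functions and their growth *)

(** The measure mu may be singular, so a Sobolev function has no values mu-almost everywhere to
    integrate. This is why the functional is built from averages, which see u through Lebesgue
    integrals only, and why their differences are estimated at every point of the support of mu. The
    gradient enters there because all mollifiers have mass 1: the difference of two of them is the
    divergence of a compactly supported field.

    The energy E may be infinite a priori, hence the partial sums and the constants independent of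
    N. Two losses have to be absorbed. Taking a function of growth l^q out of a sum costs a factor
    at each scale; geometric weights of ratio close to 1 keep it at 3/2 whatever q is, below the
    factor 2 gained from the radii. And each use of Fubini doubles the cubes: in one direction a
    shift by finitely many scales restores the original energy, in the other the potential bounds
    the energy of enlarged cubes directly.

    Cubes replace balls because their volume, and the kernels adapted to them, are products over the
    coordinates. *)

Section growth.
Context {R : realType}.
Implicit Types (f g h G df : R -> R) (C i : R) (q : nat).

Definition power_growth C q f :=
  forall l x, 1 <= l -> 0 <= x -> f (l * x) <= C * l ^+ q * f x.

Lemma derive_ge0_le f df (a b : R) : 0 < a -> a <= b ->
  (forall t : R, 0 < t -> is_derive t 1 f (df t)) -> (forall t : R, 0 < t -> 0 <= df t) ->
  f a <= f b.
Proof.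
move=> a0 ab fdf df0.
have [||c] := @MVT_segment R f df a b ab.
- by move=> x; rewrite in_itv/= => /andP[ax _]; apply: fdf; exact: lt_trans ax.
- apply: derivable_within_continuous => x; rewrite in_itv/= => /andP[ax _].
  by case: (fdf x (lt_le_trans a0 ax)).
rewrite in_itv/= => /andP[ac _] fab.
by rewrite -subr_ge0 fab mulr_ge0 ?subr_ge0// df0// (lt_le_trans a0 ac).
Qed.

Lemma sum_geometric_le (x : R) N : 0 <= x -> x < 1 ->
  \sum_(m < N) x ^+ m <= (1 - x)^-1.
Proof.
move=> x0 x1; have xB : 0 < 1 - x by rewrite subr_gt0.
rewrite -(ler_pM2l xB) divff ?gt_eqF// -opprB mulNr -subrX1 opprB.
by rewrite gerBl exprn_ge0.
Qed.

(* The weights (1 - th) th^m sum up to less than 1, so some term b m is at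
   least its weight times the whole sum. *)
Lemma sum_le_weighted C th q f : 0 < th < 1 -> 0 <= C ->
  {homo f : x y / x <= y} -> (forall x, 0 <= f x) -> f 0 = 0 ->
  power_growth C q f ->
  exists D, 0 <= D /\ forall N (b : nat -> R), (forall m, 0 <= b m) ->
    f (\sum_(m < N) b m) <= D * \sum_(m < N) (th ^- q) ^+ m * f (b m).
Proof.
move=> /andP[th0 th1] C0 fm f0 f00 fg.
have thB : 0 < 1 - th by rewrite subr_gt0.
exists (C * (1 - th) ^- q); split=> [|N b b0].
  by rewrite mulr_ge0// invr_ge0 exprn_ge0// ltW.
pose w m := (1 - th) * th ^+ m.
have w0 m : 0 < w m by rewrite mulr_gt0// exprn_gt0.
have w1 m : w m <= 1.
  by rewrite mulr_ile1// ?exprn_ge0 ?exprn_ile1 ?gerBl// ltW.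
set S := \sum_(m < N) b m.
have rhs0 m : 0 <= (th ^- q) ^+ m * f (b m).
  by rewrite mulr_ge0// exprn_ge0// invr_ge0 exprn_ge0// ltW.
have [S0|S0] := ltP 0 S; last first.
  rewrite (le_trans (fm _ _ S0))// f00 mulr_ge0 ?sumr_ge0//.
  by rewrite mulr_ge0// invr_ge0 exprn_ge0// ltW.
have [m bm] : exists m : 'I_N, w m * S <= b m.
  apply: contrapT => /forallNP H.
  have : S < S.
    have NP : (0 < N)%N by move: S0; rewrite /S; case: (N) => //; rewrite big_ord0 ltxx.
    rewrite {1}/S (@lt_le_trans _ _ (\sum_(m < N) w m * S))//.
      apply: ltr_sum => [|m _]; last by rewrite ltNge; apply/negP/H.
      by apply/hasP; exists (Ordinal NP); rewrite ?mem_index_enum.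
    rewrite -mulr_suml -[leRHS]mul1r ler_pM2r// -mulr_sumr.
    by rewrite mulrC -ler_pdivlMr// div1r; apply: sum_geometric_le => //; exact: ltW.
  by rewrite ltxx.
have : f S <= C * (w m)^-1 ^+ q * f (b m).
  rewrite -[leRHS]/(_ * _ * _); apply: le_trans (fg _ _ _ (b0 m)); last first.
    by rewrite invf_ge1.
  by apply: fm; rewrite -ler_pdivrMl ?invr_gt0// invrK.
move=> /le_trans; apply.
rewrite -mulrA -[leRHS]mulrA ler_wpM2l//.
rewrite (bigD1 m)//= mulrDr -[leLHS]addr0 lerD//; last first.
  by rewrite mulr_ge0 ?sumr_ge0// invr_ge0 exprn_ge0// ltW.
by rewrite mulrA ler_wpM2r// /w invfM exprMn !exprVn -!exprM mulnC lexx.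
Qed.

(* [g] stands for G' and [h] for its inverse, both extended by 0 to the
   nonpositive reals so that they are monotone on the whole line. *)
Record conjugate_growth G g h C i q : Prop := {
  cg_C : 1 <= C;
  cg_i : 1 < i;
  cg_G0 : G 0 = 0;
  cg_G_le : forall s t, 0 <= s -> s <= t -> G s <= G t;
  cg_g_le : {homo g : s t / s <= t};
  cg_g0 : forall t : R, t <= 0 -> g t = 0;
  cg_h_le : {homo h : s t / s <= t};
  cg_h0 : forall t : R, t <= 0 -> h t = 0;
  cg_hK : forall s, 0 <= s -> g (h s) = s;
  cg_h_lt : forall s t, h s < t -> s <= g t;
  cg_young : forall t : R, 0 <= t -> t * g t <= C * G t;
  cg_G_up : power_growth C q G;
  cg_G_down : forall l t : R, 1 <= l -> 0 <= t -> G (t / l) <= G t / l `^ i;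
  cg_g_up : power_growth C q g;
  cg_h_up : power_growth C q h;
  cg_G_incr : forall s t, 0 <= s -> s <= t -> G t - G s <= (t - s) * g t }.

Lemma index_bounds G : (forall t : R, 0 < t -> 0 < G t) -> Delta2_nabla2 G ->
  exists i s, 1 < i /\ forall t : R, 0 < t ->
    i * G t <= t * derive1 G t /\ t * derive1 G t <= s * G t.
Proof.
move=> G0 [l1 _ u1].
have LB t : 0 < t -> (lower_index G <= (t * derive1 G t / G t)%:E)%E.
  by move=> t0; apply: ereal_inf_lbound; exists t.
have UB t : 0 < t -> ((t * derive1 G t / G t)%:E <= upper_index G)%E.
  by move=> t0; apply: ereal_sup_ubound; exists t.
have lE : lower_index G \is a fin_num.
  rewrite fin_real// (lt_trans _ l1) ?ltNyr//=.
  by rewrite (le_lt_trans (LB 1 ltr01))// ltry.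
have uE : upper_index G \is a fin_num.
  rewrite fin_real// u1 andbT.
  by rewrite (lt_le_trans _ (UB 1 ltr01))// ltNyr.
exists (fine (lower_index G)), (fine (upper_index G)); split.
  by rewrite -lte_fin fineK.
move=> t t0; move: (LB _ t0) (UB _ t0).
rewrite -(fineK lE) -(fineK uE) !lee_fin.
by rewrite ler_pdivlMr ?G0// ler_pdivrMr ?G0.
Qed.

End growth.

Section growth2.
Context {R : realType}.
Implicit Types (f g h G df : R -> R) (C i : R) (q : nat).

Lemma N_function_gt0 G t : N_function G -> 0 < t -> 0 < G t.
Proof.
move=> [_ G0 G00 _ _] t0; rewrite lt_def G0 ?ltW// andbT.
apply/eqP => /G00 => /(_ (ltW t0)) t00; by rewrite t00 ltxx in t0.
Qed.

(** The derivative of s ln t - ln (G t) is s / t - g t / G t, which the hypothesis makes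
    nonnegative. *)
Lemma power_upper G (g : R -> R) s : (forall t : R, 0 < t -> 0 < G t) ->
  (forall t : R, 0 < t -> is_derive t 1 G (g t)) ->
  (forall t : R, 0 < t -> t * g t <= s * G t) ->
  forall l t : R, 1 <= l -> 0 < t -> G (l * t) <= l `^ s * G t.
Proof.
move=> G0 dG gs l t l1 t0.
have l0 : 0 < l by exact: lt_le_trans l1.
have lt0 : 0 < l * t by rewrite mulr_gt0.
pose F (t : R) := s * ln t - ln (G t).
have : F t <= F (l * t).
  apply: (@derive_ge0_le _ _ (fun t => s * t^-1 - g t / G t)) => //.
  - by rewrite ler_peMl// ltW.
  - move=> x x0; have Gx := G0 _ x0.
    have D1 := is_derive1_ln x0.
    have D2 := is_derive1_ln Gx; have D3 := dG _ x0.
    have D4 := @is_derive1_comp _ (@ln R) G x _ _ D2 D3.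
    rewrite [X in _ - X]mulrC.
    by have := is_deriveB (is_deriveZ s D1) D4.
  - move=> x x0; rewrite subr_ge0 ler_pdivrMr ?G0// mulrAC ler_pdivlMr//.
    by rewrite mulrC gs.
rewrite /F lnM ?posrE// => H.
rewrite -ler_ln ?posrE ?mulr_gt0 ?powR_gt0 ?G0// lnM ?posrE ?powR_gt0 ?G0//.
by rewrite ln_powR; lra.
Qed.

Lemma power_lower G (g : R -> R) s : (forall t : R, 0 < t -> 0 < G t) ->
  (forall t : R, 0 < t -> is_derive t 1 G (g t)) ->
  (forall t : R, 0 < t -> s * G t <= t * g t) ->
  forall l t : R, 1 <= l -> 0 < t -> l `^ s * G t <= G (l * t).
Proof.
move=> G0 dG gs l t l1 t0.
have l0 : 0 < l by exact: lt_le_trans l1.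
have lt0 : 0 < l * t by rewrite mulr_gt0.
pose F (t : R) := ln (G t) - s * ln t.
have : F t <= F (l * t).
  apply: (@derive_ge0_le _ _ (fun t => g t / G t - s * t^-1)) => //.
  - by rewrite ler_peMl// ltW.
  - move=> x x0; have Gx := G0 _ x0.
    have D1 := is_derive1_ln x0.
    have D2 := is_derive1_ln Gx; have D3 := dG _ x0.
    have D4 := @is_derive1_comp _ (@ln R) G x _ _ D2 D3.
    rewrite [X in X - _]mulrC.
    by have := is_deriveB D4 (is_deriveZ s D1).
  - move=> x x0; rewrite subr_ge0 ler_pdivlMr ?G0// mulrAC ler_pdivrMr//.
    by rewrite [leRHS]mulrC gs.
rewrite /F lnM ?posrE// => H.
rewrite -ler_ln ?posrE ?mulr_gt0 ?powR_gt0 ?G0// lnM ?posrE ?powR_gt0 ?G0//.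
by rewrite ln_powR; lra.
Qed.

Lemma derive1_surj G s : N_function G -> C1_pos G -> (exists i S, 1 < i /\
  forall t : R, 0 < t -> i * G t <= t * derive1 G t /\ t * derive1 G t <= S * G t) ->
  (forall s t : R, 0 < s -> s < t -> derive1 G s < derive1 G t) ->
  0 < s -> exists t, 0 < t /\ derive1 G t = s.
Proof.
move=> hN hC [i [S [i1 iS]]] hg s0.
have G0 (t : R) := @N_function_gt0 G t hN.
case: (hN) => _ _ _ lim0 limoo.
have [a [a0 ga]] : exists a, 0 < a /\ derive1 G a <= s.
  have S0 : 0 < S.
    have := iS 1 ltr01; have := G0 _ ltr01; nra.
  have : \forall t \near 0^'+, G t / t < s / S.
    apply: (cvgr_lt _ lim0); exact: divr_gt0.
  move=> /(filterI (nbhs_right_gt 0)) /filter_ex[a [a0 Ha]].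
  exists a; split => //.
  have := (iS a a0).2; move: Ha; rewrite ltr_pdivrMr// mulrAC ltr_pdivlMr// => H1 H2.
  rewrite -(ler_pM2l a0); lra.
have [b [b0 gb]] : exists b, 0 < b /\ s <= derive1 G b.
  have : \forall t \near +oo, s <= G t / t by move/cvgryPge : limoo; exact.
  move=> /(filterI (nbhs_pinfty_gt (num_real 0))) /filter_ex[b [b0 Hb]].
  exists b; split => //.
  have := (iS b b0).1; move: Hb; rewrite ler_pdivlMr// => H1 H2.
  have := G0 b b0.
  rewrite -(ler_pM2l b0); nra.
have ab : a <= b.
  by rewrite leNgt; apply/negP => /(hg _ _ b0); lra.
have cg : {within `[a, b], continuous (derive1 G)}.
  apply: continuous_in_subspaceT => x; rewrite inE/= in_itv/= => /andP[ax _].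
  by case: (hC x (lt_le_trans a0 ax)).
have sab : Num.min (derive1 G a) (derive1 G b) <= s <= Num.max (derive1 G a) (derive1 G b).
  by rewrite ge_min le_max ga gb orbT.
have [c] := @IVT _ (derive1 G) a b s ab cg sab.
rewrite in_itv/= => /andP[ac _] <-; exists c; split => //.
exact: lt_le_trans ac.
Qed.

Lemma conjugate_growth_exists G : N_function G -> C1_pos G -> Delta2_nabla2 G ->
  (forall s t : R, 0 < s -> s < t -> derive1 G s < derive1 G t) ->
  exists C i q, conjugate_growth G (fun t => if 0 < t then derive1 G t else 0)
    (inverse_pos (derive1 G)) C i q.
Proof.
move=> hN hC hG hg.
have G0 (t : R) := @N_function_gt0 G t hN.
have IB := index_bounds G0 hG.
have surj (s : R) := @derive1_surj G s hN hC IB hg.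
case: IB => i [S [i1 iS]].
have dG (t : R) : 0 < t -> is_derive t 1 G (derive1 G t).
  by move=> /hC[dt _]; rewrite derive1E; exact: derivableP.
have up := power_upper G0 dG (fun t t0 => (iS t t0).2).
have lo := power_lower G0 dG (fun t t0 => (iS t t0).1).
pose g (t : R) := if 0 < t then derive1 G t else 0.
pose h := inverse_pos (derive1 G); rewrite -/h -/g.
have GG0 : G 0 = 0 by case: hN => _ _ /(_ 0 (lexx 0)) [_ /(_ erefl)].
have gE (t : R) : 0 < t -> derive1 G t = g t by rewrite /g => ->.
have gp (t : R) : 0 < t -> 0 < g t.
  move=> t0; have := (iS t t0).1; have := G0 t t0; rewrite -gE// => H1 H2.
  rewrite -(pmulr_rgt0 _ t0); nra.
have hP (s : R) : 0 < s -> 0 < h s /\ g (h s) = s.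
  move=> s0; rewrite /h /inverse_pos; case: xgetP => [y -> [y0 gy]|].
    by split => //; rewrite -gE.
  by have [t [t0 gt]] := surj _ s0 => /(_ t) []; split.
have h0 (s : R) : s <= 0 -> h s = 0.
  move=> s0; rewrite /h /inverse_pos; case: xgetP => // y -> [y0 gy].
  by have := gp _ y0; rewrite -gE// gy; lra.
have hge0 (s : R) : 0 <= h s.
  by have [/hP[/ltW]|/h0->] := ltP 0 s.
have g_lt (s t : R) : 0 < s -> s < t -> g s < g t.
  by move=> s0 st; rewrite -!gE ?hg//; exact: lt_trans st.
have g_le : {homo g : s t / s <= t}.
  move=> s t; rewrite le_eqVlt => /predU1P[->//|st].
  have [s0|s0] := ltP 0 s; first exact/ltW/g_lt.
  rewrite {1}/g ltNge s0/=; have [/gp/ltW//|t0] := ltP 0 t.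
  by rewrite /g ltNge t0.
have g0 (t : R) : t <= 0 -> g t = 0 by rewrite /g ltNge => ->.
have hK (s : R) : 0 <= s -> g (h s) = s.
  by rewrite le_eqVlt => /predU1P[<-|/hP[]//]; rewrite h0// g0.
have h_lt (s t : R) : h s < t -> s <= g t.
  have [s0 st|s0 st] := ltP 0 s; first by rewrite -(hP _ s0).2; apply/g_le/ltW.
  by rewrite (le_trans s0)// ltW// gp// (le_lt_trans (hge0 s)).
have h_le : {homo h : s t / s <= t}.
  move=> s t st; have [s0|s0] := ltP 0 s; last by rewrite (h0 s).
  have t0 := lt_le_trans s0 st.
  rewrite leNgt; apply/negP => /(g_lt _ _ (hP _ t0).1).
  by rewrite (hP _ t0).2 (hP _ s0).2; lra.
have S0 : 1 < S.
  have := iS 1 ltr01; have := G0 _ ltr01; nra.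
(* As t g t is comparable to G t, the growth of G of order i passes to g with order i - 1, at the
   price of the factor i / S. *)
have glo (l t : R) : 1 <= l -> 0 < t -> i / S * l `^ (i - 1) * g t <= g (l * t).
  move=> l1 t0.
  have l0 := lt_le_trans ltr01 l1.
  have lt0 : 0 < l * t by rewrite mulr_gt0.
  have A := lo l t l1 t0; have B := (iS _ lt0).1.
  have D := (iS _ t0).2; rewrite -!gE//.
  rewrite -(ler_pM2l lt0) (le_trans _ B)//.
  rewrite -(mulr_powRB1 (ltW l0)) in A; last lra.
  apply: (@le_trans _ _ (i * (l * l `^ (i - 1) * G t))); last by rewrite ler_pM2l//; lra.
  set x := l `^ (i - 1); set d := derive1 G t.
  have x0 : 0 <= x by exact: powR_ge0.
  have -> : l * t * (i / S * x * d) = (i * (l * x)) * ((t * d) / S) by ring.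
  rewrite [leRHS]mulrA; apply: ler_wpM2l; first by rewrite !mulr_ge0//; lra.
  by rewrite ler_pdivrMr; [rewrite [leRHS]mulrC; exact: D|lra].
have gup (l t : R) : 1 <= l -> 0 < t -> g (l * t) <= S / i * l `^ S * g t.
  move=> l1 t0.
  have l0 := lt_le_trans ltr01 l1.
  have lt0 : 0 < l * t by rewrite mulr_gt0.
  have A := up l t l1 t0; have B := (iS _ lt0).2.
  have D := (iS _ t0).1; rewrite -!gE//.
  rewrite -(ler_pM2l lt0) (le_trans B)//.
  apply: (@le_trans _ _ (S * (l `^ S * G t))); first by rewrite ler_pM2l//; lra.
  set x := l `^ S; set d := derive1 G t.
  have x0 : 0 <= x by exact: powR_ge0.
  have -> : l * t * (S / i * x * d) = l * (S * x) * ((t * d) / i) by ring.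
  rewrite mulrA; apply: ler_pM.
  - by rewrite mulr_ge0//; lra.
  - exact/ltW/G0.
  - by rewrite ler_peMl// mulr_ge0 ?powR_ge0//; lra.
  - by rewrite ler_pdivlMr; [rewrite [leLHS]mulrC; exact: D|lra].
(* With this exponent and the constant K below, [glo] applied with the factor K l^e gives exactly l
   * s; this bounds the growth of h. *)
pose e := (i - 1)^-1.
have e0 : 0 < e by rewrite invr_gt0; lra.
pose K := (S / i) `^ e.
have Si : 1 <= S / i.
  rewrite ler_pdivlMr ?mul1r; last lra.
  by have [A B] := iS 1 ltr01; have := G0 _ ltr01; nra.
have K1 : 1 <= K by rewrite -(powRr0 (S / i)) ler_powR// ltW.
have hup (l s : R) : 1 <= l -> 0 < s -> h (l * s) <= K * l `^ e * h s.
  move=> l1 s0; have l0 := lt_le_trans ltr01 l1.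
  have [hs ghs] := hP _ s0.
  have [hls ghls] := hP _ (mulr_gt0 l0 s0).
  rewrite leNgt; apply/negP => H.
  have L1 : 1 <= K * l `^ e.
    by rewrite mulr_ege1// -(powRr0 l) ler_powR// ltW.
  have := glo _ _ L1 hs; rewrite ghs.
  have := g_lt _ _ (mulr_gt0 (lt_le_trans ltr01 L1) hs) H; rewrite ghls.
  move=> /(le_lt_trans _) /[apply]; rewrite ltNge => /negP; apply.
  rewrite powRM ?powR_ge0// /K -!powRrM /e mulVf; last by rewrite gt_eqF//; lra.
  rewrite !powRr1; [|exact: ltW|lra].
  have iN : i != 0 by rewrite gt_eqF//; lra.
  have SN : S != 0 by rewrite gt_eqF//; lra.
  by have -> : i / S * (S / i * l) = l by field; rewrite SN iN.
(* One integer exponent and one constant serve G, g and h alike. *)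
pose q := (Num.truncn (Num.max S e)).+1.
have qS : Num.max S e <= q%:R by apply/ltW/truncnS_gt.
have pq (l x : R) : x <= Num.max S e -> 1 <= l -> l `^ x <= l ^+ q.
  move=> xm l1; rewrite -powR_mulrn; last lra.
  by apply: ler_powR => //; exact: le_trans qS.
pose C := Num.max S (Num.max (S / i) K).
have CS : S <= C by rewrite le_max lexx.
have C1 : 1 <= C by lra.
exists C, i, q; split => //.
- move=> s t; rewrite le_eqVlt => /predU1P[<-|s0 st].
    by rewrite GG0; case: hN => _ + _ _ _; apply.
  apply: (derive_ge0_le s0 st dG) => x x0; rewrite gE//; exact/ltW/gp.
- move=> t; rewrite le_eqVlt => /predU1P[<-|t0]; first by rewrite mul0r GG0 mulr0.
  rewrite -gE// (le_trans (iS _ t0).2)// ler_wpM2r// ltW//; exact: G0.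
- move=> l x l1; rewrite le_eqVlt => /predU1P[<-|x0].
    by rewrite mulr0 GG0 mulr0.
  apply: (le_trans (up _ _ l1 x0)); apply: ler_wpM2r; first exact/ltW/G0.
  rewrite -[leLHS]mul1r; rewrite ler_pM ?powR_ge0// pq//.
  by rewrite le_max lexx.
- move=> l t l1; have l0 := lt_le_trans ltr01 l1; rewrite le_eqVlt => /predU1P[<-|x0].
    by rewrite mul0r GG0 mul0r.
  rewrite ler_pdivlMr ?powR_gt0// mulrC.
  have := lo l (t / l) l1; rewrite divr_gt0// [l * _]mulrC mulfVK ?gt_eqF//; exact.
- move=> l x l1; rewrite le_eqVlt => /predU1P[<-|x0].
    by rewrite mulr0 g0// mulr0.
  apply: (le_trans (gup _ _ l1 x0)); apply: ler_wpM2r; first exact/ltW/gp.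
  rewrite ler_pM ?powR_ge0// ?pq ?le_max ?lexx//; lra.
- move=> l x l1; rewrite le_eqVlt => /predU1P[<-|x0].
    by rewrite mulr0 h0// mulr0.
  apply: (le_trans (hup _ _ l1 x0)); apply: ler_wpM2r => //.
  rewrite ler_pM ?powR_ge0// ?pq ?le_max ?lexx ?orbT//; lra.
(* The mean value theorem is used on intervals away from 0, where G is differentiable; for s = 0 the
   bound is G t <= i * G t <= t * g t. *)
- move=> s t; rewrite le_eqVlt => /predU1P[<-|s0].
    rewrite le_eqVlt => /predU1P[<-|t0]; first by rewrite !subrr mul0r.
    rewrite GG0 !subr0 -gE// (le_trans _ (iS _ t0).1)// ler_peMl ?ltW//; exact: G0.
  move=> st.
  have [||c] := @MVT_segment R G (derive1 G) s t st.
  - by move=> x; rewrite in_itv/= => /andP[sx _]; apply: dG; exact: lt_trans sx.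
  - apply: derivable_within_continuous => x; rewrite in_itv/= => /andP[sx _].
    by case: (dG x (lt_le_trans s0 sx)).
  rewrite in_itv/= => /andP[sc ct] ->; rewrite mulrC ler_wpM2l ?subr_ge0//.
  by rewrite gE ?g_le// (lt_le_trans s0).
Qed.
End growth2.

(** * Lebesgue measure on R^n *)

Section space.
Context {R : realType} {n : nat}.
Local Notation V := 'rV[R]_n.
Local Notation leb := (lebesgue_measure_rV R n).

(** For r >= 0, the closed ball of the sup norm. *)
Definition cube (x : V) (r : R) : set V :=
  [set y | forall i, `|y ord0 i - x ord0 i| <= r].

Lemma cube_sym x y r : cube x r y <-> cube y r x.
Proof. by split=> h i; rewrite distrC; exact: h. Qed.

Lemma cube_trans x y z r s : cube x r y -> cube y s z -> cube x (r + s) z.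
Proof.
move=> xy yz i; rewrite -(subrKA (y ord0 i)) addrC.
exact: le_trans (ler_normD _ _) (lerD (xy i) (yz i)).
Qed.

Lemma cube_le x r s : r <= s -> cube x r `<=` cube x s.
Proof. by move=> rs y h i; exact: le_trans (h i) rs. Qed.

Lemma cubeE x r : cube x r =
  [set y : V | forall i, `[x ord0 i - r, x ord0 i + r]%classic (y ord0 i)].
Proof.
by apply/seteqP; split=> y h i; have := h i; rewrite /= in_itv/= ler_distl.
Qed.

Lemma compact_cube x r : compact (cube x r).
Proof.
rewrite cubeE; apply: (@rV_compact _ _ (fun i => `[x ord0 i - r, x ord0 i + r]%classic)).
by move=> i; exact: segment_compact.
Qed.

Lemma hausdorff_rV : hausdorff_space V.
Proof. exact: norm_hausdorff. Qed.

Lemma open_measurable_rV (U : set V) : open U -> measurable U.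
Proof. by move=> oU; exact: sub_sigma_algebra. Qed.

Lemma closed_measurable_rV (F : set V) : closed F -> measurable F.
Proof.
by rewrite -openC => /open_measurable_rV/measurableC; rewrite setCK.
Qed.

Lemma compact_measurable_rV (K : set V) : compact K -> measurable K.
Proof. by move=> cK; apply: closed_measurable_rV; exact: compact_closed hausdorff_rV cK. Qed.

Lemma measurable_cube x r : measurable (cube x r).
Proof. by apply: compact_measurable_rV; exact: compact_cube. Qed.

Lemma lebesgue_cube x r : 0 <= r -> leb (cube x r) = ((2 * r) ^+ n)%:E.
Proof.
move=> r0; rewrite cubeE.
rewrite (@lebesgue_measure_rV_box R n (fun i => `[x ord0 i - r, x ord0 i + r]%classic))//.
rewrite (eq_bigr (fun=> (2 * r)%:E)) => [|i _]; last first.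
  rewrite lebesgue_measure_itv/= lte_fin.
  have [h|h] := ltP; first by rewrite -EFinB; congr EFin; ring.
  by congr EFin; lra.
by rewrite prodEFin prodr_const card_ord.
Qed.

Lemma ball_cube x r : ball x r `<=` cube x r.
Proof. by move=> y [_ h] i; rewrite distrC ltW//; exact: h. Qed.

Lemma cube_ball x r s : r < s -> 0 < s -> cube x r `<=` ball x s.
Proof.
move=> rs s0 y h; split=> // i j; rewrite ord1 /ball/= distrC.
exact: le_lt_trans (h j) rs.
Qed.

Lemma continuous_measurable_rV (f : V -> R) : continuous f -> measurable_fun setT f.
Proof.
move=> /continuousP cf.
apply: (measurability _ (RGenOpens.measurableE R)).
move=> _ [_ [a [b ->] <-]]; rewrite setTI.
by apply: open_measurable_rV; apply: cf; exact: interval_open.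
Qed.

(** A base of the topology indexed by a countable type, so that unions over it stay measurable and
    null sets stay null. *)
Definition rational_ball (p : 'rV[rat]_n * nat) : set V :=
  ball (map_mx ratr p.1 : V) (p.2.+1%:R^-1 : R).

Lemma rational_ball_small (x : V) (e : R) : 0 < e ->
  exists p, [/\ rational_ball p x, rational_ball p `<=` ball x e & p.2.+1%:R^-1 < e / 2].
Proof.
move=> e0; have [k ke] : exists k : nat, k.+1%:R^-1 < e / 2.
  have [k _ /(_ k (leqnn k))] := near_infty_natSinv_lt (PosNum (divr_gt0 e0 (ltr0Sn R 1))).
  by exists k.
have k0 : 0 < k.+1%:R^-1 :> R by rewrite invr_gt0.
have /choice[q qf] : forall i, exists q : rat, ball (ratr q : R) k.+1%:R^-1 (x ord0 i).
  move=> i; have /rat_in_itvoo[q] : x ord0 i - k.+1%:R^-1 < x ord0 i + k.+1%:R^-1.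
    by rewrite ltrD2l gtrN.
  by rewrite in_itv /= => qi; exists q; rewrite /ball /= ltr_distl; exact: qi.
have Bt : rational_ball (\row_i q i, k) x.
  by split=> // i j; rewrite !mxE (ord1 i); exact: qf.
exists (\row_i q i, k); split=> // y By.
have le := @le_ball R V.
exact: ball_splitr (le _ _ _ (ltW ke) _ Bt) (le _ _ _ (ltW ke) _ By).
Qed.

Lemma rational_ballP x (U : set V) : nbhs x U ->
  exists p, rational_ball p x /\ rational_ball p `<=` U.
Proof.
move=> /nbhs_ballP[e /= e0 eU]; have [p [px pe _]] := rational_ball_small x e0.
by exists p; split=> //; exact: subset_trans eU.
Qed.

Lemma open_rational_balls (U : set V) : open U ->
  U = \bigcup_p (if `[< rational_ball p `<=` U >] then rational_ball p else set0).
Proof.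
move=> oU; apply/seteqP; split=> x; last first.
  by case=> p _; case: ifPn => // /asboolP; exact.
move=> Ux; have [p [px pU]] := rational_ballP (open_nbhs_nbhs (conj oU Ux)).
by exists p => //; case: asboolP.
Qed.

Definition box (a b : 'I_n -> R) : set V := [set x | forall i, a i < x ord0 i < b i].

Lemma boxE a b : box a b = [set x | forall i, `]a i, b i[%classic (x ord0 i)].
Proof. by apply/seteqP; split=> y h i; have := h i; rewrite /= in_itv/=. Qed.

Lemma boxI a b c d : box a b `&` box c d =
  box (fun i => Num.max (a i) (c i)) (fun i => Num.min (b i) (d i)).
Proof.
apply/seteqP; split=> x /=.
  by move=> [h k] i; rewrite gt_max lt_min; case/andP: (h i) (k i) => -> -> /andP[-> ->].
move=> h; split=> i; have := h i; rewrite gt_max lt_min.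
  by case/andP => /andP[-> _] /andP[-> _].
by case/andP => /andP[_ ->] /andP[_ ->].
Qed.

Lemma rational_ball_box p : rational_ball p =
  box (fun i => ratr (p.1 ord0 i) - p.2.+1%:R^-1) (fun i => ratr (p.1 ord0 i) + p.2.+1%:R^-1).
Proof.
apply/seteqP; split=> x.
  move=> [_ h] i; have := h ord0 i; rewrite mxE /ball/= distrC ltr_distl; exact.
by move=> h; split=> // i j; rewrite (ord1 i) mxE /ball/= distrC ltr_distl; exact: h.
Qed.

Lemma open_box a b : open (box a b).
Proof.
rewrite openE => x h; rewrite /interior /=.
apply: (@filter_forall _ _ (fun (i : 'I_n) (y : V) => a i < y ord0 i < b i) (nbhs x) (nbhs_filter x)) => i.
apply: (@coord_continuous R 1 n ord0 i x [set t : R | a i < t < b i]).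
by have := near_in_itvoo (h i); apply: filterS => y; rewrite in_itv.
Qed.

Lemma measurable_box a b : measurable (box a b).
Proof. by apply: open_measurable_rV; exact: open_box. Qed.

Definition boxes : set (set V) := [set A | exists a b, A = box a b].

(** Every open set is a countable union of rational balls, which are boxes. Measures can then be
    compared on boxes, whose volume is explicit and which are stable under intersection. *)
Lemma measurable_boxes : @measurable _ V = <<s boxes >>.
Proof.
rewrite measurable_rVE; apply/seteqP; split; last first.
  apply: smallest_sub; first exact: smallest_sigma_algebra.
  by move=> _ [a [b ->]]; apply: sub_sigma_algebra; exact: open_box.
apply: smallest_sub; first exact: smallest_sigma_algebra.
move=> U oU; rewrite (open_rational_balls oU).
have : @measurable _ (g_sigma_algebraType boxes)
  (\bigcup_p (if `[< rational_ball p `<=` U >] then rational_ball p else set0)).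
  apply: countable_bigcupT_measurable => // p; case: ifP => // _.
  rewrite rational_ball_box; apply: sub_sigma_algebra.
  by exists (fun i => ratr (p.1 ord0 i) - p.2.+1%:R^-1),
    (fun i => ratr (p.1 ord0 i) + p.2.+1%:R^-1).
exact.
Qed.

Definition big_box (k : nat) : set V := box (fun=> - k%:R) (fun=> k%:R).

Lemma box_cover : \bigcup_k big_box k = setT.
Proof.
apply/seteqP; split=> // x _; exists (Num.truncn (\sum_i `|x ord0 i|)).+1 => // i.
rewrite -ltr_norml (le_lt_trans _ (truncnS_gt _))//.
by rewrite (bigD1 i)//= lerDl sumr_ge0.
Qed.

Lemma measure_unique_boxes (m1 m2 : {measure set V -> \bar R}) :
  (forall a b, m1 (box a b) = m2 (box a b)) ->
  (forall k, (m1 (big_box k) < +oo)%E) ->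
  forall A, measurable A -> m1 A = m2 A.
Proof.
move=> m12 moo A mA.
apply: (@measure_unique _ _ _ boxes big_box) => //.
- exact: measurable_boxes.
- move=> _ _ [a [b ->]] [c [d ->]]; rewrite boxI.
  by exists (fun i => Num.max (a i) (c i)), (fun i => Num.min (b i) (d i)).
- by move=> k; exists (fun=> - k%:R), (fun=> k%:R).
- exact: box_cover.
- by move=> _ [a [b ->]]; exact: m12.
Qed.

Lemma lebesgue_box a b : leb (box a b) = (\prod_i Num.max 0 (b i - a i))%:E.
Proof.
rewrite boxE.
rewrite (@lebesgue_measure_rV_box R n (fun i => `]a i, b i[%classic))//.
rewrite -prodEFin; apply: eq_bigr => i _.
rewrite lebesgue_measure_itv/= lte_fin.
have [h|h] := ltP; first by rewrite -EFinB max_r// subr_ge0 ltW.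
by rewrite max_l// subr_le0.
Qed.

Lemma measurable_translation (a : V) : measurable_fun setT (fun x : V => x + a).
Proof.
apply: measurable_rV => i.
under eq_fun do rewrite mxE.
by apply: measurable_funD => //; exact: measurable_coord.
Qed.

End space.

(** * Translation invariance and integrals of derivatives *)

Section integrals.
Context {R : realType} {n : nat}.
Local Notation V := 'rV[R]_n.
Local Notation leb := (lebesgue_measure_rV R n).
Implicit Types (f w dw : V -> R).

(* No measurability is required of the larger function. *)
Lemma ge0_le_integral_nomeas d (T : measurableType d) (mu : {measure set T -> \bar R})
    (D : set T) (f1 f2 : T -> \bar R) : measurable D ->
  (forall x, D x -> 0 <= f1 x)%E -> (forall x, D x -> f1 x <= f2 x)%E ->
  (\int[mu]_(x in D) f1 x <= \int[mu]_(x in D) f2 x)%E.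
Proof.
move=> mD f10 f12.
have f20 x : D x -> (0 <= f2 x)%E by move=> Dx; exact: le_trans (f10 _ Dx) (f12 _ Dx).
rewrite !ge0_integralE//.
apply: le_ereal_sup => _ [h /= hf <-]; exists h => //= x.
have := hf x; rewrite /restrict; case: ifPn => // /set_mem Dx /le_trans; apply.
exact: f12.
Qed.

Lemma lebesgue_big_box_fin k : (leb (big_box k) < +oo)%E.
Proof. by rewrite /big_box lebesgue_box ltry. Qed.

Lemma lebesgue_translation (a : V) A : measurable A ->
  leb A = leb ((fun x => x + a) @^-1` A).
Proof.
move=> mA.
pose T (x : V) := x + a; have mT : measurable_fun setT T := measurable_translation a.
pose m0 : {measure set V -> \bar R} := pushforward leb T.
pose m := m0 mT; have -> : leb (T @^-1` A) = m A by [].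
have mbox b c : m (box b c) = leb (box b c).
  transitivity (leb (box (fun i => b i - a ord0 i) (fun i => c i - a ord0 i))).
    rewrite /m /pushforward; congr (leb _); apply/seteqP; split=> x /= h i; have := h i.
      by rewrite mxE ltrBlDr ltrBrDr.
    by rewrite mxE ltrBlDr ltrBrDr.
  rewrite !lebesgue_box; congr EFin; apply: eq_bigr => i _; congr (Num.max _ _); ring.
apply: measure_unique_boxes => // k.
exact: lebesgue_big_box_fin.
Qed.

Lemma ge0_integral_translation (a : V) (f : V -> \bar R) : measurable_fun setT f ->
  (forall x, 0 <= f x)%E -> (\int[leb]_x f (x + a)%R = \int[leb]_x f x)%E.
Proof.
move=> mf f0; have mt := @measurable_translation R n a.
have := ge0_integral_pushforward mt leb measurableT mf (fun x _ => f0 x).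
rewrite preimage_setT => <-.
by apply: eq_measure_integral => A mA _; apply/esym; exact: lebesgue_translation.
Qed.

Lemma integral_translation (a : V) (f : V -> \bar R) : measurable_fun setT f ->
  (\int[leb]_x f (x + a)%R = \int[leb]_x f x)%E.
Proof.
move=> mf; rewrite integralE [RHS]integralE; congr (_ - _)%E.
  rewrite -(ge0_integral_translation a (measurable_funepos mf) (funepos_ge0 f)).
  by apply: eq_integral => x _; rewrite !funeposE.
rewrite -(ge0_integral_translation a (measurable_funeneg mf) (funeneg_ge0 f)).
by apply: eq_integral => x _; rewrite !funenegE.
Qed.

Lemma integrable_bounded d (T : measurableType d) (m : {measure set T -> \bar R})
    (f : T -> R) (A : set T) B : measurable A -> (m A < +oo)%E ->
  measurable_fun A f -> (forall x, A x -> `|f x| <= B) -> m.-integrable A (EFin \o f).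
Proof.
move=> mA Afin mf fB; apply: measurable_bounded_integrable => //.
by exists B; split; rewrite ?num_real// => M BM x Ax /=; rewrite (le_trans (fB x Ax))// ltW.
Qed.

Lemma negligible_bigcup_countType d (T : measurableType d) (m : {measure set T -> \bar R})
    (I : countType) (A : I -> set T) : (forall i, m.-negligible (A i)) ->
  m.-negligible (\bigcup_i A i).
Proof.
move=> A0; apply: (@negligibleS _ _ _ _ (\bigcup_k oapp A set0 (unpickle k))).
  by move=> x [i _ Ax]; exists (pickle i) => //; rewrite pickleK.
by apply: negligible_bigcup => k; case: unpickle => [i|] //=; exact: negligible_set0.
Qed.

Definition vanishes_off M f := forall x, ~ cube 0 M x -> f x = 0.

Lemma continuous_bounded_off M f : continuous f -> vanishes_off M f ->
  exists B : R, 0 <= B /\ forall x : V, `|f x| <= B.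
Proof.
move=> cf f0.
have : compact (f @` cube 0 M).
  by apply: continuous_compact; [exact: continuous_subspaceT|exact: compact_cube].
move=> /compact_bounded[B [_ BM]]; exists (`|B| + 1); split=> [|x].
  by rewrite addr_ge0.
have [xM|xM] := pselect (cube 0 M x); last by rewrite f0// normr0 addr_ge0.
by apply: (BM (`|B| + 1)); [rewrite (le_lt_trans (ler_norm _))// ltrDl|exists x].
Qed.

Lemma lebesgue_cube_fin (x : V) r : (leb (cube x r) < +oo)%E.
Proof.
have [r0|r0] := leP 0 r; first by rewrite lebesgue_cube// ltry.
apply: (@le_lt_trans _ _ (leb (cube x 0))); last by rewrite lebesgue_cube// ltry.
by apply: le_measure; rewrite ?inE; [exact: measurable_cube..|apply: cube_le; exact: ltW].
Qed.

Lemma integrable_vanishing M f B : measurable_fun setT f -> vanishes_off M f ->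
  (forall x : V, `|f x| <= B) -> leb.-integrable setT (EFin \o f).
Proof.
move=> mf f0 fB.
have -> : EFin \o f = (EFin \o f) \_ (cube 0 M).
  apply/funext => x; rewrite /restrict; case: ifPn => // /negP xM /=.
  by rewrite f0// => h; apply: xM; rewrite inE.
apply: (proj1 (@integrable_mkcond _ _ _ leb _ _ (@measurable_cube R n 0 M))).
apply: (@integrable_bounded _ _ _ _ _ B) => //; first exact: measurable_cube.
  exact: lebesgue_cube_fin.
exact: measurable_funTS.
Qed.

Lemma integrable_continuous_off M f : continuous f -> vanishes_off M f ->
  leb.-integrable setT (EFin \o f).
Proof.
move=> cf f0; have [B [_ fB]] := continuous_bounded_off cf f0.
by apply: integrable_vanishing f0 fB; exact: continuous_measurable_rV.
Qed.

Lemma is_derive_line w (x v : V) (t d : R) :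
  is_derive (x + t *: v) v w d -> is_derive t 1 (fun s => w (x + s *: v)) d.
Proof.
move=> [dw wd].
have E : (fun h : R => h^-1 *: (((fun s => w (x + s *: v)) \o shift t) (h *: 1) -
      w (x + t *: v))) = (fun h => h^-1 *: ((w \o shift (x + t *: v)) (h *: v) - w (x + t *: v))).
  apply/funext => h /=; congr (_ *: (w _ - _)).
  by rewrite /= scalerDl -[h *: 1]/(h * 1) mulr1; rewrite addrCA.
by split; [rewrite /derivable E|rewrite /derive E].
Qed.

(** By translation invariance each difference quotient of w in the direction v has integral 0. By
    the mean value theorem it is bounded by sup |dw|, and steps of length at most 1 keep it
    supported in the cube of half-side M + 1, so dominated convergence applies. For w a product this
    is integration by parts. *)
Lemma integral_derivative0 w dw (v : V) M : (forall i, `|v ord0 i| <= 1) ->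
  continuous w -> continuous dw -> vanishes_off M w -> vanishes_off M dw ->
  (forall x : V, is_derive x v w (dw x)) -> (\int[leb]_x (dw x)%:E = 0)%E.
Proof.
move=> v1 cw cdw w0 dw0 wdw.
have [B [B0 dwB]] := continuous_bounded_off cdw dw0.
pose h k : R := k.+1%:R^-1.
have h0 k : 0 < h k by rewrite invr_gt0.
have h1 k : h k <= 1 by rewrite invf_le1// ler1n.
pose F k (x : V) := (h k)^-1 * (w (x + h k *: v) - w x).
have iw := integrable_continuous_off cw w0.
have mw := continuous_measurable_rV cw.
have mwh k : measurable_fun setT (fun x : V => w (x + h k *: v)).
  by apply: measurableT_comp => //; exact: measurable_translation.
have mF k : measurable_fun setT (F k).
  apply: measurable_funM; first exact: measurable_cst.
  exact: measurable_funB.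
have wh0 k : vanishes_off (M + 1) (fun x : V => w (x + h k *: v)).
  move=> x xM; apply: w0; apply: contra_not xM => H i.
  have := H i; rewrite !mxE => H1.
  have -> : x ord0 i - 0 = (x ord0 i + h k * v ord0 i - 0) - h k * v ord0 i by ring.
  rewrite (le_trans (ler_normB _ _))// lerD// normrM.
  by rewrite mulr_ile1// gtr0_norm.
have [Bw [_ wB]] := continuous_bounded_off cw w0.
have iwh k : leb.-integrable setT (EFin \o (fun x : V => w (x + h k *: v))).
  by apply: integrable_vanishing (wh0 k) (fun x => wB _).
have F00 k : (\int[leb]_x (F k x)%:E = 0)%E.
  rewrite /F; under eq_integral do rewrite EFinM EFinB.
  rewrite integralZl//; last first.
    exact: (integrableB measurableT (iwh k) iw).
  rewrite integralB_EFin//.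
  have /= -> := @integral_translation (h k *: v) (EFin \o w) ((measurable_EFinP _ _).2 mw).
  by rewrite subee ?mule0// integrable_fin_num.
have FB k (x : V) : `|F k x| <= B * \1_(cube (0 : V) (M + 1)) x.
  rewrite indicE; case: (asboolP (cube (0 : V) (M + 1) x)) => xM.
    rewrite mem_set// mulr1 /F.
    have [||c _] := @MVT_segment R (fun s => w (x + s *: v)) (fun s => dw (x + s *: v)) 0 (h k) (ltW (h0 k)).
    - by move=> s _; exact: is_derive_line.
    - by apply: derivable_within_continuous => s _; case: (is_derive_line (wdw (x + s *: v))).
    rewrite scale0r addr0 subr0 => ->.
    by rewrite mulrCA mulVf ?gt_eqF// mulr1.
  rewrite memNset// mulr0 /F wh0// w0 ?subrr ?mulr0 ?normr0//.
  by apply: contra_not xM; apply: cube_le; rewrite lerDl.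
have Fdw (x : V) : F ^~ x @ \oo --> dw x.
  have [dwx <-] := wdw x.
  have D : (fun k : R => k^-1 *: ((w \o shift x) (k *: v) - w x)) @ 0^' --> 'D_v w x := dwx.
  rewrite (_ : F ^~ x = fun k => (h k)^-1 *: ((w \o shift x) (h k *: v) - w x)).
    move/cvgr_dnbhsP : D; apply; split => [k|]; first by rewrite gt_eqF.
    exact: cvg_harmonic.
  by apply/funext => k; rewrite /F /= [h k *: v + x]addrC.
have mdw := continuous_measurable_rV cdw.
have iB : leb.-integrable setT (fun x : V => (B * \1_(cube (0 : V) (M + 1)) x)%:E).
  apply: (@integrable_vanishing (M + 1) _ B) => [|x xM|x].
  - apply: measurable_funM; first exact: measurable_cst.
    by apply: measurable_indic; exact: measurable_cube.
  - by rewrite indicE memNset// mulr0.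
  - rewrite normrM ger0_norm// ler_piMr// indicE; case: (_ \in _); rewrite ?normr1 ?normr0//.
have [||||_ _] := @dominated_convergence _ _ _ leb setT measurableT (fun k x => (F k x)%:E)
  (EFin \o dw) (fun x => (B * \1_(cube (0 : V) (M + 1)) x)%:E) _ _ _ iB.
- by move=> k; exact/measurable_EFinP.
- exact/measurable_EFinP.
- by apply: aeW => x _; apply: cvg_EFin; [exact: nearW|exact: Fdw].
- by apply: aeW => x k _; rewrite lee_fin; exact: FB.
rewrite (_ : [sequence _]_k = cst 0%E); last by apply/funext => k; exact: F00.
by move=> /cvg_lim <- //; rewrite lim_cst.
Qed.

End integrals.

(** * Smooth functions and tensor products *)

Section smooth1.
Context {R : realType}.
Implicit Types (f g df dg : R -> R) (k : nat) (a b c x : R).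

(** Differentiability k times, without continuity of the last derivative: in [smooth1] that
    continuity follows from the next order. *)
Fixpoint Ck k f : Prop :=
  if k is k'.+1 then (forall x, derivable f x 1) /\ Ck k' (derive1 f) else True.

Definition smooth1 f := forall k, Ck k f.

Lemma is_derive_derive1 f df : (forall x, is_derive x 1 f (df x)) -> derive1 f = df.
Proof. by move=> fdf; apply/funext => x; rewrite derive1E; exact: derive_val. Qed.

Lemma CkS k f df : (forall x, is_derive x 1 f (df x)) -> Ck k df -> Ck k.+1 f.
Proof.
move=> fdf Cdf; split; first by move=> x; exact: ex_derive.
by rewrite (is_derive_derive1 fdf).
Qed.

Lemma CkS_is_derive k f : Ck k.+1 f -> forall x, is_derive x 1 f (derive1 f x).
Proof. by move=> [df _] x; rewrite derive1E; exact: derivableP. Qed.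

Lemma CkW k f : Ck k.+1 f -> Ck k f.
Proof. by elim: k f => [//|k IH] f [df Cf]; split => //; exact: IH. Qed.

Lemma Ck_cst k c : Ck k (fun=> c).
Proof.
elim: k c => [//|k IH] c; apply: (@CkS _ _ (fun=> 0)) => // x.
Qed.

Lemma CkD k f g : Ck k f -> Ck k g -> Ck k (fun x => f x + g x).
Proof.
elim: k f g => [//|k IH] f g Cf Cg.
apply: (@CkS _ _ (fun x => derive1 f x + derive1 g x)).
  by move=> x; exact: is_deriveD (CkS_is_derive Cf x) (CkS_is_derive Cg x).
by apply: IH; [case: Cf|case: Cg].
Qed.

Lemma CkM k f g : Ck k f -> Ck k g -> Ck k (fun x => f x * g x).
Proof.
elim: k f g => [//|k IH] f g Cf Cg.
apply: (@CkS _ _ (fun x => f x * derive1 g x + g x * derive1 f x)).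
  by move=> x; exact: is_deriveM (CkS_is_derive Cf x) (CkS_is_derive Cg x).
by apply: CkD; apply: IH; [exact: CkW|case: Cg|exact: CkW|case: Cf].
Qed.

Lemma is_derive_affine f a b x (d : R) : is_derive (a * x + b) 1 f d ->
  is_derive x 1 (fun y => f (a * y + b)) (a * d).
Proof.
move=> fdf.
have D : is_derive x 1 (fun y : R => a * y + b) a.
  have := is_deriveD (is_deriveZ a (is_derive_id x 1)) (is_derive_cst b x 1).
  by rewrite addr0 -[a *: 1]/(a * 1) mulr1.
have := @is_derive1_comp _ f (fun y : R => a * y + b) x _ _ fdf D.
by rewrite mulrC.
Qed.

Lemma Ck_affine k f a b : Ck k f -> Ck k (fun x => f (a * x + b)).
Proof.
elim: k f => [//|k IH] f Cf.
apply: (@CkS _ _ (fun x => a * derive1 f (a * x + b))).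
  by move=> x; apply: is_derive_affine; exact: (CkS_is_derive Cf).
by apply: CkM; [exact: Ck_cst|apply: IH; case: Cf].
Qed.

Lemma CkV k f : (forall x, f x != 0) -> Ck k f -> Ck k (fun x => (f x)^-1).
Proof.
move=> f0; elim: k => [//|k IH] Cf.
have Ck' := CkW Cf.
apply: (@CkS _ _ (fun x => (-1 * derive1 f x) * ((f x)^-1 * (f x)^-1))).
  move=> x; have := CkS_is_derive Cf x => Dx.
  split; first exact: derivableV (f0 x) _.
  rewrite deriveV// derive_val -exprVn expr2 -[_ *: _]/(_ * _); ring.
by apply: CkM; [apply: CkM; [exact: Ck_cst|by case: Cf]|apply: CkM; exact: IH].
Qed.

Lemma smooth1_is_derive f : smooth1 f -> forall x, is_derive x 1 f (derive1 f x).
Proof. by move=> /(_ 1%N); exact: CkS_is_derive. Qed.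

Lemma smooth1_derive1 f : smooth1 f -> smooth1 (derive1 f).
Proof. by move=> sf k; case: (sf k.+1). Qed.

Lemma smooth1_continuous f : smooth1 f -> continuous f.
Proof.
move=> /(_ 1%N)[df _] x; apply: differentiable_continuous.
exact/derivable1_diffP.
Qed.

(** The classical flat function exp (-1/x), with powers of 1/x in front to make the family stable,
    up to linear combinations, under differentiation; smoothness is then an induction on the
    order. *)
Definition flat (m : nat) x := if 0 < x then x^-1 ^+ m * expR (- x^-1) else 0.

Lemma flat_ge0 m x : 0 <= flat m x.
Proof.
by rewrite /flat; case: ifP => // x0; rewrite mulr_ge0 ?expR_ge0// exprn_ge0// invr_ge0 ltW.
Qed.

(** The exponential series bounds exp y below by y^(m+1) / (m+1)!, here with y = 1/x. *)
Lemma flat_le m x : 0 < x -> flat m x <= m.+1`!%:R * x.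
Proof.
move=> x0; rewrite /flat x0 expRN.
have y0 : 0 < x^-1 by rewrite invr_gt0.
rewrite ler_pdivrMr ?expR_gt0// mulrAC -ler_pdivrMr// -exprSr.
rewrite -ler_pdivrMl ?ltr0n ?fact_gt0// mulrC.
apply: le_trans (expR_ge1Dxn m (ltW y0)).
by rewrite lerDr.
Qed.

Lemma is_derive_quadratic f x C : 0 <= C ->
  (forall h, `|f (h + x) - f x| <= C * h ^+ 2) -> is_derive x 1 f 0.
Proof.
move=> C0 fC.
have L : (fun h : R => h^-1 *: ((f \o shift x) (h *: 1) - f x)) @ 0^' --> (0 : R).
  apply/cvgr0Pnorm_le => e e0; near=> h.
  rewrite /= -[h *: 1]/(h * 1) mulr1 normrM.
  have h0 : h != 0 by near: h; exact: nbhs_dnbhs_neq.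
  rewrite normfV mulrC ler_pdivrMr ?normr_gt0// (le_trans (fC h))//.
  rewrite -real_normK ?num_real// expr2 mulrA ler_wpM2r//.
  have hC : `|h| <= e / (C + 1) by near: h; apply: dnbhs0_le; rewrite divr_gt0// ltr_wpDl.
  move: hC; rewrite ler_pdivlMr//; have := normr_ge0 h; nra.
split; first exact: (cvgP _ L).
exact: cvg_lim L.
Unshelve. all: by end_near.
Qed.

Lemma is_derive_flat m x :
  is_derive x 1 (flat m) (flat m.+2 x - m%:R * flat m.+1 x).
Proof.
have [x0|x0|->] := ltgtP x 0.
- rewrite /flat ltNge ltW//= mulr0 subrr.
  apply: (@near_eq_is_derive _ _ _ (cst 0)) => //.
  by near=> y; rewrite ltNge ltW//=; near: y; exact: lt_nbhsl.
- apply: (@near_eq_is_derive _ _ _ (fun x => x^-1 ^+ m * expR (- x^-1))).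
  + by near=> y; rewrite /flat ifT//; near: y; exact: lt_nbhsr.
  + have xN : x != 0 by rewrite gt_eqF.
    have D1 : is_derive x 1 (fun y : R => y^-1) (- (x^-1 ^+ 2)).
      split; first exact: derivableV.
      by rewrite (@deriveV _ _ id)// derive_val -exprVn -[_ *: _]/(_ * _) mulr1.
    have D2 : is_derive x^-1 1 (fun y : R => y ^+ m) (m%:R * x^-1 ^+ m.-1).
      have := @is_deriveX _ _ (@id R) m x^-1 1 1 (is_derive_id _ _).
      rewrite -[_ *: _]/(_ * _) mulr1.
      by rewrite exprfctE.
    have D3 : is_derive x^-1 1 (fun y : R => expR (- y)) (- expR (- x^-1)).
      have := @is_derive1_comp _ expR (fun y : R => - y) x^-1 _ _ (is_derive_expR _) (is_deriveNid _ _).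
      by rewrite mulrN mulr1.
    have := @is_derive1_comp _ _ (fun y : R => y^-1) x _ _ (is_deriveM D2 D3) D1.
    set u := (X in is_derive _ _ _ X -> _); set v := (X in _ -> is_derive _ _ _ X).
    suff -> : u = v by [].
    rewrite /u /v /flat x0 /GRing.scale/=; set y := x^-1; set E := expR (- y).
    by case: (m) => [|k] /=; rewrite ?expr0 !exprS ?expr0; ring.
(* For h > 0, [flat m h] is h times [flat m.+1 h], hence at most (m+2)! h^2: the derivative at 0 is
   0. *)
- rewrite {2 3}/flat ltxx mulr0 subrr.
  apply: (@is_derive_quadratic _ _ m.+2`!%:R) => // h.
  rewrite addr0 {2}/flat ltxx subr0.
  have [h0|h0] := ltP 0 h; last by rewrite /flat ltNge h0 normr0 mulr_ge0// sqr_ge0.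
  rewrite ger0_norm ?flat_ge0//.
  have -> : flat m h = h * flat m.+1 h.
    by rewrite /flat h0 exprS !mulrA divff ?gt_eqF// mul1r.
  by rewrite expr2 mulrCA ler_pM2l// flat_le.
Unshelve. all: by end_near.
Qed.

Lemma smooth1_flat m : smooth1 (flat m).
Proof.
move=> k; elim: k m => [//|k IH] m.
apply: (@CkS _ _ (fun x => flat m.+2 x + (- m%:R) * flat m.+1 x)).
  by move=> x; rewrite mulNr; exact: is_derive_flat.
by apply: CkD => //; apply: CkM => //; exact: Ck_cst.
Qed.

Lemma flat_le1 x : flat 0 x <= 1.
Proof.
rewrite /flat; case: ifP => // x0; rewrite expr0 mul1r -expR0 ler_expR.
by rewrite oppr_le0 invr_ge0 ltW.
Qed.

Lemma flat_gt0 x : 0 < x -> 0 < flat 0 x.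
Proof. by move=> x0; rewrite /flat x0 expr0 mul1r expR_gt0. Qed.

Lemma flat_le0 m x : x <= 0 -> flat m x = 0.
Proof. by rewrite /flat ltNge => ->. Qed.

Lemma flat_homo : {homo flat 0 : x y / x <= y}.
Proof.
move=> x y xy; have [x0|x0] := ltP 0 x; last by rewrite flat_le0 ?flat_ge0.
rewrite /flat x0 (lt_le_trans x0 xy) !expr0 !mul1r ler_expR lerN2.
by rewrite lef_pV2 ?posrE// (lt_le_trans x0).
Qed.

Lemma cvg_flat x : (fun k => flat 0 (k%:R * x)) @ \oo --> (if 0 < x then 1 else 0 : R).
Proof.
case: ifPn => [x0|]; last first.
  rewrite -leNgt => x0; rewrite (_ : (fun _ => _) = cst 0); first exact: cvg_cst.
  by apply/funext => k; rewrite flat_le0// mulr_ge0_le0.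
rewrite -cvg_shiftS /=.
rewrite (_ : (fun _ => _) = fun k => expR (- (x^-1 * k.+1%:R^-1))); last first.
  by apply/funext => k; rewrite /flat mulr_gt0 ?ltr0n// expr0 mul1r invfM mulrC.
suff : (fun k => expR (- (x^-1 * k.+1%:R^-1))) @ \oo --> expR (- (x^-1 * 0)).
  by rewrite mulr0 oppr0 expR0.
apply: continuous_cvg; first exact: continuous_expR.
by apply: cvgN; apply: cvgMr; exact: cvg_harmonic.
Qed.

(** A smooth transition from 0 to 1 across [-1, 1]. Its derivative serves as a mollifier whose
    primitive, and hence whose mass, is explicit. *)
Definition step x := flat 0 (x + 1) / (flat 0 (x + 1) + flat 0 (1 - x)).

Lemma step_den x : 0 < flat 0 (x + 1) + flat 0 (1 - x).
Proof.
have [x1|x1] := ltP 0 (x + 1); first by rewrite ltr_wpDr ?flat_ge0 ?flat_gt0.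
by rewrite ltr_wpDl ?flat_ge0// flat_gt0//; lra.
Qed.

Lemma smooth1_step : smooth1 step.
Proof.
have A k : Ck k (fun x => flat 0 (x + 1)).
  have := @Ck_affine k _ 1 1 (@smooth1_flat 0 k).
  by rewrite (_ : (fun _ => _) = (fun x => flat 0 (x + 1)))//; apply/funext => x; rewrite mul1r.
have B k : Ck k (fun x => flat 0 (1 - x)).
  have := @Ck_affine k _ (-1) 1 (@smooth1_flat 0 k).
  by rewrite (_ : (fun _ => _) = (fun x => flat 0 (1 - x)))//; apply/funext => x; rewrite mulN1r addrC.
move=> k; apply: CkM => //; apply: CkV; last exact: CkD.
by move=> x; rewrite gt_eqF// step_den.
Qed.

Lemma step_le x : x <= -1 -> step x = 0.
Proof. by move=> x1; rewrite /step flat_le0 ?mul0r//; lra. Qed.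

Lemma step_ge x : 1 <= x -> step x = 1.
Proof.
move=> x1; rewrite /step [flat 0 (1 - x)]flat_le0 ?addr0; last lra.
by rewrite divff// gt_eqF// flat_gt0//; lra.
Qed.

Lemma step_homo : {homo step : x y / x <= y}.
Proof.
move=> x y xy; rewrite /step ler_pdivrMr ?step_den// mulrAC ler_pdivlMr ?step_den//.
have A : flat 0 (x + 1) <= flat 0 (y + 1) by apply: flat_homo; lra.
have B : flat 0 (1 - y) <= flat 0 (1 - x) by apply: flat_homo; lra.
have := flat_ge0 0 (x + 1); have := flat_ge0 0 (1 - y); nra.
Qed.

Lemma step_ge0 x : 0 <= step x.
Proof. by rewrite /step divr_ge0 ?flat_ge0// ltW// step_den. Qed.

Lemma step_le1 x : step x <= 1.
Proof. by rewrite /step ler_pdivrMr ?step_den// mul1r lerDl flat_ge0. Qed.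

Lemma derive1_step_ge0 x : 0 <= derive1 step x.
Proof.
rewrite derive1E.
have [D _] := smooth1_is_derive smooth1_step x.
rewrite /derive; apply: limr_ge; first exact: D.
near=> h; rewrite /= -[h *: 1]/(h * 1) mulr1 -[_ *: _]/(_ * _).
have [h0|h0] := leP 0 h.
  by rewrite mulr_ge0 ?invr_ge0// subr_ge0 step_homo// lerDr.
by rewrite mulr_le0// ?invr_le0 ?subr_le0; [exact: ltW|apply: step_homo; lra].
Unshelve. all: by end_near.
Qed.

Lemma derive1_step0 x : 1 < `|x| -> derive1 step x = 0.
Proof.
move=> x1; rewrite derive1E.
have [x0|x0] := leP 0 x.
  rewrite (@near_eq_derive _ _ _ step (cst 1)) ?derive_cst//.
  near=> y; rewrite step_ge// ltW//; near: y.
  by apply: lt_nbhsr; rewrite -(ger0_norm x0).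
rewrite (@near_eq_derive _ _ _ step (cst 0)) ?derive_cst//.
near=> y; rewrite step_le// ltW//; near: y.
by apply: lt_nbhsl; rewrite ltrNr -(ltr0_norm x0).
Unshelve. all: by end_near.
Qed.

Lemma smooth1_bounded f (a b : R) : smooth1 f -> (forall x, f x != 0 -> a <= x <= b) ->
  exists B, 0 <= B /\ forall x, `|f x| <= B.
Proof.
move=> sf fab.
have : compact (f @` `[a, b]).
  apply: continuous_compact; last exact: segment_compact.
  by apply: continuous_subspaceT; exact: smooth1_continuous.
move=> /compact_bounded[B [_ BM]]; exists (`|B| + 1); split=> [|x].
  by rewrite addr_ge0.
have [->|/fab xab] := eqVneq (f x) 0; first by rewrite normr0 addr_ge0.
by apply: (BM (`|B| + 1)); [rewrite (le_lt_trans (ler_norm _))// ltrDl|exists x].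
Qed.

(** Normalised to be at least 1 on [-1, 1]; it vanishes off [-2, 2]. *)
Definition bump x := (flat 0 1) ^- 2 * (flat 0 (x + 2) * flat 0 (2 - x)).

Lemma smooth1_bump : smooth1 bump.
Proof.
have A k : Ck k (fun x => flat 0 (x + 2)).
  have := @Ck_affine k _ 1 2 (@smooth1_flat 0 k).
  by rewrite (_ : (fun _ => _) = (fun x => flat 0 (x + 2)))//; apply/funext => x; rewrite mul1r.
have B k : Ck k (fun x => flat 0 (2 - x)).
  have := @Ck_affine k _ (-1) 2 (@smooth1_flat 0 k).
  by rewrite (_ : (fun _ => _) = (fun x => flat 0 (2 - x)))//; apply/funext => x; rewrite mulN1r addrC.
by move=> k; apply: CkM; [exact: Ck_cst|exact: CkM].
Qed.

Lemma bump_ge0 x : 0 <= bump x.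
Proof. by rewrite /bump !mulr_ge0 ?flat_ge0// invr_ge0 exprn_ge0// flat_ge0. Qed.

Lemma bump_ge1 x : `|x| <= 1 -> 1 <= bump x.
Proof.
rewrite ler_norml => /andP[x1 x2].
have f1 : 0 < flat 0 1 by exact: flat_gt0.
rewrite /bump mulrC ler_pdivlMr ?exprn_gt0// mul1r expr2.
by apply: ler_pM; rewrite ?(ltW f1)//; apply: flat_homo; lra.
Qed.

Lemma bump_neq0 x : bump x != 0 -> `|x| <= 2.
Proof.
apply: contraNT; rewrite -ltNge lter_normr => /orP[x2|x2].
  by rewrite /bump [flat 0 (2 - x)]flat_le0 ?mulr0//; lra.
by rewrite /bump [flat 0 (x + 2)]flat_le0 ?mul0r ?mulr0//; lra.
Qed.

Lemma derive1_bump_neq0 x : derive1 bump x != 0 -> `|x| <= 2.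
Proof.
apply: contraNT; rewrite -ltNge => x2; rewrite derive1E.
rewrite (@near_eq_derive _ _ _ bump (cst 0)) ?derive_cst//.
near=> y; apply/eqP; apply: contraT => /bump_neq0; rewrite leNgt => /negP; elim.
near: y; have := @norm_continuous _ R^o x.
by move/cvgr_gt; apply.
Unshelve. all: by end_near.
Qed.

End smooth1.

(** * Tensor products and test functions *)

Section tens.
Context {R : realType} {n : nat}.
Local Notation V := 'rV[R]_n.
Implicit Types (f : 'I_n -> R -> R) (u w : V -> R) (Omega : set V).

(** Partial derivatives of such a product are again of this form, which reduces smoothness in n
    variables to that of each factor. *)
Definition tens f (x : V) : R := \prod_(i < n) f i (x ord0 i).

Definition upd f (i : 'I_n) (g : R -> R) := fun j => if j == i then g else f j.

Lemma tensD1 f (i : 'I_n) (x : V) :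
  tens f x = f i (x ord0 i) * \prod_(j < n | j != i) f j (x ord0 j).
Proof. by rewrite /tens (bigD1 i). Qed.

Lemma tens_updE f (i : 'I_n) g (x : V) :
  tens (upd f i g) x = g (x ord0 i) * \prod_(j < n | j != i) f j (x ord0 j).
Proof.
rewrite (tensD1 _ i) /upd eqxx; congr (_ * _); apply: eq_bigr => j /negbTE ji.
by rewrite ji.
Qed.

Lemma is_derive_tens f (i : 'I_n) (x : V) :
  derivable (f i) (x ord0 i) 1 ->
  is_derive x (delta_mx ord0 i) (tens f) (tens (upd f i (derive1 (f i))) x).
Proof.
move=> df; pose c := \prod_(j < n | j != i) f j (x ord0 j).
have E : (fun h : R => h^-1 *: ((tens f \o shift x) (h *: delta_mx ord0 i) - tens f x)) =
  (fun h : R => (h^-1 *: ((f i \o shift (x ord0 i)) (h *: 1) - f i (x ord0 i))) * c).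
  apply/funext => h /=; rewrite !(tensD1 _ i) !mxE !eqxx /=.
  rewrite [X in f i _ * X - _](_ : _ = c); last first.
    by apply: eq_bigr => j /negbTE ji; rewrite !mxE ji andbF mulr0 add0r.
  by rewrite -mulrBl -/c /GRing.scale/= mulrA.
have L : (fun h : R => (h^-1 *: ((f i \o shift (x ord0 i)) (h *: 1) - f i (x ord0 i))) * c)
    @ 0^' --> 'D_1 (f i) (x ord0 i) * c.
  by apply: cvgMl => //; exact: df.
split; first by rewrite /derivable E; exact: (cvgP _ L).
by rewrite /derive E (cvg_lim _ L)// tens_updE derive1E.
Qed.

Lemma continuous_tens f : (forall i, continuous (f i)) -> continuous (tens f).
Proof.
move=> cf; rewrite /tens; elim: (index_enum _) => [|i s IH].
  have -> : (fun x : V => \prod_(j <- [::]) f j (x ord0 j)) = cst 1.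
    by apply/funext => x; rewrite big_nil.
  by move=> x; exact: cst_continuous.
have -> : (fun x : V => \prod_(j <- i :: s) f j (x ord0 j)) =
    (fun x : V => f i (x ord0 i) * \prod_(j <- s) f j (x ord0 j)).
  by apply/funext => x; rewrite big_cons.
move=> x; apply: (@cvgM _ _ (nbhs x) (nbhs_filter x)); last exact: IH.
exact: cvg_comp (@coord_continuous R 1 n ord0 i x) (cf i _).
Qed.

Lemma upd_smooth1 f i g : (forall j, smooth1 (f j)) -> smooth1 g ->
  forall j, smooth1 (upd f i g j).
Proof. by move=> sf sg j; rewrite /upd; case: ifP. Qed.

Lemma partial_tens f i : (forall j, smooth1 (f j)) ->
  partial i (tens f) = tens (upd f i (derive1 (f i))).
Proof.
move=> sf; apply/funext => x; rewrite /partial.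
have [dfi _] := smooth1_is_derive (sf i) (x ord0 i).
have D := is_derive_tens dfi.
exact: derive_val.
Qed.

Lemma foldr_partial_tens f (s : seq 'I_n) : (forall j, smooth1 (f j)) ->
  exists g, (forall j, smooth1 (g j)) /\ foldr partial (tens f) s = tens g.
Proof.
move=> sf; elim: s => [|i s [g [sg E]]]; first by exists f.
exists (upd g i (derive1 (g i))); split.
  by apply: upd_smooth1 => //; exact: smooth1_derive1.
by rewrite /= E partial_tens.
Qed.

Lemma smooth_tens f : (forall j, smooth1 (f j)) -> smooth (tens f).
Proof.
move=> sf s; have [g [sg ->]] := foldr_partial_tens s sf; split.
  by apply: continuous_tens => j; exact: smooth1_continuous.
move=> i x; have [dgi _] := smooth1_is_derive (sg i) (x ord0 i).
by have [] := is_derive_tens dgi.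
Qed.

Lemma smooth_is_derive u i x : smooth u -> is_derive x (delta_mx ord0 i) u (partial i u x).
Proof. by move=> /(_ [::])[_ d]; apply: derivableP; exact: d. Qed.

Lemma smooth_continuous u : smooth u -> continuous u.
Proof. by move=> /(_ [::])[]. Qed.

Lemma smooth_partial u i : smooth u -> smooth (partial i u).
Proof. by move=> su s; have := su (s ++ [:: i]); rewrite foldr_cat. Qed.

Lemma foldr_partialD u w (s : seq 'I_n) : smooth u -> smooth w ->
  foldr partial (fun x => u x + w x) s = (fun x => foldr partial u s x + foldr partial w s x).
Proof.
move=> su sw; elim: s => [//|i s IH] /=; rewrite IH; apply/funext => x.
rewrite /partial; have [_ du] := su s; have [_ dw] := sw s.
exact: deriveD.
Qed.

Lemma foldr_partialZ u (c : R) (s : seq 'I_n) : smooth u ->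
  foldr partial (fun x => c * u x) s = (fun x => c * foldr partial u s x).
Proof.
move=> su; elim: s => [//|i s IH] /=; rewrite IH; apply/funext => x.
rewrite /partial; have [_ du] := su s.
exact: deriveZ.
Qed.

Lemma smoothD u w : smooth u -> smooth w -> smooth (fun x => u x + w x).
Proof.
move=> su sw s; rewrite foldr_partialD//.
have [cu du] := su s; have [cw dw] := sw s; split=> [x|i x].
  by apply: (@cvgD _ _ _ (nbhs x) (nbhs_filter x)); [exact: cu|exact: cw].
exact: derivableD.
Qed.

Lemma smoothZ (c : R) u : smooth u -> smooth (fun x => c * u x).
Proof.
move=> su s; rewrite foldr_partialZ//.
have [cu du] := su s; split=> [x|i x].
  by apply: (@cvgMr _ _ (nbhs x) (nbhs_filter x)); exact: cu.
exact: derivableZ.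
Qed.

Lemma smooth0 : smooth (fun _ : V => 0 : R).
Proof.
move=> s; have -> : foldr partial (fun _ : V => 0 : R) s = (fun=> 0).
  elim: s => [//|i s /= ->]; apply/funext => x.
  exact: derive_cst.
split; first by move=> x; exact: cst_continuous.
by move=> i x; exact: derivable_cst.
Qed.

Lemma fun_support_sub u (F : set V) : closed F -> (forall x, u x != 0 -> F x) ->
  fun_support u `<=` F.
Proof. by move=> cF uF; rewrite /fun_support closureE => x; apply. Qed.

Lemma test_function0 Omega : test_function Omega (fun _ : V => 0 : R).
Proof.
have E : fun_support (fun _ : V => 0 : R) = set0.
  by rewrite /fun_support (_ : [set _ | _] = set0) ?closure0//; apply/seteqP; split=> x //=; rewrite eqxx.
by split; [exact: smooth0|rewrite E; exact: compact0|rewrite E].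
Qed.

Lemma test_function_compact Omega u (K : set V) : smooth u -> compact K ->
  (forall x, u x != 0 -> K x) -> K `<=` Omega -> test_function Omega u.
Proof.
move=> su cK uK KO.
have sub : fun_support u `<=` K.
  by apply: fun_support_sub => //; exact: compact_closed hausdorff_rV cK.
split=> //; last exact: subset_trans sub KO.
exact: subclosed_compact (@closed_closure _ _) cK sub.
Qed.

Lemma test_functionD Omega u w : test_function Omega u -> test_function Omega w ->
  test_function Omega (fun x => u x + w x).
Proof.
move=> [su cu uO] [sw cw wO].
apply: (@test_function_compact _ _ (fun_support u `|` fun_support w)).
- exact: smoothD.
- exact: compactU.
- move=> x uw; have [u0|u0] := eqVneq (u x) 0; last by left; exact: subset_closure.
  by right; apply: subset_closure; move: uw; rewrite u0 add0r.
- by move=> x [/uO|/wO].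
Qed.

Lemma test_functionZ Omega (c : R) u : test_function Omega u ->
  test_function Omega (fun x => c * u x).
Proof.
move=> [su cu uO].
apply: (@test_function_compact _ _ (fun_support u)) => //; first exact: smoothZ.
by move=> x; rewrite mulf_eq0 negb_or => /andP[_ ux]; exact: subset_closure.
Qed.

Lemma test_function_sum Omega I (s : seq I) (u : I -> V -> R) :
  (forall i, test_function Omega (u i)) -> test_function Omega (fun x => \sum_(i <- s) u i x).
Proof.
move=> tu; elim: s => [|i s IH].
  have -> : (fun x : V => \sum_(i <- [::]) u i x) = (fun=> 0).
    by apply/funext => x; rewrite big_nil.
  exact: test_function0.
have -> : (fun x : V => \sum_(j <- i :: s) u j x) = (fun x => u i x + \sum_(j <- s) u j x).
  by apply/funext => x; rewrite big_cons.
exact: test_functionD.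
Qed.

Lemma partial_sum I (s : seq I) (u : I -> V -> R) i : (forall k, smooth (u k)) ->
  smooth (fun x => \sum_(k <- s) u k x) /\
  partial i (fun x => \sum_(k <- s) u k x) = (fun x => \sum_(k <- s) partial i (u k) x).
Proof.
move=> su; elim: s => [|k s [IH1 IH2]].
  have E (f : I -> V -> R) : (fun x => \sum_(k <- [::]) f k x) = (fun=> 0).
    by apply/funext => x; rewrite big_nil.
  rewrite !E; split; first exact: smooth0.
  by apply/funext => x; exact: derive_cst.
have E (f : I -> V -> R) : (fun x => \sum_(j <- k :: s) f j x) =
    (fun x => f k x + \sum_(j <- s) f j x).
  by apply/funext => x; rewrite big_cons.
rewrite (E u) (E (fun k => partial i (u k))); split; first exact: smoothD.
have /= -> := @foldr_partialD _ _ [:: i] (su k) IH1.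
by rewrite IH2.
Qed.

Lemma partialZ (c : R) u i x : smooth u -> partial i (fun x => c * u x) x = c * partial i u x.
Proof. by move=> su; have := foldr_partialZ c [:: i] su => /(congr1 (@^~ x)). Qed.

Definition cbox (a b : 'I_n -> R) : set V := [set x | forall i, a i <= x ord0 i <= b i].

Lemma compact_cbox a b : compact (cbox a b).
Proof.
rewrite (_ : cbox a b = [set x : V | forall i, `[a i, b i]%classic (x ord0 i)]).
  by apply: (@rV_compact _ _ (fun i => `[a i, b i]%classic)) => i; exact: segment_compact.
by apply/seteqP; split=> y h i; have := h i; rewrite /= in_itv.
Qed.

Lemma tens_neq0 f x : tens f x != 0 -> forall i, f i (x ord0 i) != 0.
Proof. by rewrite /tens => /prodf_neq0 h i; exact: h. Qed.

Lemma test_function_tens Omega f a b : (forall i, smooth1 (f i)) ->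
  (forall i s, f i s != 0 -> a i <= s <= b i) -> cbox a b `<=` Omega ->
  test_function Omega (tens f).
Proof.
move=> sf fab abO; apply: (@test_function_compact _ _ (cbox a b)) => //.
- exact: smooth_tens.
- exact: compact_cbox.
- by move=> x /tens_neq0 h i; exact: fab.
Qed.

Lemma coord_le_norm (x : V) i : `|x ord0 i| <= `|x|.
Proof.
rewrite [leRHS]/Num.norm /= mx_normrE.
by apply/bigmax_geP; right => /=; exists (ord0, i).
Qed.

Lemma test_function_vanishes Omega u : test_function Omega u ->
  exists M, vanishes_off M u /\ forall i, vanishes_off M (partial i u).
Proof.
move=> [su cu _].
have [M [_ MK]] := compact_bounded cu.
have K x : ~ cube 0 (`|M| + 1) x -> ~ fun_support u x.
  apply: contra_not => /(MK (`|M| + 1)).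
  rewrite (le_lt_trans (ler_norm _)) ?ltrDl// => /(_ isT) xM i.
  by apply: le_trans xM; rewrite mxE subr0; exact: coord_le_norm.
exists (`|M| + 1); split=> [x /K xM|i x /K xM].
  apply/eqP; apply: contraT => ux; exfalso; apply: xM; exact: subset_closure.
have o : open (~` fun_support u) by rewrite openC; exact: closed_closure.
rewrite /partial (@near_eq_derive _ _ _ u (cst 0)) ?derive_cst//.
near=> y; apply/eqP; apply: contraT => uy; exfalso.
have : (~` fun_support u) y by near: y; exact: open_nbhs_nbhs.
by apply; exact: subset_closure.
Unshelve. all: by end_near.
Qed.

End tens.

(** * Weak gradients *)

Section weak.
Context {R : realType} {n : nat}.
Local Notation V := 'rV[R]_n.
Local Notation leb := (lebesgue_measure_rV R n).
Implicit Types (u w g phi : V -> R) (Omega : set V).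

(** The measurability and the sign of H are arguments so that a measure structure can be attached to
    the resulting function. *)
Definition density_measure (H : V -> \bar R) of measurable_fun setT H &
  (forall x, 0 <= H x)%E := fun A => (\int[leb]_(x in A) H x)%E.

Section density.
Context (H : V -> \bar R) (mH : measurable_fun setT H) (H0 : forall x, (0 <= H x)%E).
Local Notation m := (density_measure mH H0).
Let m0 : m set0 = 0%E. Proof. exact: integral_set0. Qed.
Let m_ge0 A : (0 <= m A)%E. Proof. by apply: integral_ge0 => x _. Qed.
Let m_sigma : semi_sigma_additive m. Proof. exact: semi_sigma_additive_nng_induced. Qed.
HB.instance Definition _ := isMeasure.Build _ _ _ m m0 m_ge0 m_sigma.
End density.

(** The positive and negative parts of F are the densities of two finite measures that agree on
    boxes, hence on all measurable sets. *)
Lemma integral_boxes0_ae (F : V -> \bar R) : leb.-integrable setT F ->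
  (forall a b, (\int[leb]_(x in box a b) F x = 0)%E) -> ae_eq leb setT F (cst 0%E).
Proof.
move=> iF F0.
have mF : measurable_fun setT F := measurable_int _ iF.
pose mp : {measure set V -> \bar R} := density_measure (measurable_funepos mF) (funepos_ge0 F).
pose mn : {measure set V -> \bar R} := density_measure (measurable_funeneg mF) (funeneg_ge0 F).
have iFA A : measurable A -> leb.-integrable A F by move=> mA; exact: integrableS iF.
have mpn A : measurable A -> mp A = mn A.
  apply: measure_unique_boxes => [a b|k].
    have mb := measurable_box a b; have iFb := iFA _ mb.
    have := F0 a b; rewrite integralE -[X in (X - _)%E]/(mp (box a b)) -[X in (_ - X)%E]/(mn (box a b)).
    move=> /eqP; rewrite sube_eq ?add0e => [/eqP//||].
      by apply: integrable_fin_num => //; exact: integrable_funepos.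
    exact: fin_num_adde_defr.
  have mb := @measurable_box R n (fun=> - k%:R) (fun=> k%:R); have iFb := iFA _ mb.
  rewrite ltey_eq; apply/orP; left.
  by apply: integrable_fin_num => //; exact: integrable_funepos.
apply: integral_ae_eq => // E _ mE.
rewrite integral_cst// mul0e integralE -[X in (X - _)%E]/(mp E) -[X in (_ - X)%E]/(mn E) mpn//.
rewrite subee//; apply: integrable_fin_num => //.
by apply: integrable_funeneg => //; exact: iFA.
Qed.

(** In each coordinate the product of flat (k (s - a)) and flat (k (b - s)) tends to the indicator
    of ]a, b[ and vanishes off [a, b] for every k, so the supports stay in one compact box. *)
Lemma box_approx (a b : 'I_n -> R) : exists phi : nat -> V -> R,
  [/\ forall k Omega, cbox a b `<=` Omega -> test_function Omega (phi k),
      forall k x, 0 <= phi k x <= 1, forall k x, ~ cbox a b x -> phi k x = 0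
    & forall x, phi ^~ x @ \oo --> (\1_(box a b) x : R)].
Proof.
pose f (k : nat) i (s : R) := flat 0 (k%:R * (s - a i)) * flat 0 (k%:R * (b i - s)).
have sf k i : smooth1 (f k i).
  move=> l; apply: CkM.
    have := @Ck_affine _ l _ k%:R (- (k%:R * a i)) (@smooth1_flat R 0 l).
    by rewrite (_ : (fun _ => _) = (fun s => flat 0 (k%:R * (s - a i))))//; apply/funext => s; rewrite mulrBr.
  have := @Ck_affine _ l _ (- k%:R) (k%:R * b i) (@smooth1_flat R 0 l).
  by rewrite (_ : (fun _ => _) = (fun s => flat 0 (k%:R * (b i - s))))//; apply/funext => s; rewrite mulrBr mulNr addrC.
have fab k i s : f k i s != 0 -> a i <= s <= b i.
  rewrite /f mulf_eq0 negb_or => /andP[A B]; apply/andP; split; rewrite leNgt; apply/negP => H.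
    by move: A; rewrite flat_le0 ?eqxx// mulr_ge0_le0// subr_le0 ltW.
  by move: B; rewrite flat_le0 ?eqxx// mulr_ge0_le0// subr_le0 ltW.
have f01 k i s : 0 <= f k i s <= 1.
  by rewrite /f mulr_ge0 ?flat_ge0//= mulr_ile1 ?flat_ge0 ?flat_le1.
exists (fun k => tens (f k)); split.
- by move=> k Omega; apply: test_function_tens (fab k).
- by move=> k x; rewrite /tens prodr_ge0 ?prodr_ile1// => i _; case/andP: (f01 k i (x ord0 i)).
- move=> k x abx; apply/eqP; apply: contraT => /tens_neq0 h; exfalso; apply: abx => i.
  exact: fab (h i).
- move=> x.
  have fi i : (fun k => f k i (x ord0 i)) @ \oo --> (if a i < x ord0 i < b i then 1 else 0 : R).
    have -> : (if a i < x ord0 i < b i then 1 else 0 : R) =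
      (if 0 < x ord0 i - a i then 1 else 0) * (if 0 < b i - x ord0 i then 1 else 0).
      by rewrite !subr_gt0; case: (a i < _); case: (_ < b i); rewrite ?(mulr0,mul0r,mulr1).
    by apply: cvgM; exact: cvg_flat.
  have -> : \1_(box a b) x = \prod_(i < n) (if a i < x ord0 i < b i then 1 else 0 : R).
    rewrite indicE; case: (asboolP (box a b x)) => h.
      by rewrite mem_set//= big1// => i _; rewrite h.
    rewrite memNset//; move/existsNP : h => [i /negP/negbTE hi].
    by rewrite (bigD1 i)//= hi mul0r.
  rewrite /tens; elim: (index_enum _) => [|i s IH].
    rewrite big_nil (_ : (fun _ => _) = cst 1); first exact: cvg_cst.
    by apply/funext => k; rewrite big_nil.
  rewrite big_cons (_ : (fun _ => _) =
    (fun k => f k i (x ord0 i) * \prod_(j <- s) f k j (x ord0 j))).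
    exact: cvgM.
  by apply/funext => k; rewrite big_cons.
Qed.

Lemma integral_vanishing_off (D K : set V) (F : V -> \bar R) : K `<=` D ->
  (forall x, D x -> ~ K x -> F x = 0%E) -> (\int[leb]_(x in D) F x = \int[leb]_(x in K) F x)%E.
Proof.
move=> KD F0; rewrite integral_mkcond [RHS]integral_mkcond; apply: eq_integral => x _.
rewrite /patch; case: ifPn => xD; case: ifPn => xK //.
  by apply: F0; [exact: set_mem|move=> h; move: xK; rewrite mem_set].
by move: xD; rewrite mem_set//; apply: KD; exact: set_mem.
Qed.

Lemma integral_box0 Omega g (a b : 'I_n -> R) : cbox a b `<=` Omega ->
  leb.-integrable (cbox a b) (EFin \o g) ->
  (forall phi, test_function Omega phi -> \int[leb]_(x in Omega) (g x * phi x) = 0) ->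
  (\int[leb]_(x in box a b) (g x)%:E = 0)%E.
Proof.
move=> abO ig g0.
have [phi [tphi phi01 phi0 phil]] := box_approx a b.
have mK : measurable (cbox a b) by apply: compact_measurable_rV; exact: compact_cbox.
have mg : measurable_fun (cbox a b) g by apply/measurable_EFinP; exact: measurable_int ig.
have mphi k : measurable_fun (cbox a b) (phi k).
  apply: measurable_funTS; apply: continuous_measurable_rV; apply: smooth_continuous.
  by have [] := tphi k _ (@subset_refl _ (cbox a b)).
have mf k : measurable_fun (cbox a b) (fun x => g x * phi k x) by exact: measurable_funM.
have igp k : leb.-integrable (cbox a b) (EFin \o (fun x => g x * phi k x)).
  apply: le_integrable ig => //; first exact/measurable_EFinP.
  move=> x _; rewrite lee_fin normrM ler_piMr//.
  by case/andP: (phi01 k x) => p0 p1; rewrite ger0_norm.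
have bK : box a b `<=` cbox a b.
  by move=> x h i; case/andP: (h i) => h1 h2; rewrite !ltW.
have [||||_ _] := @dominated_convergence _ _ _ leb _ mK
  (fun k x => (g x * phi k x)%:E) (fun x => (g x * \1_(box a b) x)%:E)
  (fun x => `|(g x)%:E|%E) _ _ _ (integrable_abse ig).
- by move=> k; exact/measurable_EFinP.
- apply/measurable_EFinP; apply: measurable_funM => //; apply: measurable_funTS.
  by apply: measurable_indic; exact: measurable_box.
- apply: aeW => x _; apply: cvg_EFin; first exact: nearW.
  by apply: cvgM; [exact: cvg_cst|exact: phil].
- apply: aeW => x k _; rewrite lee_fin normrM ler_piMr//.
  by case/andP: (phi01 k x) => p0 p1; rewrite ger0_norm.
have E0 k : (\int[leb]_(x in cbox a b) (g x * phi k x)%:E = 0)%E.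
  have := g0 _ (tphi k _ abO); rewrite /Rintegral.
  rewrite (@integral_vanishing_off _ _ (fun x => (g x * phi k x)%:E) abO); last first.
    by move=> x _ xK; rewrite phi0// mulr0.
  have fin : (\int[leb]_(x in cbox a b) (g x * phi k x)%:E)%E \is a fin_num.
    exact: (integrable_fin_num mK (igp k)).
  by move=> H; rewrite -(fineK fin) H.
rewrite (_ : [sequence _]_k = cst 0%E); last by apply/funext => k; exact: E0.
move=> /cvg_lim; rewrite lim_cst// => /(_ (@ereal_hausdorff _)) E.
rewrite E // (@integral_vanishing_off _ _ _ bK).
  by apply: eq_integral => x xb; rewrite indicE xb mulr1.
by move=> x _ xb; rewrite indicE memNset// mulr0.
Qed.

(** The fundamental lemma of the calculus of variations, localised to the countably many rational
    balls whose closed cubes lie in Omega: g is integrable on such cubes. *)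
Lemma integral_test0_ae Omega g : open Omega -> integrable_loc Omega g ->
  (forall phi, test_function Omega phi -> \int[leb]_(x in Omega) (g x * phi x) = 0) ->
  {ae leb, forall x, Omega x -> g x = 0}.
Proof.
move=> oO ig g0.
pose c (p : 'rV[rat]_n * nat) : V := map_mx ratr p.1.
pose r (p : 'rV[rat]_n * nat) : R := p.2.+1%:R^-1.
have ae p : cube (c p) (r p) `<=` Omega -> {ae leb, forall x, rational_ball p x -> g x = 0}.
  move=> pO.
  pose a i := c p ord0 i - r p; pose b i := c p ord0 i + r p.
  have pE : rational_ball p = box a b.
    rewrite rational_ball_box; congr box; apply/funext => i; rewrite /a /b /c mxE//.
  have cE : cbox a b = cube (c p) (r p).
    by apply/seteqP; split=> x h i; have := h i; rewrite ler_distl.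
  have mb := @measurable_box R n a b.
  have igb : leb.-integrable (box a b) (EFin \o g).
    apply: (integrableS _ _ _ (ig _ (@compact_cube _ _ (c p) (r p)) pO)) => //; first exact: measurable_cube.
    by rewrite -cE => x h i; case/andP: (h i) => h1 h2; rewrite !ltW.
  (* The ball is a box, so g cut off to it is integrated over another box on the intersection of the
     two, again a box, whose closed box lies in Omega. *)
  have /negligibleS : ae_eq leb setT ((EFin \o g) \_ (box a b)) (cst 0%E).
    apply: integral_boxes0_ae => [|a' b'].
      exact: (proj1 (@integrable_mkcond _ _ _ leb _ _ mb)).
    rewrite -integral_mkcondr setIC boxI; apply: (@integral_box0 Omega) => //.
      apply: subset_trans pO; rewrite -cE => x h i; have := h i.
      by rewrite ge_max le_min => /andP[/andP[-> _] /andP[-> _]].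
    apply: (integrableS _ _ _ (ig _ (@compact_cube _ _ (c p) (r p)) pO)) => //; [exact: measurable_cube| |].
      by apply: compact_measurable_rV; exact: compact_cbox.
    rewrite -cE => x h i; have := h i.
    by rewrite ge_max le_min => /andP[/andP[-> _] /andP[-> _]].
  apply => x /= h h'; apply: h => px; move: h'; rewrite pE in px.
  by rewrite /patch mem_set// => /(_ Logic.I) [].
have : leb.-negligible (\bigcup_p (if `[< cube (c p) (r p) `<=` Omega >]
    then ~` [set x | rational_ball p x -> g x = 0] else set0)).
  apply: negligible_bigcup_countType => p; case: asboolP => h; first exact: ae.
  exact: negligible_set0.
apply: negligibleS => x /not_implyP[Ox gx].
have [e e0 eO] : exists2 e : R, 0 < e & ball x e `<=` Omega.
  by have /nbhs_ballP[e /= e0 ?] := open_nbhs_nbhs (conj oO Ox); exists e.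
have e2 : 0 < e / 2 by rewrite divr_gt0.
have [p [px pe pr]] := rational_ball_small x e2.
exists p => //; case: asboolP => [_|]; first by move=> /(_ px).
case=> y hy; apply: eO.
apply: (@cube_ball _ _ _ (r p + r p)) => //.
  by move: pr; rewrite -/(r p); lra.
apply: cube_trans hy; apply/cube_sym; exact: ball_cube.
Qed.

Lemma bounded_lebesgue_fin (A : set V) : measurable A -> bounded_set A -> (leb A < +oo)%E.
Proof.
move=> mA [M [_ MA]].
have AC : A `<=` cube 0 (`|M| + 1).
  move=> x Ax i; rewrite mxE subr0; apply: le_trans (coord_le_norm x i) _.
  by apply: (MA (`|M| + 1)) => //; rewrite (le_lt_trans (ler_norm _))// ltrDl.
apply: le_lt_trans (lebesgue_cube_fin 0 (`|M| + 1)).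
by apply: le_measure; rewrite ?inE //; exact: measurable_cube.
Qed.

Lemma compact_lebesgue_fin (K : set V) : compact K -> (leb K < +oo)%E.
Proof.
move=> cK; apply: bounded_lebesgue_fin (compact_bounded cK); exact: compact_measurable_rV.
Qed.

Lemma continuous_integrable_loc Omega f : continuous f -> integrable_loc Omega f.
Proof.
move=> cf K cK _.
have /compact_bounded[M [_ MK]] : compact (f @` K).
  by apply: continuous_compact => //; exact: continuous_subspaceT.
apply: (@integrable_bounded _ _ _ _ _ _ (`|M| + 1)).
- exact: compact_measurable_rV.
- exact: compact_lebesgue_fin.
- by apply: measurable_funTS; exact: continuous_measurable_rV.
- move=> x Kx; apply: (MK (`|M| + 1)); last by exists x.
  by rewrite (le_lt_trans (ler_norm _))// ltrDl.
Qed.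

Lemma test_function_off Omega u x : test_function Omega u -> ~ Omega x -> u x = 0.
Proof.
move=> [_ _ uO] Ox; apply/eqP; apply: contraT => ux; exfalso; apply: Ox; apply: uO.
exact: subset_closure.
Qed.

Lemma weak_gradient_test Omega u : test_function Omega u ->
  is_weak_gradient Omega u (fun x => \row_i partial i u x).
Proof.
move=> tu; have [su _ _] := tu; split=> [i|i phi tphi].
  rewrite (_ : (fun x => _) = partial i u); last by apply/funext => x; rewrite mxE.
  apply: continuous_integrable_loc; exact/smooth_continuous/smooth_partial.
have [sphi _ _] := tphi.
have [M [uM _]] := test_function_vanishes tu.
have [N [pN dpN]] := test_function_vanishes tphi.
have cu := smooth_continuous su; have cphi := smooth_continuous sphi.
have cdu := smooth_continuous (smooth_partial i su).
have cdphi := smooth_continuous (smooth_partial i sphi).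
pose f1 x := u x * partial i phi x; pose f2 x := phi x * partial i u x.
have cM (f g : V -> R) : continuous f -> continuous g -> continuous (fun x => f x * g x).
  by move=> cf cg x; apply: (@cvgM _ _ (nbhs x) (nbhs_filter x)); [exact: cf|exact: cg].
have vf1 : vanishes_off N f1 by move=> x /dpN; rewrite /f1 => ->; rewrite mulr0.
have vf2 : vanishes_off N f2 by move=> x /pN; rewrite /f2 => ->; rewrite mul0r.
have i1 := integrable_continuous_off (cM _ _ cu cdphi) vf1.
have i2 := integrable_continuous_off (cM _ _ cphi cdu) vf2.
(* Integration by parts: f1 + f2 is the derivative of u * phi in the direction i. *)
have : (\int[leb]_x (f1 x + f2 x)%:E = 0)%E.
  apply: (@integral_derivative0 _ _ (fun x => u x * phi x) _ (delta_mx ord0 i) N).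
  - by move=> j; rewrite mxE; case: (_ && _); rewrite ?normr1 ?normr0.
  - exact: cM.
  - move=> x; apply: (@cvgD _ _ _ (nbhs x) (nbhs_filter x)); first exact: (cM _ _ cu cdphi).
    exact: (cM _ _ cphi cdu).
  - by move=> x /pN ->; rewrite mulr0.
  - by move=> x xN; rewrite vf1// vf2// addr0.
  - move=> x; exact: (is_deriveM (smooth_is_derive i x su) (smooth_is_derive i x sphi)).
under eq_integral do rewrite EFinD; rewrite integralD// => S.
have m1 F : (forall x, ~ Omega x -> F x = 0) ->
    \int[leb]_(x in Omega) F x = \int[leb]_x F x.
  move=> F0; rewrite Rintegral_mkcond; apply: eq_Rintegral => x _; rewrite /patch.
  by case: ifPn => // /negP h; rewrite F0// => Ox; apply: h; rewrite mem_set.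
rewrite m1; last by move=> x Ox; rewrite (test_function_off tu Ox) mul0r.
rewrite m1; last by move=> x Ox; rewrite (test_function_off tphi Ox) mulr0.
have -> : \int[leb]_x ((\row_i0 partial i0 u x) ord0 i * phi x) = \int[leb]_x f2 x.
  by apply: eq_Rintegral => x _; rewrite mxE mulrC.
have F1 := integrable_fin_num measurableT i1; have F2 := integrable_fin_num measurableT i2.
move: S; rewrite /Rintegral -/f1 -(fineK F1) -(fineK F2) -EFinD => -[/eqP].
by rewrite addr_eq0 => /eqP.
Qed.

Lemma integrable_loc_test Omega g phi : open Omega -> integrable_loc Omega g ->
  test_function Omega phi -> leb.-integrable Omega (fun x => (g x * phi x)%:E).
Proof.
move=> oO ig tphi; have [sphi cK KO] := tphi.
set K := fun_support phi in cK KO.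
have mK := compact_measurable_rV cK.
have mO := open_measurable_rV oO.
have igK := ig _ cK KO.
have [M [pM _]] := test_function_vanishes tphi.
have [B [B0 pB]] := continuous_bounded_off (smooth_continuous sphi) pM.
have H : leb.-integrable K (fun x => (g x * phi x)%:E).
  apply: (@le_integrable _ _ _ leb _ mK _ (fun x => B%:E * (g x)%:E)%E).
  - apply/measurable_EFinP; apply: measurable_funM.
      by apply/measurable_EFinP; exact: measurable_int igK.
    by apply: measurable_funTS; apply: continuous_measurable_rV; exact: smooth_continuous.
  - by move=> x _; rewrite lee_fin !normrM mulrC ler_wpM2r// (ger0_norm B0).
  - exact: integrableZl.
have off x : ~ K x -> (g x * phi x)%:E = 0%E.
  move=> Kx; suff -> : phi x = 0 by rewrite mulr0.
  by apply/eqP; apply: contraT => px; exfalso; apply: Kx; exact: subset_closure.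
have := proj1 (@integrable_mkcond _ _ _ leb _ _ mK) H.
rewrite (_ : _ \_ K = (fun x => (g x * phi x)%:E)); first exact: integrableS.
apply/funext => x; rewrite /patch; case: ifPn => // /negP h; rewrite off//.
by move=> Kx; apply: h; rewrite mem_set.
Qed.

(** [weak_gradient] is a choice; uniqueness almost everywhere identifies it with the classical
    gradient when u is a test function. *)
Lemma weak_gradient_unique Omega u v1 v2 : open Omega ->
  is_weak_gradient Omega u v1 -> is_weak_gradient Omega u v2 ->
  {ae leb, forall x, Omega x -> v1 x = v2 x}.
Proof.
move=> oO [l1 w1] [l2 w2].
have H i : {ae leb, forall x, Omega x -> v1 x ord0 i - v2 x ord0 i = 0}.
  apply: integral_test0_ae => // [K cK KO|phi tphi].
    have := integrableB (compact_measurable_rV cK) (l1 i K cK KO) (l2 i K cK KO).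
    by [].
  under eq_Rintegral do rewrite mulrBl.
  rewrite RintegralB//.
  - by have := w1 i _ tphi; have := w2 i _ tphi; lra.
  - exact: open_measurable_rV.
  - exact: integrable_loc_test (l1 i) tphi.
  - exact: integrable_loc_test (l2 i) tphi.
have := @filter_forall _ _ (fun i (x : V) => Omega x -> v1 x ord0 i - v2 x ord0 i = 0)
  _ (ae_filter_ringOfSetsType leb) H.
apply: filterS => x hx Ox; apply/rowP => i; apply/eqP; rewrite -subr_eq0.
by apply/eqP; exact: hx.
Qed.

End weak.

(** * Dyadic energy and the Wolff potential *)

Section growth_sums.
Context {R : realType}.
Implicit Types (f : R -> R) (C : R) (q : nat).

Lemma bernoulli_le (x : R) q : 0 <= x <= 1 -> 1 - q%:R * x <= (1 - x) ^+ q.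
Proof.
move=> /andP[x0 x1]; elim: q => [|q IH]; first by rewrite mul0r subr0 expr0.
rewrite exprSr -natr1.
have H : (1 - q%:R * x) * (1 - x) <= (1 - x) ^+ q * (1 - x) by apply: ler_wpM2r => //; lra.
apply: le_trans H; have q0 : 0 <= q%:R * x * x by rewrite !mulr_ge0.
nra.
Qed.

(** The ratio th = 1 - 1 / (3 (q + 1)) is so close to 1 that th^(-q) <= 3/2, by Bernoulli's
    inequality. What matters is that 3/2 is less than 2, the ratio of consecutive radii. *)
Lemma growth_sum C q f : 0 <= C -> {homo f : x y / x <= y} -> (forall x, 0 <= f x) ->
  f 0 = 0 -> power_growth C q f ->
  exists D, 0 <= D /\ forall N (b : nat -> R), (forall m, 0 <= b m) ->
    f (\sum_(m < N) b m) <= D * \sum_(m < N) (3 / 2) ^+ m * f (b m).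
Proof.
move=> C0 fm f0 f00 fg; pose x : R := (3 * q.+1%:R)^-1; pose th := 1 - x.
have q1 : 1 <= q.+1%:R :> R by rewrite ler1n.
have x0 : 0 < x by rewrite invr_gt0; lra.
have x1 : x <= 1 / 3.
  have : q.+1%:R^-1 <= 1 :> R by rewrite invf_le1 ?q1// (lt_le_trans _ q1).
  by rewrite /x invfM; move: (_.+1%:R^-1) => y; lra.
have th01 : 0 < th < 1 by rewrite /th; apply/andP; split; lra.
have [D [D0 HD]] := sum_le_weighted th01 C0 fm f0 f00 fg.
exists D; split=> // N b b0; apply: le_trans (HD N b b0) _.
rewrite ler_wpM2l//; apply: ler_sum => m _; rewrite ler_wpM2r//.
have thq : 0 <= th ^- q by rewrite invr_ge0 exprn_ge0//; case/andP: th01 => /ltW.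
have t32 : 0 <= 3 / 2 :> R by lra.
rewrite lerXn2r//.
have : 2 / 3 <= th ^+ q.
  apply: le_trans (@bernoulli_le x q _); last by lra.
  have : q%:R * x <= 1 / 3.
    have -> : 1 / 3 = q.+1%:R * x by rewrite /x; field; rewrite gt_eqF//; lra.
    by rewrite ler_pM2r// ler_nat.
  lra.
move=> H; have -> : 3 / 2 = (2 / 3)^-1 :> R by field.
have p23 : 0 < 2 / 3 :> R by lra.
by rewrite lef_pV2 ?posrE// (lt_le_trans p23).
Qed.

(** The same with the terms reversed: here the last one has weight 1 and the weights grow towards
    the first, that is towards the large scales. *)
Lemma growth_sum_rev C q f : 0 <= C -> {homo f : x y / x <= y} -> (forall x, 0 <= f x) ->
  f 0 = 0 -> power_growth C q f ->
  exists D, 0 <= D /\ forall k (b : nat -> R), (forall m, 0 <= b m) ->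
    f (\sum_(j < k.+1) b j) <= D * \sum_(j < k.+1) (3 / 2) ^+ (k - j) * f (b j).
Proof.
move=> C0 fm f0 f00 fg; have [D [D0 HD]] := growth_sum C0 fm f0 f00 fg.
exists D; split=> // k b b0.
rewrite (reindex_inj rev_ord_inj) [X in _ <= D * X](reindex_inj rev_ord_inj) /=.
have := HD k.+1 (fun m => b (k.+1 - m.+1)%N) (fun m => b0 _).
move=> /le_trans; apply; rewrite ler_wpM2l//; apply: ler_sum => j _.
by rewrite (_ : (k - (k.+1 - j.+1))%N = j :> nat)// subSS subKn// -ltnS.
Qed.

End growth_sums.

Lemma ge0_integralZT d (T : measurableType d) (R : realType) (m : {measure set T -> \bar R})
    (k : R) (f : T -> R) : measurable_fun setT f -> (forall x, 0 <= f x) -> 0 <= k ->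
  (\int[m]_x (k * f x)%:E = k%:E * \int[m]_x (f x)%:E)%E.
Proof.
move=> mf f0 k0; under eq_integral do rewrite EFinM.
apply: ge0_integralZl_EFin => //; last exact/measurable_EFinP.
by move=> x _; rewrite lee_fin.
Qed.

(** * Fubini for masses of cubes *)

Section cubes.
Context {R : realType} {n : nat} (mu : {finite_measure set 'rV[R]_n -> \bar R}).
Local Notation V := 'rV[R]_n.
Local Notation leb := (lebesgue_measure_rV R n).

Lemma measurable_cube_rel (r : R) : measurable [set p : V * V | cube p.1 r p.2].
Proof.
rewrite (_ : [set _ | _] = \bigcap_(i in [set: 'I_n])
   ((fun p : V * V => `|p.2 ord0 i - p.1 ord0 i|) @^-1` `]-oo, r]%classic)); last first.
  apply/seteqP; split=> p /= h i; first by move=> _; exact: h.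
  exact: h i Logic.I.
apply: fin_bigcap_measurable => [|i _]; first exact: finite_finset.
rewrite -[X in measurable X]setTI.
have mc : measurable_fun setT (fun p : V * V => `|p.2 ord0 i - p.1 ord0 i|).
  apply: measurableT_comp => //; apply: measurable_funB.
    by apply: (measurableT_comp (measurable_coord i)); exact: measurable_snd.
  by apply: (measurableT_comp (measurable_coord i)); exact: measurable_fst.
by apply: mc => //; exact: measurable_itv.
Qed.

Definition mass (x : V) (r : R) : R := fine (mu (cube x r)).

Lemma mass_fin (A : set V) : measurable A -> (fine (mu A))%:E = mu A.
Proof. by move=> mA; rewrite fineK// fin_num_measure. Qed.

Lemma massE x r : (mass x r)%:E = mu (cube x r).
Proof. by apply: mass_fin; exact: measurable_cube. Qed.

Lemma mass_ge0 x r : 0 <= mass x r.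
Proof. exact: fine_ge0. Qed.

Lemma mass_le x y r s : cube x r `<=` cube y s -> mass x r <= mass y s.
Proof.
by move=> xy; rewrite -lee_fin !massE; apply: le_measure; rewrite ?inE//; exact: measurable_cube.
Qed.

Lemma mass_le_total x r : mass x r <= fine (mu setT).
Proof.
rewrite -lee_fin massE mass_fin//; apply: le_measure; rewrite ?inE//; exact: measurable_cube.
Qed.

Lemma measurable_mass r : measurable_fun setT (fun y => mass y r).
Proof.
have := @measurable_fun_xsection _ _ _ _ _ mu _ (measurable_cube_rel r).
rewrite (_ : _ \o _ = fun y => mu (cube y r)); last first.
  apply/funext => y /=; congr (mu _); apply/seteqP; split=> x.
    by rewrite /xsection /= inE.
  by move=> h; rewrite /xsection /= inE.
by move=> H; apply: measurableT_comp.
Qed.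

(** Tonelli for the relation of lying in a cube of half-side s about each other, which is
    symmetric. *)
Lemma integral_mass (s : R) (F : V -> R) : measurable_fun setT F -> (forall y, 0 <= F y) ->
  (\int[leb]_y (mass y s * F y)%:E =
   \int[mu]_x \int[leb]_y (\1_(cube x s) y * F y)%:E)%E.
Proof.
move=> mF F0.
pose f (p : V * V) : \bar R := (\1_[set p : V * V | cube p.1 s p.2] p * F p.1)%:E.
have mf : measurable_fun setT f.
  apply/measurable_EFinP; apply: measurable_funM.
    by apply: measurable_indic; exact: measurable_cube_rel.
  by apply: measurableT_comp => //; exact: measurable_fst.
have f0 p : (0 <= f p)%E by rewrite lee_fin mulr_ge0// indicE.
have -> : (\int[leb]_y (mass y s * F y)%:E = \int[leb]_y \int[mu]_x f (y, x))%E.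
  apply: eq_integral => y _; rewrite EFinM massE muleC -(setIT (cube y s)).
  rewrite -integral_indic//; last exact: measurable_cube.
  rewrite -[LHS]/(_ * \int[mu]_x (\1_(cube y s) x)%:E)%E -ge0_integralZT//.
    by apply: eq_integral => x _; rewrite /f /= mulrC.
  by apply: measurable_indic; exact: measurable_cube.
have -> : (\int[leb]_y \int[mu]_x f (y, x) = \int[mu]_x \int[leb]_y f (y, x))%E.
  exact: (@fubini_tonelli _ _ _ _ _ leb mu f mf f0).
apply: eq_integral => x _; apply: eq_integral => y _; rewrite /f !indicE /=.
congr ((_%:R * _)%:E); congr nat_of_bool.
by apply/idP/idP => /set_mem h; apply/mem_set; exact/cube_sym.
Qed.

(** After Tonelli, F is integrated over the cube about x, of volume (2 s)^n, on which it is at most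
    F' x. *)
Lemma cube_average (s : R) (F F' : V -> R) : 0 <= s ->
  measurable_fun setT F -> measurable_fun setT F' ->
  (forall y, 0 <= F y) -> (forall x, 0 <= F' x) -> (forall x y, cube x s y -> F y <= F' x) ->
  (\int[leb]_y (mass y s * F y)%:E <= ((2 * s) ^+ n)%:E * \int[mu]_x (F' x)%:E)%E.
Proof.
move=> s0 mF mF' F0 F'0 FF'; rewrite integral_mass//.
rewrite -ge0_integralZT// ?exprn_ge0 ?mulr_ge0//.
apply: ge0_le_integral_nomeas => // [x _|x _].
  by apply: integral_ge0 => y _; rewrite lee_fin mulr_ge0// indicE.
rewrite mulrC EFinM -(lebesgue_cube x s0) -(setIT (cube x s)).
rewrite -integral_indic//; last exact: measurable_cube.
rewrite -[leRHS]/(_ * \int[leb]_y (\1_(cube x s) y)%:E)%E -ge0_integralZT//; last first.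
  by apply: measurable_indic; exact: measurable_cube.
apply: ge0_le_integral_nomeas => // y _; first by rewrite lee_fin mulr_ge0// indicE.
rewrite setIT lee_fin mulrC indicE; case: (asboolP (cube x s y)) => h.
  by rewrite mem_set// !mulr1 FF'.
by rewrite memNset// !mulr0.
Qed.

End cubes.

(** * Bounds by the dyadic energy *)

Section wolff_sums.
Context {R : realType}.

Lemma integral_sum_le d (T : measurableType d) (m : {measure set T -> \bar R}) I (s : seq I)
    (f : I -> T -> R) (B : I -> R) :
  (forall i, measurable_fun setT (f i)) -> (forall i x, 0 <= f i x) ->
  (forall i, (\int[m]_x (f i x)%:E <= (B i)%:E)%E) ->
  (\int[m]_x (\sum_(i <- s) f i x)%:E <= (\sum_(i <- s) B i)%:E)%E.
Proof.
move=> mf f0 fB; elim: s => [|i s IH].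
  under eq_integral do rewrite big_nil.
  by rewrite integral0 big_nil.
under eq_integral do rewrite big_cons EFinD.
rewrite ge0_integralD//.
- by rewrite big_cons EFinD leeD.
- by move=> x _; rewrite lee_fin.
- exact/measurable_EFinP.
- by move=> x _; rewrite lee_fin sumr_ge0.
- by apply/measurable_EFinP; exact: measurable_sum.
Qed.

Lemma homo_measurable d (T : measurableType d) (D : set T) (f : R -> R) (u : T -> R) :
  {homo f : x y / x <= y} -> measurable_fun D u -> measurable_fun D (fun x => f (u x)).
Proof.
move=> fm mu; have mf : measurable_fun setT f.
  by apply: nondecreasing_measurable => // x y _ _; exact: fm.
exact: measurableT_comp mf mu.
Qed.

(** Once the sums are exchanged, 3/2 from the growth times 1/2 from the radii leaves the ratio 3/4,
    whose geometric series has sum 4. *)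
Lemma geometric_weights (r w : nat -> R) N : (forall k, 0 <= w k) -> (forall k, 0 <= r k) ->
  (forall k j, (j <= k)%N -> r k = (2^-1) ^+ (k - j) * r j) ->
  \sum_(k < N) \sum_(j < k.+1) (3 / 2) ^+ (k - j) * (r k * w j) <= 4 * \sum_(j < N) r j * w j.
Proof.
move=> w0 r0 rE.
pose F k j : R := if (j <= k)%N then (3 / 4) ^+ (k - j) * (r j * w j) else 0.
have -> : \sum_(k < N) \sum_(j < k.+1) (3 / 2) ^+ (k - j) * (r k * w j) =
    \sum_(k < N) \sum_(j < N) F k j.
  apply: eq_bigr => k _.
  rewrite -(big_mkord xpredT (fun j => (3 / 2) ^+ (k - j) * (r k * w j))).
  have Z : \sum_(k.+1 <= j < N) F k j = 0.
    by rewrite big_nat big1// => j /andP[kj _]; rewrite /F leqNgt kj.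
  rewrite -(big_mkord xpredT (F k)) (big_cat_nat (n := k.+1) (p := N))//= Z [RHS]addr0.
  apply: eq_big_nat => j /andP[_]; rewrite ltnS => jk.
  rewrite /F jk (rE _ _ jk) !mulrA -exprMn; congr (_ ^+ _ * _ * _); by field.
rewrite exchange_big /= mulr_sumr; apply: ler_sum => j _.
have Z : \sum_(0 <= k < j) F k j = 0.
  by rewrite big_nat big1// => k /andP[_ kj]; rewrite /F leqNgt kj.
rewrite -(big_mkord xpredT (fun k => F k j)).
rewrite (big_cat_nat (n := j) (leq0n j) (ltnW (ltn_ord j)))/= Z [leLHS]add0r.
rewrite -{1}[nat_of_ord j]add0n big_addn.
rewrite (eq_big_nat _ _ (F2 := fun m => (3 / 4) ^+ m * (r j * w j))); last first.
  by move=> m _; rewrite /F leq_addl addnK.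
rewrite -mulr_suml ler_wpM2r ?mulr_ge0// big_mkord.
apply: le_trans (sum_geometric_le _ _ _) _; [lra|lra|].
by rewrite (_ : 1 - 3 / 4 = 4^-1) ?invrK//; field.
Qed.

Context {n : nat} (n0 : (0 < n)%N) (mu : {finite_measure set 'rV[R]_n -> \bar R}).
Local Notation V := 'rV[R]_n.
Local Notation leb := (lebesgue_measure_rV R n).
Context (G g h : R -> R) (C i : R) (q : nat) (cg : conjugate_growth G g h C i q).
Context (rho : R) (rho0 : 0 < rho).

Definition rad (k : nat) : R := rho / 2 ^+ k.

(** The factor c on the cubes is a parameter because Fubini replaces it by 2 c. *)
Definition dens (c : R) k (x : V) : R := mass mu x (c * rad k) / rad k ^+ n.-1.

Definition wsum (c : R) k : R := fine (\int[mu]_x (h (dens c k x))%:E)%E.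

Lemma rad_gt0 k : 0 < rad k.
Proof. by rewrite divr_gt0// exprn_gt0. Qed.

Lemma radE k j : (j <= k)%N -> rad k = (2^-1) ^+ (k - j) * rad j.
Proof.
move=> jk; rewrite /rad -{1}(subnK jk) exprD invfM exprVn.
by rewrite mulrCA mulrA.
Qed.

Lemma rad_le k j : (j <= k)%N -> rad k <= rad j.
Proof.
move=> jk; rewrite (radE jk); apply: ler_piMl; first exact/ltW/rad_gt0.
by apply: exprn_ile1; lra.
Qed.

Lemma radS k : rad k = 2 * rad k.+1.
Proof. by rewrite /rad exprS invfM; field; rewrite expf_neq0. Qed.

Lemma h_ge0 s : 0 <= h s.
Proof.
have [s0|s0] := leP s 0; first by rewrite (cg_h0 cg).
by rewrite -(cg_h0 cg (lexx 0)) (cg_h_le cg)// ltW.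
Qed.

Lemma g_ge0 s : 0 <= g s.
Proof.
have [s0|s0] := leP s 0; first by rewrite (cg_g0 cg).
by rewrite -(cg_g0 cg (lexx 0)) (cg_g_le cg)// ltW.
Qed.

Lemma G_ge0 s : 0 <= s -> 0 <= G s.
Proof. by move=> s0; rewrite -(cg_G0 cg) (cg_G_le cg). Qed.

Lemma C_ge0 : 0 <= C. Proof. by have := cg_C cg; lra. Qed.

Lemma dens_ge0 c k x : 0 <= dens c k x.
Proof. by rewrite /dens divr_ge0 ?mass_ge0// exprn_ge0// ltW// rad_gt0. Qed.

Lemma measurable_dens c k : measurable_fun setT (dens c k).
Proof. by apply: measurable_funM => //; exact: measurable_mass. Qed.

Lemma measurable_h_dens c k : measurable_fun setT (fun x => h (dens c k x)).
Proof. by apply: homo_measurable; [exact: cg_h_le cg|exact: measurable_dens]. Qed.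

Lemma dens_le_total c k x : dens c k x <= fine (mu setT) / rad k ^+ n.-1.
Proof. by rewrite /dens ler_wpM2r ?mass_le_total// invr_ge0 exprn_ge0// ltW// rad_gt0. Qed.

Lemma integrable_h_dens c k : mu.-integrable setT (fun x => (h (dens c k x))%:E).
Proof.
apply: (@integrable_bounded _ _ _ _ _ _ (h (fine (mu setT) / rad k ^+ n.-1))) => //.
- by rewrite -ge0_fin_numE// fin_num_measure.
- exact: measurable_h_dens.
- by move=> x _; rewrite ger0_norm ?h_ge0//; apply: (cg_h_le cg); exact: dens_le_total.
Qed.

Lemma wsumE c k : (\int[mu]_x (h (dens c k x))%:E = (wsum c k)%:E)%E.
Proof.
by rewrite /wsum fineK//; apply: (integrable_fin_num measurableT (integrable_h_dens c k)).
Qed.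

Lemma wsum_ge0 c k : 0 <= wsum c k.
Proof. by apply: fine_ge0; apply: integral_ge0 => x _; rewrite lee_fin h_ge0. Qed.

(* Fubini: [dens c k] is an average of mu over cubes of radius [c * rad k], on
   which [dens c j] is controlled by its value at the centre. *)
Lemma integral_dens_h c k j : 0 < c -> (j <= k)%N ->
  (\int[leb]_y (dens c k y * h (dens c j y))%:E <=
   ((2 * c) ^+ n * rad k * wsum (2 * c) j)%:E)%E.
Proof.
move=> c0 jk; have rk := rad_gt0 k; have rj := rad_gt0 j.
have rn : 0 < rad k ^+ n.-1 by rewrite exprn_gt0.
under eq_integral do rewrite /dens mulrAC mulrC.
rewrite -/(dens c j _).
rewrite ge0_integralZT; last 3 first.
- apply: measurable_funM; first exact: measurable_mass.
  exact: measurable_h_dens.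
- by move=> x; rewrite mulr_ge0 ?mass_ge0 ?h_ge0.
- by rewrite invr_ge0 ltW.
have H := @cube_average _ _ mu (c * rad k) (fun y => h (dens c j y))
  (fun y => h (dens (2 * c) j y)) _ (measurable_h_dens _ _) (measurable_h_dens _ _)
  (fun _ => h_ge0 _) (fun _ => h_ge0 _) _.
apply: (@le_trans _ _ (((rad k ^+ n.-1)^-1)%:E * (((2 * (c * rad k)) ^+ n)%:E * (wsum (2 * c) j)%:E))%E).
  rewrite lee_wpmul2l ?lee_fin ?invr_ge0 ?(ltW rn)// -wsumE; apply: H.
    by rewrite mulr_ge0// ltW.
  move=> x y xy; apply: (cg_h_le cg); rewrite /dens ler_wpM2r ?invr_ge0 ?exprn_ge0 ?(ltW rj)//.
  apply: mass_le => z yz; apply: (@cube_le _ _ x (c * rad k + c * rad j)); last exact: cube_trans yz.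
  have := rad_le jk; nra.
rewrite -!EFinM lee_fin mulrA ler_wpM2r ?wsum_ge0//.
have -> : (2 * (c * rad k)) ^+ n = (2 * c) ^+ n * (rad k ^+ n.-1 * rad k).
  by rewrite mulrA exprMn -exprSr prednK.
rewrite le_eqVlt; apply/orP; left; apply/eqP.
set x := rad k ^+ n.-1 in rn *; field; by rewrite gt_eqF.
Qed.

Lemma integral_dens_sum c : 0 < c -> exists K, 0 <= K /\ forall N,
  (\int[leb]_y (\sum_(k < N) dens c k y * h (\sum_(j < k.+1) dens c j y))%:E <=
   (K * \sum_(j < N) rad j * wsum (2 * c) j)%:E)%E.
Proof.
move=> c0.
have [D [D0 HD]] := growth_sum_rev C_ge0 (cg_h_le cg) h_ge0 (cg_h0 cg (lexx 0)) (cg_h_up cg).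
exists (D * (2 * c) ^+ n * 4); split=> [|N].
  by rewrite !mulr_ge0// exprn_ge0//; lra.
pose f (k j : nat) y := D * (3 / 2) ^+ (k - j) * (dens c k y * h (dens c j y)).
have e0 k j : 0 <= D * (3 / 2) ^+ (k - j) by rewrite mulr_ge0// exprn_ge0//; lra.
have f0 k j y : 0 <= f k j y by rewrite mulr_ge0// mulr_ge0 ?dens_ge0 ?h_ge0.
have mdh k j : measurable_fun setT (fun y => dens c k y * h (dens c j y)).
  by apply: measurable_funM; [exact: measurable_dens|exact: measurable_h_dens].
have mf k j : measurable_fun setT (f k j) by apply: measurable_funM.
apply: (@le_trans _ _ (\int[leb]_y (\sum_(k < N) \sum_(j < k.+1) f k j y)%:E)%E).
  apply: ge0_le_integral_nomeas => // y _.
    by rewrite lee_fin sumr_ge0// => k _; rewrite mulr_ge0 ?dens_ge0 ?h_ge0.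
  rewrite lee_fin; apply: ler_sum => k _.
  have := HD k (fun j => dens c j y) (fun j => dens_ge0 c j y).
  move=> /(ler_wpM2l (dens_ge0 c k y)) /le_trans; apply.
  rewrite mulrA mulr_sumr; apply: ler_sum => j _; rewrite /f le_eqVlt; apply/orP; left.
  by apply/eqP; ring.
pose B k j := D * (2 * c) ^+ n * ((3 / 2) ^+ (k - j) * (rad k * wsum (2 * c) j)).
apply: (@le_trans _ _ (\sum_(k < N) \sum_(j < k.+1) B k j)%:E).
  apply: (@integral_sum_le _ _ leb _ _ (fun k : 'I_N => fun y => \sum_(j < k.+1) f k j y)).
  - by move=> k; exact: measurable_sum.
  - by move=> k y; rewrite sumr_ge0.
  - move=> k; apply: integral_sum_le => // j.
    rewrite ge0_integralZT//; last by move=> y; rewrite mulr_ge0 ?dens_ge0 ?h_ge0.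
    have jk : (j <= k)%N by rewrite -ltnS.
    apply: le_trans (lee_wpmul2l _ (integral_dens_h c0 jk)) _; first by rewrite lee_fin.
    by rewrite -EFinM lee_fin /B le_eqVlt; apply/orP; left; apply/eqP; ring.
rewrite lee_fin /B; under eq_bigr do rewrite -mulr_sumr; rewrite -mulr_sumr.
rewrite -[leRHS]mulrA ler_wpM2l//; first by rewrite mulr_ge0// exprn_ge0//; lra.
apply: geometric_weights => //; first exact: wsum_ge0.
- by move=> k; exact/ltW/rad_gt0.
- exact: radE.
Qed.

(** G is telescoped along the tails V j, and each increment is at most tau j * g (V j). Only scales
    from j on remain inside g. *)
Lemma G_sum_le (tau : nat -> R) N : (forall k, 0 <= tau k) ->
  G (\sum_(k < N) tau k) <= \sum_(j < N) tau j * g (\sum_(m < N - j) tau (j + m)%N).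
Proof.
move=> tau0; pose V j := \sum_(j <= k < N) tau k.
have V0 j : 0 <= V j by exact: sumr_ge0.
have VE j : V j = \sum_(m < N - j) tau (j + m)%N.
  rewrite /V -{1}[j]add0n big_addn big_mkord; apply: eq_bigr => m _.
  by rewrite addnC.
have VS j : (j < N)%N -> V j = tau j + V j.+1 by move=> jN; rewrite /V big_ltn.
have -> : G (\sum_(k < N) tau k) = \sum_(j < N) (G (V j) - G (V j.+1)).
  rewrite -(big_mkord xpredT (fun j => G (V j) - G (V j.+1))).
  rewrite (eq_bigr (fun j => - (G (V j.+1) - G (V j)))); last by move=> j _; rewrite opprB.
  rewrite sumrN telescope_sumr// opprB /V [X in _ = _ - G X]big_geq// (cg_G0 cg) subr0.
  by rewrite big_mkord.
apply: ler_sum => j _; rewrite -VE.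
have VD : V j - V j.+1 = tau j by rewrite (VS _ (ltn_ord j)) addrK.
have : V j.+1 <= V j by rewrite (VS _ (ltn_ord j)) lerDr.
by move=> /(cg_G_incr cg (V0 _)); rewrite VD.
Qed.

(** In [G_sum_le] with tau k = h (dens c k y), g acts on a sum of values of h. The growth of g takes
    it inside, and g (h s) = s leaves the products dens c (j + m) y * h (dens c j y), which
    [integral_dens_h] integrates. *)
Lemma integral_G_sum c : 0 < c -> exists K, 0 <= K /\ forall N,
  (\int[leb]_y (G (\sum_(k < N) h (dens c k y)))%:E <=
   (K * \sum_(j < N) rad j * wsum (2 * c) j)%:E)%E.
Proof.
move=> c0.
have [D [D0 HD]] := growth_sum C_ge0 (cg_g_le cg) g_ge0 (cg_g0 cg (lexx 0)) (cg_g_up cg).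
exists (D * (2 * c) ^+ n * 4); split=> [|N].
  by rewrite !mulr_ge0// exprn_ge0//; lra.
pose f (j m : nat) y := D * (3 / 2) ^+ m * (dens c (j + m)%N y * h (dens c j y)).
have e0 m : 0 <= D * (3 / 2) ^+ m by rewrite mulr_ge0// exprn_ge0//; lra.
have f0 j m y : 0 <= f j m y by rewrite mulr_ge0// mulr_ge0 ?dens_ge0 ?h_ge0.
have mdh k j : measurable_fun setT (fun y => dens c k y * h (dens c j y)).
  by apply: measurable_funM; [exact: measurable_dens|exact: measurable_h_dens].
have mf j m : measurable_fun setT (f j m) by apply: measurable_funM.
apply: (@le_trans _ _ (\int[leb]_y (\sum_(j < N) \sum_(m < N - j) f j m y)%:E)%E).
  apply: ge0_le_integral_nomeas => // y _.
    by rewrite lee_fin G_ge0// sumr_ge0// => k _; exact: h_ge0.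
  rewrite lee_fin; apply: le_trans (G_sum_le (tau := fun k => h (dens c k y)) N _) _.
    by move=> k; exact: h_ge0.
  apply: ler_sum => j _.
  have := HD (N - j)%N (fun m => h (dens c (j + m)%N y)) (fun m => h_ge0 _).
  move=> /(ler_wpM2l (h_ge0 (dens c j y))) /le_trans; apply.
  rewrite mulrA mulr_sumr; apply: ler_sum => m _; rewrite /f (cg_hK cg) ?dens_ge0//.
  by rewrite le_eqVlt; apply/orP; left; apply/eqP; ring.
pose B j m := D * (2 * c) ^+ n * ((3 / 4) ^+ m * (rad j * wsum (2 * c) j)).
apply: (@le_trans _ _ (\sum_(j < N) \sum_(m < N - j) B j m)%:E).
  apply: (@integral_sum_le _ _ leb _ _ (fun j : 'I_N => fun y => \sum_(m < N - j) f j m y)).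
  - by move=> k; exact: measurable_sum.
  - by move=> k y; rewrite sumr_ge0.
  - move=> j; apply: integral_sum_le => // m.
    rewrite ge0_integralZT//; last by move=> y; rewrite mulr_ge0 ?dens_ge0 ?h_ge0.
    apply: le_trans (lee_wpmul2l _ (integral_dens_h c0 (leq_addr m j))) _; first by rewrite lee_fin.
    rewrite (radE (leq_addr m j)) addKn -EFinM lee_fin /B.
    have -> : (3 / 4 : R) ^+ m = (3 / 2) ^+ m * (2^-1) ^+ m by rewrite -exprMn; congr (_ ^+ _); field.
    by rewrite le_eqVlt; apply/orP; left; apply/eqP; ring.
rewrite lee_fin /B; under eq_bigr do rewrite -mulr_sumr -mulr_suml; rewrite -mulr_sumr.
rewrite -[leRHS]mulrA ler_wpM2l//; first by rewrite mulr_ge0// exprn_ge0//; lra.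
rewrite mulr_sumr; apply: ler_sum => j _; rewrite ler_wpM2r//.
  by rewrite mulr_ge0 ?wsum_ge0// ltW ?rad_gt0.
apply: le_trans (sum_geometric_le _ _ _) _; [lra|lra|].
by rewrite (_ : 1 - 3 / 4 = 4^-1) ?invrK//; field.
Qed.

End wolff_sums.

(** * Comparison of the Wolff potential with dyadic sums *)

Section wolff_potential.
Context {R : realType} {n : nat} (n0 : (0 < n)%N) (mu : {finite_measure set 'rV[R]_n -> \bar R}).
Local Notation V := 'rV[R]_n.
Context (G g h : R -> R) (C i : R) (q : nat) (cg : conjugate_growth G g h C i q).

Definition wolff (x : V) (r0 : R) : \bar R :=
  (\int[lebesgue_measure]_(r in `]0%R, r0[)
     (h (fine (mu (eucl_ball x r)) / r ^+ n.-1))%:E)%E.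

Lemma coord_le_eucl_norm (x : V) j : `|x ord0 j| <= eucl_norm x.
Proof.
rewrite /eucl_norm -sqrtr_sqr ler_sqrt ?sumr_ge0//; last by move=> k _; exact: sqr_ge0.
by rewrite (bigD1 j)//= lerDl sumr_ge0// => k _; exact: sqr_ge0.
Qed.

Lemma eucl_norm_le_sum (x : V) : eucl_norm x <= \sum_j `|x ord0 j|.
Proof.
have s0 : 0 <= \sum_j `|x ord0 j| by rewrite sumr_ge0.
rewrite -(ger0_norm s0) /eucl_norm -sqrtr_sqr ler_sqrt ?sqr_ge0//.
have /(_ (index_enum 'I_n)) H s : 0 <= \sum_(j <- s) `|x ord0 j| /\
    \sum_(j <- s) x ord0 j ^+ 2 <= (\sum_(j <- s) `|x ord0 j|) ^+ 2.
  elim: s => [|k s [IH1 IH2]]; first by rewrite !big_nil expr0n.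
  rewrite !big_cons; split; first by rewrite addr_ge0.
  rewrite -[x ord0 k ^+ 2]real_normK ?num_real//.
  by have := normr_ge0 (x ord0 k); nra.
exact: H.2.
Qed.

Lemma cube_eucl_ball (x : V) (c r L : R) : 0 < r -> n%:R * c < L ->
  cube x (c * r) `<=` eucl_ball x (L * r).
Proof.
move=> r0 cL y xy; rewrite /eucl_ball/=; apply: le_lt_trans (eucl_norm_le_sum _) _.
apply: (@le_lt_trans _ _ (\sum_(j < n) c * r)).
  by apply: ler_sum => j _; rewrite !mxE; exact: xy.
by rewrite sumr_const card_ord -mulr_natl mulrA ltr_pM2r.
Qed.

Lemma eucl_ball_cube (x : V) (r : R) : eucl_ball x r `<=` cube x r.
Proof.
move=> y; rewrite /eucl_ball/= => xy j.
by have := coord_le_eucl_norm (y - x) j; rewrite !mxE => /le_trans; apply; exact: ltW.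
Qed.

Lemma measurable_eucl_ball (x : V) r : measurable (eucl_ball x r).
Proof.
have m2 : measurable_fun setT (fun y : V => \sum_(j < n) (y - x) ord0 j ^+ 2).
  apply: measurable_sum => j.
  under eq_fun do rewrite !mxE.
  by apply: measurable_funX; apply: measurable_funB => //; exact: measurable_coord.
have [r0|r0] := ltP 0 r; last first.
  rewrite (_ : eucl_ball x r = set0)//; apply/seteqP; split=> // y.
  by rewrite /eucl_ball/= ltNge (le_trans r0)// sqrtr_ge0.
rewrite (_ : eucl_ball x r = (fun y : V => \sum_(j < n) (y - x) ord0 j ^+ 2) @^-1` `]-oo, r ^+ 2[%classic).
  by rewrite -[X in measurable X]setTI; exact: m2.
apply/seteqP; split=> y; rewrite /eucl_ball /eucl_norm /= in_itv/=.
  rewrite -{1}[r](ger0_norm (ltW r0)) -sqrtr_sqr ltr_sqrt//; exact: exprn_gt0.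
by rewrite -{2}[r](ger0_norm (ltW r0)) -sqrtr_sqr ltr_sqrt//; exact: exprn_gt0.
Qed.

Lemma mass_le_eucl (x : V) r s : cube x r `<=` eucl_ball x s ->
  mass mu x r <= fine (mu (eucl_ball x s)).
Proof.
move=> rs; rewrite -lee_fin massE mass_fin; last exact: measurable_eucl_ball.
by apply: le_measure; rewrite ?inE//; [exact: measurable_cube|exact: measurable_eucl_ball].
Qed.

Lemma eucl_le_mass (x : V) r s : eucl_ball x s `<=` cube x r ->
  fine (mu (eucl_ball x s)) <= mass mu x r.
Proof.
move=> rs; rewrite -lee_fin massE mass_fin; last exact: measurable_eucl_ball.
by apply: le_measure; rewrite ?inE//; [exact: measurable_eucl_ball|exact: measurable_cube].
Qed.

Lemma h_growth_le (l s t : R) : 1 <= l -> 0 <= t -> s <= l * t -> h s <= C * l ^+ q * h t.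
Proof. by move=> l1 t0 st; apply: le_trans (cg_h_le cg st) (cg_h_up cg l1 t0). Qed.

(** For r in [L r_k, 2 L r_k[ the ball of radius r contains the cube of half-side c r_k, the
    Euclidean norm being at most n times the sup norm; the integrand is then at least h (dens) / M,
    where M pays for the change of denominator. These intervals have length L r_k, are disjoint, and
    lie in ]0, r0[ when rho <= r0 / (4 L). *)
Lemma sum_le_wolff (c : R) (r0 : R) : 0 < c -> 0 < r0 -> exists rho1 K, [/\ 0 < rho1, 0 < K &
  forall rho, 0 < rho -> rho <= rho1 -> forall N x,
  ((K * \sum_(k < N) rad rho k * h (dens mu rho c k x))%:E <= wolff x r0)%E].
Proof.
move=> c0 r00; pose L : R := n%:R * c + 1.
have L1 : 1 <= L by rewrite lerDr mulr_ge0// ltW.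
have L0 : 0 < L by lra.
pose M := C * ((2 * L) ^+ n.-1) ^+ q.
have M0 : 0 < M.
  by have := cg_C cg => C1; rewrite mulr_gt0 ?exprn_gt0//; lra.
exists (r0 / (4 * L)), (L / M); split; [by rewrite divr_gt0//; lra|by rewrite divr_gt0|].
move=> rho rho0 rho1 N x.
pose a k := h (dens mu rho c k x) / M.
have a0 k : 0 <= a k by rewrite divr_ge0 ?(h_ge0 cg)// ltW.
pose I k : set R := `[L * rad rho k, 2 * L * rad rho k[%classic.
have rk k := @rad_gt0 _ _ rho0 k.
have IE k : lebesgue_measure (I k) = (L * rad rho k)%:E.
  rewrite lebesgue_measure_itv/= lte_fin ifT; last by have := rk k; nra.
  by rewrite -EFinB; congr EFin; ring.
have ID k : I k `<=` `]0, r0[%classic.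
  move=> r; rewrite /I/= !in_itv/= => /andP[r1 r2].
  rewrite (lt_le_trans _ r1) ?mulr_gt0//=.
  have : rad rho k <= rho by have := rad_le rho0 (leq0n k); rewrite {2}/rad expr0 divr1.
  move: rho1; rewrite ler_pdivlMr; last lra.
  move=> ? ?; nra.
apply: (@le_trans _ _ (\int[lebesgue_measure]_(r in `]0%R, r0[)
   (\sum_(k < N) a k * \1_(I k) r)%:E)%E); last first.
  apply: ge0_le_integral_nomeas => //.
    by move=> r _; rewrite lee_fin sumr_ge0// => k _; rewrite mulr_ge0// indicE.
  move=> r _; rewrite lee_fin.
  have [[k rIk]|nI] := pselect (exists k : 'I_N, I k r); last first.
    rewrite big1 ?(h_ge0 cg)// => k _; rewrite indicE memNset ?mulr0// => H.
    by apply: nI; exists k.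
  have disj j k' : (j < k')%N -> I j r -> I k' r -> False.
    rewrite /I/= !in_itv/= => jk /andP[+ _] /andP[_].
    have := rad_le rho0 jk; rewrite (radS rho j); have := rk k'; nra.
  rewrite (bigD1 k)//= big1 ?addr0; last first.
    move=> j jk; rewrite indicE memNset ?mulr0// => rIj.
    have [jk'|jk'|/val_inj jk'] := ltngtP j k; first exact: disj jk' rIj rIk.
      exact: disj jk' rIk rIj.
    by rewrite jk' eqxx in jk.
  rewrite indicE mem_set// mulr1 /a ler_pdivrMr// [leRHS]mulrC /M.
  move: (rIk); rewrite /I/= in_itv/= => /andP[r1 r2].
  have rr : 0 < r by rewrite (lt_le_trans _ r1)// mulr_gt0.
  apply: h_growth_le.
  - by rewrite exprn_ege1//; lra.
  - by rewrite divr_ge0 ?fine_ge0 ?exprn_ge0// ltW.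
  rewrite /dens [leRHS]mulrCA; apply: ler_pM.
  - exact: mass_ge0.
  - by rewrite invr_ge0 exprn_ge0// ltW.
  - apply: mass_le_eucl; apply: subset_trans (@cube_eucl_ball x c (rad rho k) L (rk k) _) _.
      by rewrite ltrDl.
    by move=> y; rewrite /eucl_ball/= => /lt_le_trans; apply.
  - rewrite ler_pdivlMr ?exprn_gt0// mulrC ler_pdivrMr ?exprn_gt0// -exprMn.
    by rewrite lerXn2r// ?nnegrE; nra.
have mI k : measurable_fun `]0%R, r0[%classic (fun r : R => (a k * \1_(I k) r)%:E).
  by apply/measurable_EFinP; apply: measurable_funM => //; apply: measurable_indic; exact: measurable_itv.
under eq_integral do rewrite -sumEFin.
rewrite ge0_integral_sum//; last 2 first.
- by move=> k; exact: mI.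
- by move=> k r _; rewrite lee_fin mulr_ge0// indicE.
rewrite mulr_sumr -sumEFin; apply: lee_sum => k _.
under eq_integral do rewrite EFinM.
rewrite ge0_integralZl_EFin//; last first.
  by apply/measurable_EFinP; apply: measurable_indic; exact: measurable_itv.
have mIk : measurable (I k) by exact: measurable_itv.
rewrite integral_indic// setIidl; last exact: ID.
rewrite [X in (_ <= _ * X)%E](_ : _ = (L * rad rho k)%:E); last exact: IE.
by rewrite -EFinM lee_fin /a le_eqVlt; apply/orP; left; apply/eqP; field; rewrite gt_eqF.
Qed.

Lemma rad_small (rho r : R) : 0 < rho -> 0 < r -> r < rho ->
  exists k, rad rho k.+1 <= r < rad rho k.
Proof.
move=> rho0 r0 rr.
have ex : exists k, rad rho k.+1 <= r.
  have [k Hk] : exists k : nat, rho / r < k%:R.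
    by exists (Num.truncn (rho / r)).+1; exact: truncnS_gt.
  exists k; have H2 : (k%:R : R) < 2 ^+ k.+1.
    by rewrite -natrX ltr_nat (ltn_trans (ltnSn k))// ltn_expl.
  rewrite /rad ler_pdivrMr ?exprn_gt0//.
  move: Hk; rewrite ltr_pdivrMr// => Hk; rewrite (le_trans (ltW Hk))// mulrC.
  by rewrite ler_pM2l// ltW.
exists (ex_minn ex); case: ex_minnP => k -> min; rewrite /=.
case: k min => [|k] min; first by rewrite /rad expr0 divr1.
rewrite ltNge; apply/negP => /min; by rewrite ltnn.
Qed.

(** On [r_(k+1), r_k[ the ball lies in the cube of half-side r_k, and r >= r_k / 2, so that passing
    from r to r_k costs at most 2^(n-1) inside h. *)
Lemma wolff_le_sum : exists K, 0 < K /\ forall rho, 0 < rho -> forall x,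
  (wolff x rho <= \sum_(k <oo) (K * (rad rho k * h (dens mu rho 1 k x)))%:E)%E.
Proof.
pose K := C * (2 ^+ n.-1) ^+ q.
have K0 : 0 < K.
  by have := cg_C cg => C1; rewrite mulr_gt0 ?exprn_gt0//; lra.
exists K; split=> // rho rho0 x.
have rk k := @rad_gt0 _ _ rho0 k.
pose I k : set R := `[rad rho k.+1, rad rho k[%classic.
have mIk k : measurable (I k) by exact: measurable_itv.
pose a k := K * h (dens mu rho 1 k x).
have a0 k : 0 <= a k by rewrite mulr_ge0 ?(h_ge0 cg)// ltW.
pose f (k : nat) (r : R) : \bar R := (a k * \1_(I k) r)%:E.
have f0 k r : (0 <= f k r)%E by rewrite lee_fin mulr_ge0// indicE.
have mf k : measurable_fun `]0%R, rho[%classic (f k).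
  by apply/measurable_EFinP; apply: measurable_funM => //; exact: measurable_indic.
apply: (@le_trans _ _ (\int[lebesgue_measure]_(r in `]0%R, rho[) (\sum_(k <oo) f k r))%E).
  apply: ge0_le_integral_nomeas => //.
    by move=> r _; rewrite lee_fin (h_ge0 cg).
  move=> r; rewrite /= in_itv/= => /andP[r0 rr].
  have [k /andP[k1 k2]] := rad_small rho0 r0 rr.
  apply: (@le_trans _ _ (f k r)); last first.
    apply: le_trans (@nneseries_lim_ge R (f ^~ r) xpredT 0 k.+1 (fun m _ _ => f0 m r)).
    by rewrite big_nat_recr//= leeDr// sume_ge0.
  rewrite /f lee_fin indicE mem_set ?mulr1; last by rewrite /I/= in_itv/= k1 k2.
  apply: h_growth_le; first by rewrite exprn_ege1//; lra.
    exact: dens_ge0.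
  rewrite /dens mul1r mulrCA; apply: ler_pM.
  - exact: fine_ge0.
  - by rewrite invr_ge0 exprn_ge0// ltW.
  - apply: eucl_le_mass; apply: subset_trans (@eucl_ball_cube x r) _.
    by apply: cube_le; exact: ltW.
  - rewrite ler_pdivlMr ?exprn_gt0// mulrC ler_pdivrMr ?exprn_gt0// -exprMn.
    rewrite lerXn2r ?nnegrE ?(ltW (rk k)) ?mulr_ge0 ?(ltW r0)//.
    by move: k1; rewrite (radS rho k); lra.
rewrite integral_nneseries//.
apply: lee_nneseries => [k _ _|k _]; first by apply: integral_ge0 => r _.
rewrite /f; under eq_integral do rewrite EFinM.
rewrite ge0_integralZl_EFin//; last first.
  by apply/measurable_EFinP; apply: measurable_indic; exact: mIk.
rewrite integral_indic//; last exact: mIk.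
apply: (@le_trans _ _ ((a k)%:E * (rad rho k)%:E)%E).
  rewrite lee_wpmul2l ?lee_fin//.
  apply: (@le_trans _ _ (lebesgue_measure (I k))).
    apply: le_measure; [|by rewrite inE; exact: mIk|exact: subIsetl].
    by rewrite inE; apply: measurableI => //; exact: mIk.
  rewrite lebesgue_measure_itv/= lte_fin ifT; last by have := rk k.+1; rewrite (radS rho k); lra.
  by rewrite -EFinB lee_fin gerBl ltW.
by rewrite -EFinM lee_fin /a le_eqVlt; apply/orP; left; apply/eqP; ring.
Qed.

Lemma integral_wolff_le : exists K, 0 < K /\ forall rho B, 0 < rho ->
  (forall N, \sum_(k < N) rad rho k * wsum mu h rho 1 k <= B) ->
  (\int[mu]_x wolff x rho <= (K * B)%:E)%E.
Proof.
have [K [K0 HK]] := wolff_le_sum.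
exists K; split=> // rho B rho0 HB.
have rk k := @rad_gt0 _ _ rho0 k.
pose f k x : \bar R := (K * (rad rho k * h (dens mu rho 1 k x)))%:E.
have f0 k x : (0 <= f k x)%E by rewrite lee_fin !mulr_ge0 ?(h_ge0 cg)// ltW.
have mh k := measurable_h_dens mu cg rho 1 k.
have mf k : measurable_fun setT (f k).
  by apply/measurable_EFinP; apply: measurable_funM => //; apply: measurable_funM.
apply: (@le_trans _ _ (\int[mu]_x (\sum_(k <oo) f k x))%E).
  apply: ge0_le_integral_nomeas => // x _.
    by apply: integral_ge0 => r _; rewrite lee_fin (h_ge0 cg).
  exact: HK.
rewrite integral_nneseries//.
apply: lime_le.
  by apply: is_cvg_nneseries => k _ _; apply: integral_ge0 => x _.
near=> N; rewrite big_mkord.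
rewrite (eq_bigr (fun k : 'I_N => (K * (rad rho k * wsum mu h rho 1 k))%:E)); last first.
  move=> k _; rewrite /f.
  rewrite (eq_integral (fun x => (K * rad rho k * h (dens mu rho 1 k x))%:E)); last first.
    by move=> x _; rewrite mulrA.
  have Kr : 0 <= K * rad rho k by rewrite mulr_ge0// ltW.
  by rewrite (ge0_integralZT _ (mh k) (fun x => h_ge0 cg _) Kr) (wsumE mu cg rho0) -EFinM -mulrA.
by rewrite sumEFin lee_fin -mulr_sumr ler_pM2l//; exact: HB.
Unshelve. all: by end_near.
Qed.

Lemma sum_le_integral_wolff (Omega : set V) (c r0 : R) : measurable Omega ->
  mu (~` Omega) = 0%E -> 0 < c -> 0 < r0 ->
  (\int[mu]_(x in Omega) wolff x r0 < +oo)%E ->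
  exists rho1 B, [/\ 0 < rho1, 0 <= B & forall rho, 0 < rho -> rho <= rho1 ->
    forall N, \sum_(k < N) rad rho k * wsum mu h rho c k <= B].
Proof.
move=> mO mu0 c0 r00 Ioo.
have [rho1 [K [rho10 K0 HK]]] := sum_le_wolff c0 r00.
set I := (\int[mu]_(x in Omega) wolff x r0)%E in Ioo.
have W0 x : (0 <= wolff x r0)%E by apply: integral_ge0 => r _; rewrite lee_fin (h_ge0 cg).
have I0 : (0 <= I)%E by apply: integral_ge0 => x _.
have Ifin : I \is a fin_num by rewrite ge0_fin_numE.
exists rho1, (fine I / K); split=> //; first by rewrite divr_ge0 ?fine_ge0// ltW.
move=> rho rho0 rhole N.
rewrite ler_pdivlMr// mulrC -lee_fin fineK//.
have rk k := @rad_gt0 _ _ rho0 k.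
have mh k := measurable_h_dens mu cg rho c k.
pose F x := K * \sum_(k < N) rad rho k * h (dens mu rho c k x).
have mF : measurable_fun setT F.
  by apply: measurable_funM => //; apply: measurable_sum => k; apply: measurable_funM.
have F0 x : 0 <= F x.
  by rewrite mulr_ge0 ?(ltW K0)// sumr_ge0// => k _; rewrite mulr_ge0 ?(h_ge0 cg)// ltW.
have -> : (K * \sum_(k < N) rad rho k * wsum mu h rho c k)%:E = (\int[mu]_x (F x)%:E)%E.
  rewrite /F ge0_integralZT//; last 3 first.
  - by apply: measurable_sum => k; apply: measurable_funM.
  - by move=> x; rewrite sumr_ge0// => k _; rewrite mulr_ge0 ?(h_ge0 cg)// ltW.
  - exact: ltW.
  rewrite EFinM; congr (_ * _)%E.
  under eq_integral do rewrite -sumEFin.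
  rewrite ge0_integral_sum//; last 2 first.
  - by move=> k; apply/measurable_EFinP; apply: measurable_funM.
  - by move=> k x _; rewrite lee_fin mulr_ge0 ?(h_ge0 cg)// ltW.
  rewrite -sumEFin; apply: eq_bigr => k _.
  by rewrite (ge0_integralZT _ (mh k) (fun x => h_ge0 cg _) (ltW (rk k))) (wsumE mu cg rho0) [RHS]EFinM.
rewrite (@ge0_negligible_integral _ _ _ mu setT (~` Omega))//.
- rewrite setTD setCK; apply: ge0_le_integral_nomeas => // x _.
    by rewrite lee_fin.
  exact: HK.
- exact: measurableC.
- exact/measurable_EFinP.
- by move=> x _; rewrite lee_fin.
Qed.

End wolff_potential.

(** * From the dual space to the Wolff potential *)

Section lattice.
Context {R : realType}.

Lemma count_integers_le (y : R) M :
  \sum_(j < M) (if `|y - j%:R| <= 2 then 1 else 0 : R) <= 5.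
Proof.
(* For y < 2 the truncation is 0, and the interval of five integers from m still contains all j <= y
   + 2 < 4. *)
pose m := Num.truncn (y - 2).
have jm j : `|y - j%:R| <= 2 -> (m <= j < m + 5)%N.
  rewrite ler_norml => /andP[h1 h2]; have [y2|y2] := leP 0 (y - 2).
    have /andP[m1 m2] := truncn_itv y2; rewrite -/m in m1 m2.
    rewrite -!(ltr_nat R) -[(m <= j)%N](ler_nat R) natrD.
    by move: m2; rewrite -natr1 => m2; apply/andP; split; lra.
  have -> : m = 0%N by apply/truncn0Pn; rewrite -ltNge; lra.
  by rewrite add0n /= -(ltr_nat R); lra.
apply: (@le_trans _ _ (\sum_(0 <= j < M) (if (m <= j < m + 5)%N then 1 else 0 : R))).
  rewrite big_mkord; apply: ler_sum => j _.
  by case: ifPn => [/jm ->//|_]; case: ifP.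
(* The range is enlarged so that it can be cut at m and m + 5 wherever M lies. *)
apply: (@le_trans _ _ (\sum_(0 <= j < M + (m + 5)) (if (m <= j < m + 5)%N then 1 else 0 : R))).
  rewrite [leRHS](big_cat_nat (n := M))//= ?leq_addr// lerDl sumr_ge0// => j _.
  by case: ifP.
rewrite (big_cat_nat (n := m)) //=; last by rewrite addnA (leq_trans (leq_addl M m))// leq_addr.
rewrite (big_cat_nat (m := m) (n := (m + 5)%N)) ?leq_addr ?leq_addl//=.
rewrite big_nat big1 => [|j /andP[_ jlt]]; last by rewrite leqNgt jlt.
rewrite add0r big_nat (eq_bigr (fun=> 1)); last by move=> j ->.
rewrite -big_nat big_const_nat addKn iter_addr_0.
rewrite [X in _ + X <= _]big_nat big1 ?addr0//.
by move=> j /andP[jge _]; rewrite ltnNge jge andbF.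
Qed.

Lemma bump_bounded : exists B : R, 1 <= B /\
  forall s, bump s <= B /\ `|derive1 bump s| <= B.
Proof.
have b2 (s : R) : bump s != 0 -> -2 <= s <= 2 by move=> /bump_neq0; rewrite ler_norml.
have d2 (s : R) : derive1 bump s != 0 -> -2 <= s <= 2.
  by move=> /derive1_bump_neq0; rewrite ler_norml.
have [B1 [B10 HB1]] := smooth1_bounded (@smooth1_bump R) b2.
have [B2 [B20 HB2]] := smooth1_bounded (smooth1_derive1 (@smooth1_bump R)) d2.
exists (1 + B1 + B2); split; first lra.
move=> s; split; last by have := HB2 s; lra.
by have := HB1 s; rewrite ger0_norm ?bump_ge0//; lra.
Qed.

Context {n : nat}.
Local Notation V := 'rV[R]_n.

(** w is a sum of bumps of size r centred at the points p of a lattice of mesh r, with heights t p;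
    sampling t makes w smooth however rough t is. Each x in the range of the lattice is within r of
    some p, whose bump is at least 1 at x. At most 5^n bumps reach x, so w is bounded by C1 times a
    common bound of their heights, and a derivative costs 1 / r. *)
Lemma lattice_test : exists C1 : R, 1 <= C1 /\
  forall (Omega : set V) (r B0 : R) (t : V -> R), 0 < r -> (forall p, 0 <= t p) ->
  (forall p, t p != 0 -> cube p (2 * r) `<=` Omega) ->
  exists w, [/\ test_function Omega w, forall x, 0 <= w x,
    forall x : V, (forall i, `|x ord0 i| <= B0) -> exists p, cube p r x /\ t p <= w x
  & forall x T, 0 <= T -> (forall p, cube p (2 * r) x -> t p <= T) ->
    w x <= C1 * T /\ forall i, `|partial i w x| <= C1 / r * T].
Proof.
have [B [B1 HB]] := bump_bounded.
have B0' : 0 <= B by lra.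
exists (B ^+ n * 5 ^+ n); split.
  by rewrite mulr_ege1// exprn_ege1//; lra.
move=> Omega r B0 t r0 t0 tO.
(* The coordinates r * (z i - M) run from - r M to r M, and r M exceeds |B0|. *)
pose M := (Num.truncn (`|B0| / r)).+1.
pose p (z : {ffun 'I_n -> 'I_(2 * M).+1}) : V := \row_i (r * ((z i)%:R - M%:R)).
pose f (z : {ffun 'I_n -> 'I_(2 * M).+1}) (i : 'I_n) (s : R) := bump (r^-1 * s + - ((z i)%:R - M%:R) : R).
have fE (z : {ffun 'I_n -> 'I_(2 * M).+1}) (x : V) i : r^-1 * x ord0 i + - ((z i)%:R - M%:R) = r^-1 * (x ord0 i - p z ord0 i).
  by rewrite mxE; field; rewrite gt_eqF.
have sf z i : smooth1 (f z i) by move=> k; apply: Ck_affine; exact: smooth1_bump.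
have near_le (s c : R) : (`|r^-1 * s| <= c) = (`|s| <= c * r).
  by rewrite normrM gtr0_norm ?invr_gt0// ler_pdivrMl// mulrC.
pose w (x : V) := \sum_z t (p z) * tens (f z) x.
have tt z : test_function Omega (fun x => t (p z) * tens (f z) x).
  have [t00|tz] := eqVneq (t (p z)) 0.
    rewrite t00 (_ : (fun _ => _) = (fun=> 0)); first exact: test_function0.
    by apply/funext => x; rewrite mul0r.
  apply: test_functionZ.
  apply: (@test_function_compact _ _ _ _ (cube (p z) (2 * r))).
  - exact: smooth_tens.
  - exact: compact_cube.
  - move=> x /tens_neq0 h i; have := h i; rewrite /f fE => /bump_neq0.
    by rewrite near_le.
  - exact: tO.
have f0 z i s : 0 <= f z i s by exact: bump_ge0.
have ten0 z (x : V) : 0 <= tens (f z) x by rewrite /tens prodr_ge0.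
have w0 (x : V) : 0 <= w x by rewrite sumr_ge0// => z _; rewrite mulr_ge0.
exists w; split=> //.
- by apply: test_function_sum.
- move=> x xB.
  have zi i : exists j : 'I_(2 * M).+1, `|x ord0 i - r * (j%:R - M%:R)| <= r.
    pose y := x ord0 i / r + M%:R.
    have MB : `|x ord0 i / r| < M%:R.
      rewrite normrM (gtr0_norm (x := r^-1)) ?invr_gt0//.
      apply: le_lt_trans (truncnS_gt _); rewrite ler_pM2r ?invr_gt0//.
      exact: le_trans (xB i) (ler_norm _).
    have y0 : 0 <= y by move: MB; rewrite ltr_norml /y => /andP[]; lra.
    have /andP[j1 j2] := truncn_itv y0.
    have jM : (Num.truncn y < (2 * M).+1)%N.
      rewrite ltnS -(ler_nat R) natrM; move: MB; rewrite ltr_norml => /andP[_].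
      by move: j1; rewrite /y; lra.
    exists (Ordinal jM) => /=; set J : R := (Num.truncn y)%:R in j1 *.
    have -> : x ord0 i - r * (J - M%:R) = r * (y - J) by rewrite /y; field; rewrite gt_eqF.
    rewrite normrM gtr0_norm// ler_piMr ?(ltW r0)// ler_norml.
    by move: j2; rewrite -natr1 -/J; lra.
  have [z Hz] := choice zi.
  pose Z : {ffun 'I_n -> 'I_(2 * M).+1} := [ffun i => z i].
  have cx : cube (p Z) r x by move=> i; rewrite mxE ffunE; exact: Hz.
  exists (p Z); split=> //.
  rewrite /w (bigD1 Z)//= -[leLHS]addr0 lerD//; last first.
    by rewrite sumr_ge0// => z' _; rewrite mulr_ge0.
  rewrite ler_peMr// /tens.
  have : \prod_(i < n) (1 : R) <= \prod_(i < n) f Z i (x ord0 i).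
    apply: ler_prod => i _; rewrite ler01 /= /f fE bump_ge1// near_le mul1r.
    exact: cx.
  by rewrite big1.
- move=> x T T0 tT.
  (* That x lies in the cube about p z is a condition on each coordinate, so the number of such z is
     a product of one-dimensional counts, each at most 5. *)
  have nz (z : {ffun 'I_n -> 'I_(2 * M).+1}) : \prod_(i < n) (if `|(r^-1 * x ord0 i + M%:R) - (z i)%:R| <= 2 then 1 else 0 : R) =
      if `[< cube (p z) (2 * r) x >] then 1 else 0.
    case: asboolP => h.
      rewrite big1// => i _; rewrite ifT//.
      have -> : r^-1 * x ord0 i + M%:R - (z i)%:R = r^-1 * (x ord0 i - p z ord0 i).
        by rewrite -fE; ring.
      by rewrite near_le; exact: h.
    have /existsNP[i hi] := h; rewrite (bigD1 i)//= ifF ?mul0r//.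
    apply/negP => H; apply: hi; rewrite -near_le -fE.
    by move: H; congr (`|_| <= _); ring.
  have count : \sum_z (if `[< cube (p z) (2 * r) x >] then 1 else 0 : R) <= 5 ^+ n.
    under eq_bigr do rewrite -nz.
    rewrite -(bigA_distr_bigA (fun i (j : 'I_(2 * M).+1) =>
      if `|(r^-1 * x ord0 i + M%:R) - j%:R| <= 2 then 1 else 0 : R)).
    rewrite -[n in leRHS]card_ord -prodr_const; apply: ler_prod => i _.
    rewrite count_integers_le andbT sumr_ge0// => j _; by case: ifP.
  have key (F : {ffun 'I_n -> 'I_(2 * M).+1} -> R) (D : R) : 0 <= D ->
      (forall z, `|F z| <= D) -> (forall z, ~ cube (p z) (2 * r) x -> F z = 0) ->
      `|\sum_z t (p z) * F z| <= D * 5 ^+ n * T.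
    move=> D0 FD F0; apply: le_trans (ler_norm_sum _ _ _) _.
    apply: (@le_trans _ _ (\sum_z (if `[< cube (p z) (2 * r) x >] then 1 else 0) * (D * T))).
      apply: ler_sum => z _; case: asboolP => h; last by rewrite F0// mulr0 normr0 mul0r.
      by rewrite mul1r normrM (ger0_norm (t0 _)) mulrC ler_pM// tT.
    rewrite -mulr_suml (_ : D * 5 ^+ n * T = 5 ^+ n * (D * T)); last by ring.
    by apply: ler_wpM2r; [rewrite mulr_ge0|exact: count].
  have prodB z (F : 'I_n -> R) : (forall i, `|F i| <= B) -> `|\prod_(i < n) F i| <= B ^+ n.
    move=> FB; rewrite normr_prod -[n in leRHS]card_ord -prodr_const.
    by apply: ler_prod => i _; rewrite normr_ge0 FB.
  split.
    rewrite -(ger0_norm (w0 x)); apply: key => //; first exact: exprn_ge0.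
      move=> z; apply: prodB => // i; rewrite ger0_norm//.
      by have [] := HB (r^-1 * x ord0 i + - ((z i)%:R - M%:R)).
    move=> z xz; apply/eqP; apply: contraT => /tens_neq0 h; exfalso; apply: xz => i.
    by have := h i; rewrite /f fE => /bump_neq0; rewrite near_le.
  move=> i.
  have -> : partial i w x = \sum_z t (p z) * partial i (tens (f z)) x.
    rewrite /w (partial_sum _ _ _).2; last by move=> z; have [] := tt z.
    apply: eq_bigr => z _; rewrite partialZ//; exact: smooth_tens.
  rewrite (_ : B ^+ n * 5 ^+ n / r * T = B ^+ n / r * 5 ^+ n * T); last by ring.
  have dE z s : derive1 (f z i) s = r^-1 * derive1 bump (r^-1 * s + - ((z i)%:R - M%:R)).
    have D := smooth1_is_derive (@smooth1_bump R) (r^-1 * s + - ((z i)%:R - M%:R)).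
    by have [_ E] := is_derive_affine D; rewrite derive1E; exact: E.
  have PE z : partial i (tens (f z)) x =
      r^-1 * \prod_(j < n) (if j == i then derive1 bump else bump) (r^-1 * x ord0 j + - ((z j)%:R - M%:R)).
    rewrite partial_tens// /tens (bigD1 i)//= [in RHS](bigD1 i)//= eqxx /upd eqxx dE -mulrA.
    congr (_ * (_ * _)); apply: eq_bigr => j /negbTE ji; by rewrite ji.
  apply: key; first by rewrite divr_ge0 ?exprn_ge0// ltW.
    move=> z; rewrite PE normrM (gtr0_norm (x := r^-1)) ?invr_gt0// mulrC.
    rewrite ler_pM2r ?invr_gt0//; apply: prodB => // j.
    have [b1 b2] := HB (r^-1 * x ord0 j + - ((z j)%:R - M%:R)).
    by case: ifP => // _; rewrite ger0_norm// bump_ge0.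
  move=> z xz; apply/eqP; apply: contraT; rewrite PE mulf_eq0 negb_or => /andP[_].
  rewrite prodf_seq_neq0 => /allP h; exfalso; apply: xz => j.
  have := h j (mem_index_enum _); rewrite /= fE.
  by case: ifP => _ => [/derive1_bump_neq0|/bump_neq0]; rewrite near_le.
Qed.

End lattice.

(** * Supports, measurability and Sobolev norms of test functions *)

Section sobolev_test.
Context {R : realType} {n : nat}.
Local Notation V := 'rV[R]_n.
Local Notation leb := (lebesgue_measure_rV R n).
Implicit Types (Omega K : set V).

(** A point off the support has a null open neighbourhood, which may be shrunk to a member of the
    countable base. *)
Lemma measure_support_null (mu : {measure set V -> \bar R}) : mu (~` measure_support mu) = 0%E.
Proof.
pose F (p : 'rV[rat]_n * nat) : set V := if mu (rational_ball p) == 0%E then rational_ball p else set0.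
have mb p : measurable (rational_ball p : set V).
  by rewrite rational_ball_box; exact: measurable_box.
have nF : mu.-negligible (\bigcup_p F p).
  apply: negligible_bigcup_countType => p; rewrite /F; case: ifPn => [/eqP h|_].
    by exists (rational_ball p); split => //; exact: mb.
  exact: negligible_set0.
have sub : ~` measure_support mu `<=` \bigcup_p F p.
  move=> x; rewrite /measure_support /= => /existsNP[U /not_implyP[oU /not_implyP[Ux muU]]].
  have [p [px pU]] := rational_ballP (open_nbhs_nbhs (conj oU Ux)).
  exists p => //; rewrite /F ifT// eq_le measure_ge0 andbT.
  apply: (@le_trans _ _ (mu U)); last by rewrite leNgt; apply/negP.
  by apply: le_measure; rewrite ?inE//; exact: open_measurable_rV.
have oS : open (~` measure_support mu).
  rewrite openE => x; rewrite /measure_support /= => /existsNP[U /not_implyP[oU /not_implyP[Ux muU]]].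
  rewrite /interior nbhsE; exists U => // y Uy /(_ U oU Uy); exact: muU.
apply: measure_negligible; first exact: open_measurable_rV.
exact: negligibleS sub nF.
Qed.

Lemma compact_margin Omega K : open Omega -> compact K -> K `<=` Omega ->
  exists2 d : R, 0 < d & forall x, K x -> cube x d `<=` Omega.
Proof.
move=> oO /compact_near_coveringP cK KO.
have H : \forall e \near 0^'+, K `<=` [set x | cube x e `<=` Omega].
  apply: (cK _ (0^'+) (fun (e : R) (x : V) => cube x e `<=` Omega)) => x Kx.
  have [e e0 eO] : exists2 e : R, 0 < e & ball x e `<=` Omega.
    by have /nbhs_ballP[e /= e0 ?] := open_nbhs_nbhs (conj oO (KO _ Kx)); exists e.
  exists (ball x (e / 3), [set d : R | 0 < d /\ d < e / 3]) => /=.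
    split; first by apply: nbhsx_ballx; rewrite divr_gt0.
    near=> d; split; near: d; [exact: nbhs_right_gt|apply: nbhs_right_lt].
    by rewrite divr_gt0.
  move=> [y d] /= [xy [d0 de]] z yz; apply: eO.
  apply: (@cube_ball _ _ _ (e / 3 + d)) => //; first lra.
  by apply: cube_trans yz; exact: ball_cube.
have [d [d0 dO]] := filter_ex (filterI (nbhs_right_gt (0 : R)) H).
by exists d.
Unshelve. all: by end_near.
Qed.

(** Omega is a countable union of compact cubes, on each of which f is integrable and so
    measurable. *)
Lemma integrable_loc_measurable Omega (f : V -> R) : open Omega -> integrable_loc Omega f ->
  measurable_fun Omega f.
Proof.
move=> oO lf _ B mB.
pose c (p : 'rV[rat]_n * nat) : V := map_mx ratr p.1.
pose r (p : 'rV[rat]_n * nat) : R := p.2.+1%:R^-1.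
rewrite (_ : Omega `&` f @^-1` B = \bigcup_p (if `[< cube (c p) (r p) `<=` Omega >]
    then cube (c p) (r p) `&` f @^-1` B else set0)).
  apply: countable_bigcupT_measurable => // p; case: asboolP => // pO.
  have /measurable_EFinP mf := measurable_int _ (lf _ (@compact_cube _ _ (c p) (r p)) pO).
  by apply: mf => //; exact: measurable_cube.
apply/seteqP; split=> [x [Ox Bx]|x [p _]]; last first.
  by case: asboolP => // pO [px Bx]; split=> //; exact: pO.
have [e e0 eO] : exists2 e : R, 0 < e & ball x e `<=` Omega.
  by have /nbhs_ballP[e /= e0 ?] := open_nbhs_nbhs (conj oO Ox); exists e.
have e2 : 0 < e / 2 by rewrite divr_gt0.
have [p [px pe pr]] := rational_ball_small x e2.
exists p => //; case: asboolP => [_|]; first by split=> //; exact: ball_cube.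
case=> y hy; apply: eO.
apply: (@cube_ball _ _ _ (r p + r p)) => //.
  by move: pr; rewrite -/(r p); lra.
by apply: cube_trans hy; apply/cube_sym; exact: ball_cube.
Qed.

Lemma measurable_eucl_norm Omega (v : V -> V) :
  (forall i, measurable_fun Omega (fun x => v x ord0 i)) ->
  measurable_fun Omega (fun x => eucl_norm (v x)).
Proof.
move=> mv; rewrite /eucl_norm; apply: homo_measurable.
  by move=> s t st; exact: ler_wsqrtr.
by apply: measurable_sum => i; apply: measurable_funX.
Qed.

Context (G g h : R -> R) (C i : R) (q : nat) (cg : conjugate_growth G g h C i q).

Lemma measurable_G d (T : measurableType d) (D : set T) (f : T -> R) :
  (forall x, 0 <= f x) -> measurable_fun D f -> measurable_fun D (fun x => (G (f x))%:E).
Proof.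
move=> f0 mf; apply/measurable_EFinP.
rewrite (_ : (fun x => _) = (fun x => (fun t => G (Num.max 0 t)) (f x))); last first.
  by apply/funext => x; rewrite max_r.
apply: (@homo_measurable _ _ _ D (fun t => G (Num.max 0 t)) f _ mf) => s t st.
apply: (cg_G_le cg).
  by rewrite le_max lexx.
by rewrite ge_max !le_max lexx st /= orbT.
Qed.

Lemma weak_gradientP Omega u : (exists v, is_weak_gradient Omega u v) ->
  is_weak_gradient Omega u (weak_gradient Omega u).
Proof. exact: (@xgetPex _ (fun=> 0) [set v | is_weak_gradient Omega u v]). Qed.

Lemma measurable_norm_gradient Omega u : open Omega -> sobolev11_loc Omega u ->
  measurable_fun Omega (norm_gradient Omega u).
Proof.
move=> oO [_ [v wv]]; apply: measurable_eucl_norm => j.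
have [lw _] := @weak_gradientP _ _ (ex_intro _ v wv).
exact: integrable_loc_measurable.
Qed.

Lemma sobolev11_loc_test Omega w : test_function Omega w -> sobolev11_loc Omega w.
Proof.
move=> tw; split; last by exists (fun x => \row_i partial i w x); exact: weak_gradient_test.
by apply: continuous_integrable_loc; have [sw _ _] := tw; exact: smooth_continuous.
Qed.

Lemma test_modular_le Omega w (B : V -> R) (l : R) : open Omega -> test_function Omega w ->
  0 < l -> measurable_fun setT B -> (forall x, `|w x| <= B x) ->
  (forall x, eucl_norm (\row_i partial i w x) <= B x) ->
  (orlicz_modular G Omega w l <= \int[leb]_x (G (B x / l))%:E)%E /\
  (orlicz_modular G Omega (norm_gradient Omega w) l <= \int[leb]_x (G (B x / l))%:E)%E.
Proof.
move=> oO tw l0 mB wB dB.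
have mO := open_measurable_rV oO.
have B0 x : 0 <= B x by exact: le_trans (wB x).
have Bl0 x : 0 <= B x / l by rewrite divr_ge0// ltW.
have GB0 x : (0 <= (G (B x / l))%:E)%E by rewrite lee_fin (G_ge0 cg).
have mGB : measurable_fun setT (fun x => (G (B x / l))%:E).
  by apply: measurable_G => //; apply: measurable_funM.
have IO : (\int[leb]_(x in Omega) (G (B x / l))%:E <= \int[leb]_x (G (B x / l))%:E)%E.
  by apply: ge0_subset_integral.
have lw := sobolev11_loc_test tw.
split.
  apply: le_trans IO; apply: ge0_le_integral_nomeas => // x _.
    by rewrite lee_fin (G_ge0 cg)// divr_ge0// ltW.
  rewrite lee_fin (cg_G_le cg)// ?divr_ge0// ?(ltW l0)//.
  by rewrite ler_pM2r ?invr_gt0.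
apply: le_trans IO; rewrite /orlicz_modular.
have wE : {ae leb, forall x, Omega x -> weak_gradient Omega w x = \row_i partial i w x}.
  apply: weak_gradient_unique oO _ (weak_gradient_test tw).
  by apply: weak_gradientP; exists (fun x => \row_i partial i w x); exact: weak_gradient_test.
apply: ae_ge0_le_integral => //.
- by move=> x _; rewrite lee_fin (G_ge0 cg)// divr_ge0// ltW.
- apply: measurable_G => [x|]; first by rewrite divr_ge0// ltW.
  apply: measurable_funM => //; apply: measurableT_comp => //.
  exact: measurable_norm_gradient.
- exact: measurable_funTS.
- apply: filterS wE => x wx Ox; rewrite lee_fin (cg_G_le cg)//.
    by rewrite divr_ge0// ltW.
  rewrite ler_pM2r ?invr_gt0// ger0_norm ?sqrtr_ge0//.
  by rewrite /norm_gradient wx.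
Qed.

(** The modulars of w and of its gradient must add up to at most 1, hence the threshold 1/2 for the
    common majorant B. *)
Lemma test_sobolev_norm_le Omega w (B : V -> R) (l : R) : open Omega -> test_function Omega w ->
  0 < l -> measurable_fun setT B -> (forall x, `|w x| <= B x) ->
  (forall x, eucl_norm (\row_i partial i w x) <= B x) ->
  (\int[leb]_x (G (B x / l))%:E <= (2^-1)%:E)%E ->
  sobolev G Omega w /\ (sobolev_norm G Omega w <= l%:E)%E.
Proof.
move=> oO tw l0 mB wB dB I2.
have [I3 I4] := test_modular_le oO tw l0 mB wB dB.
have h3 := le_trans I3 I2; have h4 := le_trans I4 I2.
have half1 : ((2^-1)%:E <= 1 :> \bar R)%E by rewrite lee_fin; lra.
have lw := sobolev11_loc_test tw.
have lux f : (orlicz_modular G Omega f l <= (2^-1)%:E)%E -> (luxemburg_norm G Omega f < +oo)%E.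
  move=> fl; apply: (@le_lt_trans _ _ l%:E); last exact: ltry.
  by apply: ereal_inf_lbound; exists l => //; split=> //; exact: le_trans half1.
split.
  split=> //.
    split; last exact: lux.
    apply: measurable_funTS; apply: continuous_measurable_rV.
    by have [sw _ _] := tw; exact: smooth_continuous.
  by split; [exact: measurable_norm_gradient|exact: lux].
apply: ereal_inf_lbound; exists l => //; split=> //.
apply: le_trans (leeD h3 h4) _; rewrite -EFinD lee_fin; lra.
Qed.

Lemma test_sobolev0 Omega w : open Omega -> test_function Omega w ->
  sobolev G Omega w -> sobolev0 G Omega w.
Proof.
move=> oO tw sw; split=> // e e0; exists w; split=> //.
rewrite (_ : (fun x => w x - w x) = (fun=> 0)); last by apply/funext => x; rewrite subrr.
apply: (@le_lt_trans _ _ (e / 2)%:E); last by rewrite lte_fin; lra.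
have p0 j (x : V) : partial j (fun _ : V => 0 : R) x = 0 by exact: derive_cst.
apply: (test_sobolev_norm_le (B := fun=> 0) oO (test_function0 _) _ _ _ _ _).2 => //.
- by rewrite divr_gt0.
- by move=> x; rewrite normr0.
- move=> x; rewrite /eucl_norm big1 ?sqrtr0// => j _.
  by rewrite mxE p0 expr0n.
- rewrite (eq_integral (fun=> 0%E)) ?integral0 ?lee_fin// => x _.
  by rewrite mul0r (cg_G0 cg).
Qed.

End sobolev_test.

(** * Boundedness of the energy *)

Section dual_to_wolff.
Context {R : realType}.

(** Put X = 1 + b (E + c) >= 1. The hypothesis gives X <= A X^(1/i), so X^(1 - 1/i) <= A, and X is
    bounded because i > 1. *)
Lemma sublinear_bound (a b c i : R) : 1 < i -> 0 <= a -> 0 <= b -> 0 <= c ->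
  exists M, forall E, 0 <= E -> E <= a * (1 + b * (E + c)) `^ i^-1 -> E <= M.
Proof.
move=> i1 a0 b0 c0; pose A := 1 + b * (a + c); pose e := 1 - i^-1.
have i0 : 0 < i by lra.
have ii : i^-1 < 1 by rewrite invf_lt1.
have e0 : 0 < e by rewrite /e; lra.
exists (a * A `^ e^-1) => E E0 HE.
pose X := 1 + b * (E + c); rewrite -/X in HE.
have bEc : 0 <= b * (E + c) by rewrite mulr_ge0// addr_ge0.
have X1 : 1 <= X by rewrite /X; lra.
have X0 : 0 < X by lra.
have Xi1 : 1 <= X `^ i^-1 by rewrite -(powRr0 X) ler_powR// ltW// invr_gt0.
have XA : X <= A * X `^ i^-1.
  rewrite /X /A mulrDl mul1r lerD// -mulrA ler_wpM2l// mulrDl lerD//.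
  by rewrite ler_peMr.
have XeA : X `^ e <= A.
  have XE : X `^ e * X `^ i^-1 = X.
    by rewrite -powRD ?(gt_eqF X0) ?implybT// /e subrK powRr1// ltW.
  by rewrite -(ler_pM2r (lt_le_trans ltr01 Xi1)) XE.
have XAe : X <= A `^ e^-1.
  rewrite -[leLHS](powRr1 (ltW X0)) -(divff (lt0r_neq0 e0)) powRrM.
  apply: ge0_ler_powR; rewrite ?nnegrE ?powR_ge0//; first by rewrite invr_ge0 ltW.
  by rewrite /A addr_ge0// mulr_ge0// addr_ge0.
apply: le_trans HE _; rewrite ler_wpM2l//; apply: le_trans XAe.
by rewrite -[leRHS](powRr1 (ltW X0)) ler_powR// ltW.
Qed.

Context {n : nat} (n0 : (0 < n)%N) (mu : {finite_measure set 'rV[R]_n -> \bar R}).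
Local Notation V := 'rV[R]_n.
Local Notation leb := (lebesgue_measure_rV R n).
Context (G g h : R -> R) (C i : R) (q : nat) (cg : conjugate_growth G g h C i q).

(** As 8 r_(k+3) = r_k, the enlarged cube at scale k + 3 is the original one at scale k; only the
    denominators differ, by 8^(n-1), which the growth of h absorbs. The first three scales go into
    c0. *)
Lemma wsum8_le (rho : R) : 0 < rho -> exists K c0, [/\ 0 <= K, 0 <= c0 & forall N,
  \sum_(k < N) rad rho k * wsum mu h rho 8 k <=
  K * \sum_(k < N) rad rho k * wsum mu h rho 1 k + c0].
Proof.
move=> rho0; have rk k := @rad_gt0 _ _ rho0 k.
have w0 c k := @wsum_ge0 _ _ mu _ _ _ _ _ _ cg rho c k.
pose K := C * (8 ^+ n.-1) ^+ q.
have C1 := cg_C cg.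
have K0 : 0 <= K by rewrite mulr_ge0 ?exprn_ge0//; lra.
have rad3 k : rad rho k = 8 * rad rho k.+3.
  by rewrite (radS rho k) (radS rho k.+1) (radS rho k.+2); ring.
exists K, (\sum_(k < 3) rad rho k * wsum mu h rho 8 k); split=> // [|N].
  by rewrite sumr_ge0// => k _; rewrite mulr_ge0// ltW.
have step k : rad rho k.+3 * wsum mu h rho 8 k.+3 <= K * (rad rho k * wsum mu h rho 1 k).
  have : wsum mu h rho 8 k.+3 <= K * wsum mu h rho 1 k.
    rewrite -lee_fin EFinM -!(wsumE mu cg rho0).
    rewrite -ge0_integralZT//; last 2 first.
    - exact: measurable_h_dens cg rho 1 k.
    - by move=> x; exact: h_ge0 cg _.
    apply: ge0_le_integral_nomeas => // x _; first by rewrite lee_fin (h_ge0 cg).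
    rewrite lee_fin; apply: (h_growth_le cg); first by rewrite exprn_ege1//; lra.
      exact: dens_ge0.
    rewrite /dens mul1r -(rad3 k) mulrCA ler_wpM2l ?mass_ge0//.
    rewrite ler_pdivlMr ?exprn_gt0// mulrC ler_pdivrMr ?exprn_gt0// -exprMn.
    by rewrite -(rad3 k).
  move=> H; have := rk k.+3; have := rk k; rewrite (rad3 k) => r1 r2.
  apply: (@le_trans _ _ (rad rho k.+3 * (K * wsum mu h rho 1 k))); first by rewrite ler_pM2l.
  rewrite mulrCA ler_wpM2l// ler_wpM2r//; lra.
have sum0 a c : 0 <= \sum_(a <= k < c) rad rho k * wsum mu h rho 1 k.
  by rewrite sumr_ge0// => k _; rewrite mulr_ge0// ltW.
have sum80 a c : 0 <= \sum_(a <= k < c) rad rho k * wsum mu h rho 8 k.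
  by rewrite sumr_ge0// => k _; rewrite mulr_ge0// ltW.
apply: (@le_trans _ _ (\sum_(0 <= k < N.+3) rad rho k * wsum mu h rho 8 k)).
  rewrite -(big_mkord xpredT (fun k => rad rho k * wsum mu h rho 8 k)).
  rewrite [leRHS](big_cat_nat (n := N))//= ?lerDl//.
  by rewrite -addn3 leq_addr.
rewrite (big_cat_nat (n := 3))//= addrC lerD//; last by rewrite big_mkord.
rewrite -[3%N in X in X <= _]add0n big_addn !subSS subn0 mulr_sumr big_mkord.
by apply: ler_sum => k _; rewrite addn3.
Qed.

Lemma dual_sum_bounded (Omega S : set V) : open Omega -> compact S -> S `<=` Omega ->
  mu (~` S) = 0%E -> in_dual G Omega mu ->
  exists rho B, 0 < rho /\ forall N, \sum_(k < N) rad rho k * wsum mu h rho 1 k <= B.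
Proof.
move=> oO cS SO muS [L [[_ [CL HL]] Lmu]].
have [d d0 dO] := compact_margin oO cS SO.
(* The bumps at scale k live within 4 r_k of S, so d / 6 keeps them in Omega; rho <= 1 lets U bound
   u as well as its gradient. *)
pose rho := Num.min 1 (d / 6).
have rho0 : 0 < rho by rewrite lt_min ltr01 divr_gt0.
have rho1 : rho <= 1 by rewrite ge_min lexx.
have rhod6 : rho <= d / 6 by rewrite ge_min lexx orbT.
have rk k := @rad_gt0 _ _ rho0 k.
have rkrho k : rad rho k <= rho by have := rad_le rho0 (leq0n k); rewrite {2}/rad expr0 divr1.
have [B0 B0S] : exists B0, forall x, S x -> forall j, `|x ord0 j| <= B0.
  have /compact_bounded[M [_ MS]] := cS; exists (`|M| + 1) => x Sx j.
  apply: le_trans (coord_le_norm x j) _; apply: (MS (`|M| + 1)) => //.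
  by rewrite (le_lt_trans (ler_norm _))// ltrDl.
have [C1 [C11 Hlat]] := @lattice_test R n.
(* The cube of half-side 2 r_k about p contains that of half-side r_k about x when p is within r_k
   of x, which bounds u from below; it lies in that of half-side 4 r_k about x when p is within 2
   r_k, which bounds u by U. Fubini turns 4 into 8. *)
pose t k (p : V) := h (dens mu rho 2 k p).
have t0 k p : 0 <= t k p by exact: h_ge0 cg _.
have mS : measurable S by exact: compact_measurable_rV.
(* A nonzero height means that mu charges the cube about p, which therefore meets S. *)
have tO k p : t k p != 0 -> cube p (2 * rad rho k) `<=` Omega.
  move=> tp.
  have [x [Sx px]] : exists x, S x /\ cube p (2 * rad rho k) x.
    apply: contrapT => H; move/eqP : tp; apply; rewrite /t /dens.
    have -> : mass mu p (2 * rad rho k) = 0.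
      rewrite /mass (_ : mu _ = 0%E)//; apply/eqP; rewrite eq_le measure_ge0 andbT -muS.
      apply: le_measure; rewrite ?inE; [exact: measurable_cube|exact: measurableC|].
      by move=> x px Sx; apply: H; exists x.
    by rewrite mul0r (cg_h0 cg).
  move=> y py; apply: (dO x Sx); apply: (@cube_le _ _ _ (2 * rad rho k + 2 * rad rho k)).
    by have := rkrho k; lra.
  by apply: cube_trans py; apply/cube_sym.
have /choice[w Hw] k := Hlat Omega (rad rho k) B0 (t k) (rk k) (t0 k) (tO k).
pose u N x := \sum_(k < N) rad rho k * w k x.
have tu N : test_function Omega (u N).
  by apply: test_function_sum => k; apply: test_functionZ; have [] := Hw k.
pose U N x := \sum_(k < N) h (dens mu rho 4 k x).
have mU N : measurable_fun setT (U N).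
  by apply: measurable_sum => k; exact: measurable_h_dens cg rho 4 k.
have T0 k x : 0 <= h (dens mu rho 4 k x) by exact: h_ge0 cg _.
have tT k x p : cube p (2 * rad rho k) x -> t k p <= h (dens mu rho 4 k x).
  move=> px; apply: (cg_h_le cg); rewrite /dens ler_wpM2r ?invr_ge0 ?exprn_ge0 ?(ltW (rk k))//.
  apply: mass_le => y py; apply: (@cube_le _ _ _ (2 * rad rho k + 2 * rad rho k)); first lra.
  by apply: cube_trans py; apply/cube_sym.
have wU k x := let: And4 _ _ _ H := Hw k in H x _ (T0 k x) (tT k x).
have w0 k x : 0 <= w k x by have [_ H _ _] := Hw k; exact: H.
have u0 N x : 0 <= u N x by rewrite sumr_ge0// => k _; rewrite mulr_ge0// ltW.
have uU N x : u N x <= C1 * U N x.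
  rewrite mulr_sumr; apply: ler_sum => k _; have [H _] := wU k x.
  apply: le_trans H; rewrite ler_piMl//; exact: le_trans (rkrho k) rho1.
have duU N x j : `|partial j (u N) x| <= C1 * U N x.
  rewrite /u (partial_sum _ _ _).2; last first.
    by move=> k; apply: smoothZ; have [[]] := Hw k.
  apply: le_trans (ler_norm_sum _ _ _) _; rewrite mulr_sumr; apply: ler_sum => k _.
  rewrite partialZ; last by have [[]] := Hw k.
  have [_ /(_ j) H] := wU k x; rewrite normrM gtr0_norm//.
  by rewrite mulrC -ler_pdivlMr// mulrAC.
pose C2 := n.+1%:R * C1.
have C21 : 1 <= C2 by rewrite mulr_ege1// ler1n.
have U0 N x : 0 <= U N x by rewrite sumr_ge0.
have uB N x : `|u N x| <= C2 * U N x.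
  rewrite ger0_norm//; apply: le_trans (uU N x) _; rewrite ler_wpM2r// ler_peMl ?ler1n//; lra.
have duB N x : eucl_norm (\row_j partial j (u N) x) <= C2 * U N x.
  apply: le_trans (eucl_norm_le_sum _) _.
  apply: (@le_trans _ _ (\sum_(j < n) C1 * U N x)).
    by apply: ler_sum => j _; rewrite mxE.
  rewrite sumr_const card_ord -mulr_natl mulrA ler_wpM2r// ler_wpM2r//; first lra.
  by rewrite ler_nat.
have [K [K0 HK]] := integral_G_sum n0 mu cg rho0 (ltr0n R 4).
have [K8 [c8 [K80 c80 H8]]] := wsum8_le rho0.
pose E N := \sum_(k < N) rad rho k * wsum mu h rho 1 k.
have E0 N : 0 <= E N.
  by rewrite sumr_ge0// => k _; rewrite mulr_ge0 ?(wsum_ge0 mu cg)// ltW.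
(* On S, which carries mu, each w k is at least h (dens mu rho 1 k x). *)
have EL N : E N <= L (u N).
  rewrite (Lmu _ (tu N)).
  have [M [uM _]] := test_function_vanishes (tu N).
  have cu : continuous (u N) by have [su _ _] := tu N; exact: smooth_continuous.
  have [Bu [_ uBu]] := continuous_bounded_off cu uM.
  have mu_u : measurable_fun setT (u N) by exact: continuous_measurable_rV.
  have mO := open_measurable_rV oO.
  have iu : mu.-integrable Omega (EFin \o u N).
    apply: (@integrable_bounded _ _ _ _ _ _ Bu) => //; last exact: measurable_funTS.
    by rewrite -ge0_fin_numE// fin_num_measure.
  rewrite -lee_fin /Rintegral fineK; last exact: integrable_fin_num.
  rewrite /E -sumEFin.
  apply: (@le_trans _ _ (\int[mu]_x (\sum_(k < N) rad rho k * h (dens mu rho 1 k x))%:E)%E).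
    under eq_integral do rewrite -sumEFin.
    have mh k : measurable_fun setT (fun x => rad rho k * h (dens mu rho 1 k x)).
      by apply: measurable_funM => //; exact: measurable_h_dens cg rho 1 k.
    rewrite ge0_integral_sum//; last 2 first.
    - by move=> k; exact/measurable_EFinP.
    - by move=> k x _; rewrite lee_fin mulr_ge0 ?(h_ge0 cg)// ltW.
    apply: lee_sum => k _.
    by rewrite (ge0_integralZT _ (measurable_h_dens mu cg rho 1 k) (fun x => h_ge0 cg _)
      (ltW (rk k))) (wsumE mu cg rho0) -EFinM.
  have mF : measurable_fun setT (fun x => (\sum_(k < N) rad rho k * h (dens mu rho 1 k x))%:E).
    apply/measurable_EFinP; apply: measurable_sum => k; apply: measurable_funM => //.
    exact: measurable_h_dens cg rho 1 k.
  have F0 x : (0 <= (\sum_(k < N) rad rho k * h (dens mu rho 1 k x))%:E)%E.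
    by rewrite lee_fin sumr_ge0// => k _; rewrite mulr_ge0 ?(h_ge0 cg)// ltW.
  rewrite (@ge0_negligible_integral _ _ _ mu setT (~` S))//; last exact: measurableC.
  rewrite setTD setCK.
  apply: (@le_trans _ _ (\int[mu]_(x in S) (u N x)%:E)%E); last first.
    apply: ge0_subset_integral => //; first exact/measurable_EFinP/measurable_funTS.
    by move=> x _; rewrite lee_fin.
  apply: ge0_le_integral_nomeas => // x Sx; rewrite lee_fin; apply: ler_sum => k _.
  rewrite ler_pM2l//; have [_ _ H _] := Hw k.
  have [p [px tp]] := H x (B0S x Sx); apply: le_trans tp.
  apply: (cg_h_le cg); rewrite /dens ler_wpM2r ?invr_ge0 ?exprn_ge0 ?(ltW (rk k))//.
  apply: mass_le => y xy; apply: (@cube_le _ _ _ (rad rho k + 1 * rad rho k)); first lra.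
  exact: cube_trans px xy.
(* The modular will be at most p / X with X = 1 + 2 * p, for p half of Kt * (E N + c8); the factor 2
   brings this below 1/2. *)
pose Kt := 2 * (C * C2 ^+ q * K * (K8 + 1)).
have C0 : 0 <= C by have := cg_C cg; lra.
have Kt0 : 0 <= Kt by rewrite !mulr_ge0 ?exprn_ge0//; lra.
have [M HM] := sublinear_bound (cg_i cg) (normr_ge0 CL) Kt0 c80.
exists rho, M; split=> // N; apply: HM; first exact: E0.
set X := 1 + Kt * (E N + c8).
have X1 : 1 <= X by rewrite lerDl mulr_ge0// addr_ge0.
(* The growth of G of order at least i turns division of the argument by l into division of the
   modular by X. *)
pose l := X `^ i^-1.
have i0 : 0 < i by have := cg_i cg; lra.
have l1 : 1 <= l by rewrite -(powRr0 X) ler_powR// ltW// invr_gt0.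
have l0 : 0 < l by lra.
have lX : l `^ i = X by rewrite /l -powRrM mulVf ?gt_eqF// powRr1//; lra.
have half : (\int[leb]_x (G (C2 * U N x / l))%:E <= (2^-1)%:E)%E.
  pose c := C * C2 ^+ q / X.
  have c0 : 0 <= c by rewrite divr_ge0 ?mulr_ge0 ?exprn_ge0//; lra.
  have mGU : measurable_fun setT (fun x => G (U N x)).
    by apply/measurable_EFinP; exact: (measurable_G cg (U0 N) (mU N)).
  apply: (@le_trans _ _ (\int[leb]_x (c * G (U N x))%:E)%E).
    apply: ge0_le_integral_nomeas => // x _.
      by rewrite lee_fin (G_ge0 cg)// divr_ge0 ?mulr_ge0//; lra.
    rewrite lee_fin; apply: le_trans (cg_G_down cg l1 _) _; first by rewrite mulr_ge0//; lra.
    rewrite lX /c [leRHS]mulrAC; apply: ler_wpM2r; first by rewrite invr_ge0; lra.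
    exact: (cg_G_up cg C21 (U0 N x)).
  rewrite ge0_integralZT//; last by move=> x; exact: (G_ge0 cg).
  apply: le_trans (lee_wpmul2l _ (HK N)) _; first by rewrite lee_fin.
  rewrite -EFinM lee_fin.
  have -> : 2 * 4 = 8 :> R by ring.
  apply: (@le_trans _ _ (c * (K * ((K8 + 1) * (E N + c8))))).
    rewrite ler_wpM2l// ler_wpM2l//; apply: le_trans (H8 N) _.
    by have := E0 N; rewrite /E; nra.
  pose p := C * C2 ^+ q * K * (K8 + 1) * (E N + c8).
  have -> : c * (K * ((K8 + 1) * (E N + c8))) = p / X by rewrite /c /p; ring.
  have XE : X = 1 + 2 * p by rewrite /X /Kt /p; ring.
  by rewrite ler_pdivrMr XE; lra.
have [sobu normu] := test_sobolev_norm_le cg oO (tu N) l0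
  (measurable_funM (measurable_cst C2) (mU N)) (uB N) (duB N) half.
have := HL _ (test_sobolev0 cg oO (tu N) sobu).
have normu0 : (0 <= sobolev_norm G Omega (u N))%E.
  by apply: le_ereal_inf_tmp => _ [r [r0 _] <-]; rewrite lee_fin ltW.
move=> LC; rewrite -lee_fin; apply: (@le_trans _ _ (`|L (u N)|%:E)%E).
  by rewrite lee_fin; apply: le_trans (EL N) (ler_norm _).
apply: le_trans LC _; apply: (@le_trans _ _ (`|CL|%:E * sobolev_norm G Omega (u N))%E).
  by apply: lee_wpmul2r => //; rewrite lee_fin ler_norm.
by rewrite EFinM; apply: lee_wpmul2l => //; rewrite lee_fin.
Qed.

End dual_to_wolff.

(** * From the Wolff potential to the dual space *)

Section mollifier1.
Context {R : realType}.

Definition molk (r s : R) : R := r^-1 * derive1 step (r^-1 * s).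

(** A primitive of the difference of the mollifiers at scales r and r / 2. The two steps agree off
    [-r, r], which makes it compactly supported; it is bounded by 1 whatever r is, and this saves a
    factor 1 / r in [kerK]. *)
Definition stepdiff (r s : R) : R := step (r^-1 * s) - step ((r / 2)^-1 * s).

Lemma smooth1_reflect (F : R -> R) (c : R) : smooth1 F -> smooth1 (fun s => F (c - s)).
Proof.
move=> sF k; have := @Ck_affine _ k F (-1) c (sF k).
by rewrite (_ : (fun _ => _) = (fun s => F (c - s)))//; apply/funext => s; rewrite mulN1r addrC.
Qed.

Lemma smooth1_scale (F : R -> R) (a : R) : smooth1 F -> smooth1 (fun s => F (a * s)).
Proof.
move=> sF k; have := @Ck_affine _ k F a 0 (sF k).
by rewrite (_ : (fun _ => _) = (fun s => F (a * s)))//; apply/funext => s; rewrite addr0.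
Qed.

Lemma smooth1_molk r : smooth1 (molk r).
Proof.
move=> k; apply: CkM; first exact: Ck_cst.
by apply: smooth1_scale; apply: smooth1_derive1; exact: smooth1_step.
Qed.

Lemma smooth1_stepdiff r : smooth1 (stepdiff r).
Proof.
move=> k; apply: CkD; first by apply: smooth1_scale; exact: smooth1_step.
rewrite (_ : (fun _ => _) = (fun s => -1 * step ((r / 2)^-1 * s))); last first.
  by apply/funext => s; rewrite mulN1r.
by apply: CkM; [exact: Ck_cst|apply: smooth1_scale; exact: smooth1_step].
Qed.

Lemma derive1_reflect (F : R -> R) (c s : R) : smooth1 F ->
  derive1 (fun s => F (c - s)) s = - derive1 F (c - s).
Proof.
move=> sF; have D : is_derive (-1 * s + c) 1 F (derive1 F (c - s)).
  by rewrite mulN1r addrC; exact: smooth1_is_derive.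
have [_ E] := is_derive_affine D.
rewrite derive1E -mulN1r -E; congr ('D_1 _ s).
by apply/funext => t; rewrite mulN1r addrC.
Qed.

Lemma is_derive_scale (F : R -> R) (a s : R) : smooth1 F ->
  is_derive s 1 (fun s => F (a * s)) (a * derive1 F (a * s)).
Proof.
move=> sF; have D : is_derive (a * s + 0) 1 F (derive1 F (a * s)).
  by rewrite addr0; exact: smooth1_is_derive.
have := is_derive_affine D.
by rewrite (_ : (fun _ => _) = (fun s => F (a * s)))//; apply/funext => t; rewrite addr0.
Qed.

Lemma derive1_stepdiff r s : derive1 (stepdiff r) s = molk r s - molk (r / 2) s.
Proof.
have [_ E] := is_deriveB (is_derive_scale r^-1 s (@smooth1_step R))
  (is_derive_scale (r / 2)^-1 s (@smooth1_step R)).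
by rewrite derive1E; exact: E.
Qed.

Lemma molk_ge0 r s : 0 < r -> 0 <= molk r s.
Proof. by move=> r0; rewrite /molk mulr_ge0 ?derive1_step_ge0// invr_ge0 ltW. Qed.

Lemma scale_gt1 (r s : R) : 0 < r -> (1 < `|r^-1 * s|) = (r < `|s|).
Proof. by move=> r0; rewrite normrM gtr0_norm ?invr_gt0// ltr_pdivlMl// mulr1. Qed.

Lemma molk_off r s : 0 < r -> r < `|s| -> molk r s = 0.
Proof. by move=> r0 rs; rewrite /molk derive1_step0 ?mulr0// scale_gt1. Qed.

Lemma stepdiff_off r s : 0 < r -> r < `|s| -> stepdiff r s = 0.
Proof.
move=> r0 rs; have r20 : 0 < r / 2 by rewrite divr_gt0.
have h1 : 1 < `|r^-1 * s| by rewrite scale_gt1.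
have h2 : 1 < `|(r / 2)^-1 * s| by rewrite scale_gt1//; lra.
rewrite /stepdiff; have [s0|s0] := leP 0 s.
  rewrite !step_ge ?subrr// ltW//.
    by move: h2; rewrite ger0_norm// mulr_ge0// invr_ge0 ltW.
  by move: h1; rewrite ger0_norm// mulr_ge0// invr_ge0 ltW.
rewrite !step_le ?subrr//.
  by move: h2; rewrite ler0_norm ?mulr_ge0_le0 ?invr_ge0 ?(ltW r20)// ?(ltW s0)//; lra.
by move: h1; rewrite ler0_norm ?mulr_ge0_le0 ?invr_ge0 ?(ltW r0)// ?(ltW s0)//; lra.
Qed.

Lemma stepdiff_le1 r s : `|stepdiff r s| <= 1.
Proof.
rewrite /stepdiff; move: (step_ge0 (r^-1 * s)) (step_le1 (r^-1 * s))
  (step_ge0 ((r / 2)^-1 * s)) (step_le1 ((r / 2)^-1 * s)) => h1 h2 h3 h4.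
by rewrite ler_norml; apply/andP; split; lra.
Qed.

Lemma molk_bounded : exists B : R, 1 <= B /\ forall r s, 0 < r -> `|molk r s| <= B / r.
Proof.
have d2 (s : R) : derive1 step s != 0 -> -1 <= s <= 1.
  by move=> /eqP ds; rewrite -ler_norml leNgt; apply/negP => /derive1_step0.
have [B [B0 HB]] := smooth1_bounded (smooth1_derive1 (@smooth1_step R)) d2.
exists (1 + B); split; first lra.
move=> r s r0; rewrite /molk normrM gtr0_norm ?invr_gt0// mulrC ler_pM2r ?invr_gt0//.
by have := HB (r^-1 * s); lra.
Qed.

Lemma integral_molk (r c : R) : 0 < r ->
  (\int[lebesgue_measure]_s (molk r (c - s))%:E = 1)%E.
Proof.
move=> r0; pose F (s : R) := - step (r^-1 * (c - s)).
have sF : smooth1 F.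
  have s1 := smooth1_reflect c (smooth1_scale r^-1 (@smooth1_step R)).
  move=> k; rewrite (_ : F = (fun s => -1 * step (r^-1 * (c - s)))); last first.
    by apply/funext => s; rewrite mulN1r.
  by apply: CkM; [exact: Ck_cst|exact: s1].
have sm := smooth1_reflect c (smooth1_molk r).
have FE s : derive1 F s = molk r (c - s).
  have [_ E] := is_deriveN (smooth1_is_derive
    (smooth1_reflect c (smooth1_scale r^-1 (@smooth1_step R))) s).
  rewrite derive1E (_ : F = - (fun s => step (r^-1 * (c - s))))// E.
  rewrite (@derive1_reflect (fun s => step (r^-1 * s)))//; last exact: smooth1_scale (@smooth1_step R).
  rewrite opprK derive1E; have [_ ->] := is_derive_scale r^-1 (c - s) (@smooth1_step R).
  by [].
have cr : c - r < c + r by lra.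
have := @continuous_FTC2 _ (fun s => molk r (c - s)) F _ _ cr.
rewrite (_ : (F (c + r))%:E - (F (c - r))%:E = 1)%E; last first.
  rewrite -EFinB /F; congr EFin.
  have -> : r^-1 * (c - (c + r)) = -1 by field; rewrite gt_eqF.
  have -> : r^-1 * (c - (c - r)) = 1 by field; rewrite gt_eqF.
  by rewrite step_le// step_ge//; ring.
move=> <-.
- rewrite [RHS]integral_mkcond; apply: eq_integral => s _; rewrite /patch.
  case: ifPn => // /negP hs; rewrite molk_off// ltNge; apply/negP => h; apply: hs.
  by rewrite inE /= in_itv/=; move: h; rewrite ler_norml => /andP[]; lra.
- by apply: continuous_subspaceT; exact: smooth1_continuous.
- have cF := smooth1_continuous sF; split.
  + by move=> s _; have [] := smooth1_is_derive sF s.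
  + by apply: cvg_at_right_filter; exact: cF.
  + by apply: cvg_at_left_filter; exact: cF.
- by move=> s _; exact: FE.
Qed.

End mollifier1.

Section integral_tens.
Context {R : realType}.

(** Lebesgue measure in dimension n + 1 is the image of a product measure, so Tonelli splits off one
    factor at a time. *)
Lemma integral_tens n (f : 'I_n -> R -> R) : (forall i s, 0 <= f i s) ->
  (forall i, measurable_fun setT (f i)) ->
  (\int[lebesgue_measure_rV R n]_x (tens f x)%:E =
   \prod_(i < n) \int[lebesgue_measure]_s (f i s)%:E)%E.
Proof.
have mtens m (g : 'I_m -> R -> R) : (forall i, measurable_fun setT (g i)) ->
    measurable_fun setT (fun x : 'rV[R]_m => tens g x).
  move=> mg; apply: measurable_prod => i _.
  exact: measurableT_comp (mg i) (measurable_coord i).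
elim: n f => [|n IH] f f0 mf.
  rewrite big_ord0 /=.
  rewrite integral_dirac//; first by rewrite diracT mul1e /tens big_ord0.
  by apply/measurable_EFinP; exact: mtens.
pose f' (i : 'I_n) := f (lift ord0 i).
have f'p i s : 0 <= f' i s by exact: f0.
rewrite big_ord_recl -/(f' _) /=.
have -> : (\prod_(i < n) \int[lebesgue_measure]_s (f (lift ord0 i) s)%:E =
    \int[lebesgue_measure_rV R n]_x (tens f' x)%:E)%E.
  by rewrite (IH f' (fun i => f0 _) (fun i => mf _)).
have mfE : measurable_fun setT (fun x : 'rV[R]_n.+1 => (tens f x)%:E).
  by apply/measurable_EFinP; exact: mtens.
have tens0 m (g : 'I_m -> R -> R) x : (forall i s, 0 <= g i s) -> 0 <= tens g x.
  by move=> g0; apply: prodr_ge0.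
have -> : (\int[lebesgue_succ (lebesgue_measure_rV R n)]_x (tens f x)%:E =
  \int[(@lebesgue_measure R \x lebesgue_measure_rV R n)%E]_p (tens f (rV_cons p))%:E)%E.
  rewrite /lebesgue_succ.
  rewrite (ge0_integral_pushforward (@measurable_rV_cons R n))//.
  by move=> x _; rewrite lee_fin tens0.
have E (p : measurableTypeR R * 'rV[R]_n) : tens f (rV_cons p) = f ord0 p.1 * tens f' p.2.
  rewrite /tens big_ord_recl; congr (f ord0 _ * _).
    by have /(congr1 fst) := rV_consK p.
  apply: eq_bigr => i _; congr (f _ _).
  by have /(congr1 snd)/rowP/(_ i) := rV_consK p; rewrite mxE.
under eq_integral do rewrite E.
have mp : measurable_fun setT (fun p : measurableTypeR R * 'rV[R]_n => (f ord0 p.1 * tens f' p.2)%:E).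
  apply/measurable_EFinP; apply: measurable_funM.
    by apply: (measurableT_comp (mf ord0)); exact: measurable_fst.
  by apply: (measurableT_comp (mtens _ f' _)); [move=> i; exact: mf|exact: measurable_snd].
rewrite fubini_tonelli1//; last by move=> p; rewrite lee_fin mulr_ge0// tens0.
rewrite /fubini_F /=.
have f'0 x : 0 <= tens f' x by rewrite tens0.
have mf' : measurable_fun setT (fun x => tens f' x) by apply: mtens => i; exact: mf.
under eq_integral do rewrite (ge0_integralZT _ mf' f'0 (f0 _ _)).
set c := (\int[lebesgue_measure_rV R n]_x (tens f' x)%:E)%E.
have c0 : (0 <= c)%E by apply: integral_ge0 => x _; rewrite lee_fin.
under eq_integral do rewrite muleC.
rewrite ge0_integralZl//; first by rewrite muleC.
  by apply/measurable_EFinP; have := mf ord0.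
by move=> s _; rewrite lee_fin.
Qed.

End integral_tens.

(** * The mollifiers and the kernels acting on the gradient *)

Section kernels.
Context {R : realType} {n : nat}.
Local Notation V := 'rV[R]_n.
Local Notation leb := (lebesgue_measure_rV R n).
Implicit Types (x y : V) (r : R).

Definition eta r x y : R := tens (fun j s => molk r (x ord0 j - s)) y.

(* The i-th factor is a primitive of the difference of the mollifiers at scales
   r and r / 2, so that the sum of the [partial i (kerK r i x)] telescopes. *)
Definition kerK r (i : 'I_n) x y : R :=
  tens (fun j s => if (j < i)%N then molk (r / 2) (x ord0 j - s)
    else if j == i then stepdiff r (x ord0 j - s) else molk r (x ord0 j - s)) y.

Let etaf_smooth r x (j : 'I_n) : smooth1 (fun s => molk r (x ord0 j - s)).
Proof. by apply: smooth1_reflect; exact: smooth1_molk. Qed.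

Let kerf_smooth r (i : 'I_n) x (j : 'I_n) : smooth1 (fun s =>
  if (j < i)%N then molk (r / 2) (x ord0 j - s)
    else if j == i then stepdiff r (x ord0 j - s) else molk r (x ord0 j - s)).
Proof.
case: (j < i)%N; last case: (j == i); apply: smooth1_reflect; try exact: smooth1_molk.
exact: smooth1_stepdiff.
Qed.

Lemma eta_off r x y : 0 < r -> ~ cube x r y -> eta r x y = 0.
Proof.
move=> r0 xy; apply/eqP; apply: contraT => /tens_neq0 h; exfalso; apply: xy => j.
rewrite leNgt; apply/negP => H; move/eqP : (h j); apply.
by rewrite molk_off// distrC.
Qed.

Lemma kerK_off r i x y : 0 < r -> ~ cube x r y -> kerK r i x y = 0.
Proof.
move=> r0 xy; apply/eqP; apply: contraT => /tens_neq0 h; exfalso; apply: xy => j.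
rewrite leNgt; apply/negP => H; move/eqP : (h j); apply.
have r2 : 0 < r / 2 by rewrite divr_gt0.
case: ifP => _; first by rewrite molk_off// distrC; lra.
by case: ifP => _; [rewrite stepdiff_off// distrC|rewrite molk_off// distrC].
Qed.

Lemma eta_continuous r x : continuous (eta r x).
Proof. by apply: continuous_tens => j; exact: smooth1_continuous. Qed.

Lemma test_function_kerK Omega r i x : 0 < r -> cube x r `<=` Omega ->
  test_function Omega (kerK r i x).
Proof.
move=> r0 xO; apply: (@test_function_compact _ _ _ _ (cube x r)) => //.
- exact: smooth_tens.
- exact: compact_cube.
- by move=> y; apply: contraNP => /(kerK_off i r0) ->.
Qed.

Lemma eta_ge0 r x y : 0 < r -> 0 <= eta r x y.
Proof. by move=> r0; apply: prodr_ge0 => j _; exact: molk_ge0. Qed.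

(** A factor at scale r / 2 is at most 2 B / r, whence the constant 2 * B. In [kerK] the factor
    [stepdiff] is at most 1, which leaves n - 1 factors of order 1 / r. *)
Lemma kernel_bounds : exists B : R, 1 <= B /\ forall r x y, 0 < r ->
  eta r x y <= (B / r) ^+ n /\ forall i, `|kerK r i x y| <= (B / r) ^+ n.-1.
Proof.
have [B [B1 HB]] := @molk_bounded R.
exists (2 * B); split; first lra.
move=> r x y r0.
have Br : B / r <= 2 * B / r by rewrite ler_pM2r ?invr_gt0//; lra.
have m1 s : `|molk r s| <= 2 * B / r by exact: le_trans (HB r s r0) Br.
have m2 s : `|molk (r / 2) s| <= 2 * B / r.
  have r2 : 0 < r / 2 by rewrite divr_gt0.
  apply: le_trans (HB _ s r2) _; rewrite le_eqVlt; apply/orP; left; apply/eqP.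
  by field; rewrite gt_eqF.
split.
  apply: (@le_trans _ _ (\prod_(j < n) (2 * B / r))); last by rewrite prodr_const card_ord.
  apply: ler_prod => j _; rewrite molk_ge0//=.
  by apply: le_trans (ler_norm _) _; exact: m1.
move=> i; rewrite /kerK /tens normr_prod (bigD1 i)//= ltnn eqxx.
rewrite -[leRHS]mul1r; apply: ler_pM => //.
- exact: prodr_ge0.
- exact: stepdiff_le1.
apply: (@le_trans _ _ (\prod_(j < n | j != i) (2 * B / r))); last first.
  rewrite prodr_const (_ : #|_| = n.-1)//.
  by rewrite -[n in RHS]card_ord -(cardC1 i); apply: eq_card.
apply: ler_prod => j ji; rewrite normr_ge0 /=.
by case: ifP => _; [exact: m2|rewrite (negbTE ji); exact: m1].
Qed.

(** Q i has its first i factors at scale r / 2 and the others at scale r. The sign comes from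
    differentiating in y functions of x - y. *)
Lemma eta_telescope r x y : 
  eta r x y - eta (r / 2) x y = - \sum_(i < n) partial i (kerK r i x) y.
Proof.
pose Q (i : nat) : R := \prod_(j < n)
  (if (j < i)%N then molk (r / 2) (x ord0 j - y ord0 j) else molk r (x ord0 j - y ord0 j)).
have -> : eta r x y - eta (r / 2) x y = \sum_(i < n) (Q i - Q i.+1).
  rewrite -(big_mkord xpredT (fun i => Q i - Q i.+1)).
  rewrite (eq_bigr (fun i => - (Q i.+1 - Q i))); last by move=> i _; rewrite opprB.
  rewrite sumrN telescope_sumr// opprB; congr (_ - _).
  by apply: eq_bigr => j _; rewrite ltn_ord.
rewrite -sumrN; apply: eq_bigr => i _.
rewrite /kerK partial_tens//.
rewrite tens_updE; set P := \prod_(j < n | j != i) _.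
have QE k : (i <= k)%N -> (k <= i.+1)%N -> Q k = (if (i < k)%N then molk (r / 2) (x ord0 i - y ord0 i)
    else molk r (x ord0 i - y ord0 i)) * P.
  move=> ik ki; rewrite /Q (bigD1 i)//=; congr (_ * _); apply: eq_bigr => j ji.
  rewrite (negbTE ji); have [ji'|ji'|/val_inj jE] := ltngtP j i.
  - by rewrite (leq_trans ji' ik).
  - by rewrite ltnNge (leq_trans ki ji').
  - by rewrite jE eqxx in ji.
rewrite !QE// ltnn ltnSn.
rewrite eqxx.
rewrite derive1_reflect; last exact: smooth1_stepdiff.
by rewrite derive1_stepdiff; ring.
Qed.

Lemma measurable_molk r : measurable_fun setT (@molk R r).
Proof. by apply: continuous_measurable_fun; apply: smooth1_continuous; exact: smooth1_molk. Qed.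

Lemma integral_eta r x : 0 < r -> (\int[leb]_y (eta r x y)%:E = 1)%E.
Proof.
move=> r0; rewrite integral_tens.
- by rewrite big1// => j _; exact: integral_molk.
- by move=> j s; exact: molk_ge0.
- move=> j; apply: continuous_measurable_fun; apply: smooth1_continuous; exact: etaf_smooth.
Qed.

Lemma measurable_eta r : measurable_fun setT (fun p : V * V => eta r p.1 p.2).
Proof.
apply: measurable_prod => j _; apply: (measurableT_comp (measurable_molk r)).
apply: measurable_funB.
  by apply: (measurableT_comp (measurable_coord j)); exact: measurable_fst.
by apply: (measurableT_comp (measurable_coord j)); exact: measurable_snd.
Qed.

End kernels.

Lemma cvg_bounded_variation (R : realType) (I : nat -> R) (M : R) :
  (forall N, \sum_(k < N) `|I k - I k.+1| <= M) ->
  cvgn I /\ `|limn I| <= `|I 0| + M.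
Proof.
move=> HM; pose u k := I k.+1 - I k.
have uE : series u = (fun N => I N - I 0%N).
  apply/funext => N; rewrite /series /=.
  by rewrite telescope_sumr.
have cu : cvgn (series u).
  apply: normed_cvg; apply: nondecreasing_is_cvgn.
    apply: nondecreasing_series => k _ _; exact: normr_ge0.
  exists M => _ [N _ <-]; apply: le_trans (HM N); rewrite /= /series /= big_mkord.
  by apply: ler_sum => k _; rewrite distrC.
have cI : cvgn I.
  have -> : I = (fun N => series u N + I 0%N).
    by apply/funext => N; rewrite uE subrK.
  by apply: is_cvgD => //; exact: is_cvg_cst.
split=> //.
have B N : `|I N| <= `|I 0| + M.
  have -> : I N = I 0%N + series u N by rewrite uE addrC subrK.
  apply: le_trans (ler_normD _ _) _; rewrite lerD2l.
  apply: le_trans (HM N); rewrite /series /= big_mkord.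
  apply: le_trans (ler_norm_sum _ _ _) _.
  by apply: ler_sum => k _; rewrite distrC.
have cn : `|I N| @[N --> \oo] --> `|limn I| by apply: cvg_norm; exact: cI.
rewrite -(cvg_lim _ cn)//; apply: limr_le; first exact: cvgP cn.
by apply: nearW => N; exact: B.
Qed.

(** * Mollified functions *)

Section averages.
Context {R : realType} {n : nat} (mu : {finite_measure set 'rV[R]_n -> \bar R}).
Local Notation V := 'rV[R]_n.
Local Notation leb := (lebesgue_measure_rV R n).
Implicit Types (f g : V -> R) (r : R) (x y : V) (S : set V).

Definition avg f r x : R := \int[leb]_y (f y * eta r x y).

Lemma integrable_mul_bounded (f k : V -> R) (M : R) : leb.-integrable setT (EFin \o f) ->
  measurable_fun setT k -> (forall y, `|k y| <= M) ->
  leb.-integrable setT (fun y => (f y * k y)%:E).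
Proof.
move=> If mk kM.
have mf : measurable_fun setT f by apply/measurable_EFinP; exact: measurable_int If.
have M0 : 0 <= M by exact: le_trans (normr_ge0 _) (kM 0).
have IM : leb.-integrable setT (fun y => M%:E * `|(EFin \o f) y|)%E.
  by apply: integrableZl => //; exact: integrable_abse.
apply: le_integrable IM => //; first by apply/measurable_EFinP; exact: measurable_funM.
move=> y _; rewrite /= !lee_fin (ger0_norm (mulr_ge0 M0 (normr_ge0 _))) normrM mulrC.
by rewrite ler_wpM2r.
Qed.

Lemma measurable_eta_r r x : measurable_fun setT (eta r x).
Proof. by apply: continuous_measurable_rV; exact: eta_continuous. Qed.

Lemma avg_le : exists B, 0 <= B /\ forall f r x, 0 < r -> leb.-integrable setT (EFin \o f) ->
  leb.-integrable setT (fun y => (f y * eta r x y)%:E) /\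
  \int[leb]_y `|f y * eta r x y| <= (B / r) ^+ n * \int[leb]_y `|f y|.
Proof.
have [B [B1 HB]] := @kernel_bounds R n.
exists B; split=> [|f r x r0 If]; first lra.
have e0 y : 0 <= eta r x y by exact: eta_ge0.
have eB y : `|eta r x y| <= (B / r) ^+ n by rewrite ger0_norm//; have [] := HB r x y r0.
have I := integrable_mul_bounded If (measurable_eta_r r x) eB.
split=> //.
have In : leb.-integrable setT (EFin \o (fun y => `|f y|)).
  exact: (integrable_abse If).
rewrite -RintegralZl//; apply: le_Rintegral => //.
- exact: (integrable_abse I).
- exact: (integrableZl measurableT _ In).
- by move=> y _; rewrite normrM mulrC ler_wpM2r.
Qed.

(** Fubini for the product of mu and Lebesgue measure: at fixed r the kernel is bounded, f is
    integrable and mu is finite. *)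
Lemma integrable_avg f r S : 0 < r -> measurable S -> leb.-integrable setT (EFin \o f) ->
  mu.-integrable S (EFin \o avg f r).
Proof.
move=> r0 mS If.
have [B [B0 HB]] := avg_le.
have mf : measurable_fun setT f by apply/measurable_EFinP; exact: measurable_int If.
pose F (p : V * V) : \bar R := (f p.2 * eta r p.1 p.2)%:E.
have mF : measurable_fun setT F.
  apply/measurable_EFinP; apply: measurable_funM; last exact: measurable_eta.
  by apply: (measurableT_comp mf); exact: measurable_snd.
have IF : (mu \x leb)%E.-integrable setT F.
  apply/(integrable12ltyP mu leb mF).
  pose c : R := (B / r) ^+ n * \int[leb]_y `|f y|.
  apply: (@le_lt_trans _ _ (\int[mu]_x (cst c%:E x))%E); last first.
      rewrite integral_cst//; apply: lte_mul_pinfty => //.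
      by rewrite lee_fin mulr_ge0 ?exprn_ge0 ?divr_ge0 ?(ltW r0)// Rintegral_ge0.
    by rewrite -ge0_fin_numE// fin_num_measure.
  apply: ge0_le_integral_nomeas => // [x _|x _]; first exact: integral_ge0.
  have [I HI] := HB f r x r0 If; rewrite /cst -[leLHS]fineK ?lee_fin; first exact: HI.
  exact: (integrable_fin_num measurableT (integrable_abse I)).
have := integrable_fubini_F IF.
rewrite (_ : fubini_F _ _ = EFin \o avg f r); first exact: integrableS.
apply/funext => x; rewrite /fubini_F /= /avg /Rintegral fineK//.
by have [I _] := HB f r x r0 If; exact: integrable_fin_num I.
Qed.

Lemma avg_linear (a : R) f g r x : 0 < r ->
  leb.-integrable setT (EFin \o f) -> leb.-integrable setT (EFin \o g) ->
  avg (fun y => a * f y + g y) r x = a * avg f r x + avg g r x.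
Proof.
move=> r0 If Ig.
have [_ [_ /(_ f r x r0 If)[I1 _]]] := avg_le.
have [_ [_ /(_ g r x r0 Ig)[I2 _]]] := avg_le.
rewrite /avg -RintegralZl// -RintegralD//; last exact: (integrableZl measurableT _ I1).
by apply: eq_Rintegral => y _; rewrite mulrDl mulrA.
Qed.

Lemma avg_cst1 r x : 0 < r -> \int[leb]_y eta r x y = 1.
Proof. by move=> r0; rewrite /Rintegral integral_eta. Qed.

Lemma integrable_eta r x : 0 < r -> leb.-integrable setT (EFin \o eta r x).
Proof.
move=> r0; apply/integrableP; split.
  by apply/measurable_EFinP; exact: measurable_eta_r.
under eq_integral do rewrite /= ger0_norm ?eta_ge0//.
by rewrite integral_eta// ltry.
Qed.

Lemma avg_near f r x (e : R) : 0 < r -> leb.-integrable setT (EFin \o f) ->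
  (forall y, cube x r y -> `|f y - f x| <= e) -> `|avg f r x - f x| <= e.
Proof.
move=> r0 If fe.
have [_ [_ /(_ f r x r0 If)[I1 _]]] := avg_le.
have Ie := integrable_eta x r0.
have -> : avg f r x - f x = \int[leb]_y ((f y - f x) * eta r x y).
  rewrite -[f x in LHS]mulr1 -(avg_cst1 x r0) -RintegralZl// /avg -RintegralB//.
    by apply: eq_Rintegral => y _; rewrite mulrBl.
  exact: (integrableZl measurableT _ Ie).
have I2 : leb.-integrable setT (EFin \o (fun y => (f y - f x) * eta r x y)).
  rewrite (_ : _ \o _ = ((EFin \o (fun y => f y * eta r x y)%R) \- (EFin \o (fun y => f x * eta r x y)%R))%E).
    by apply: integrableB => //; exact: (integrableZl measurableT _ Ie).
  by apply/funext => y /=; rewrite -EFinB mulrBl.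
apply: le_trans (le_normr_Rintegral _ I2) _ => //.
rewrite -[e]mulr1 -(avg_cst1 x r0) -RintegralZl//; apply: le_Rintegral => //.
- exact: (integrable_abse I2).
- exact: (integrableZl measurableT _ Ie).
move=> y _; rewrite normrM (ger0_norm (eta_ge0 x y r0)).
have [xy|xy] := pselect (cube x r y); last by rewrite (eta_off r0 xy) !mulr0.
by rewrite ler_wpM2r ?eta_ge0// fe.
Qed.

Lemma avg_bounded f r x (b : R) : 0 < r -> leb.-integrable setT (EFin \o f) ->
  (forall y, `|f y| <= b) -> `|avg f r x| <= b.
Proof.
move=> r0 If fb.
have [_ [_ /(_ f r x r0 If)[I1 _]]] := avg_le.
have Ie := integrable_eta x r0.
apply: le_trans (le_normr_Rintegral _ I1) _ => //.
rewrite -[b]mulr1 -(avg_cst1 x r0) -RintegralZl//; apply: le_Rintegral => //.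
- exact: (integrable_abse I1).
- exact: (integrableZl measurableT _ Ie).
- by move=> y _; rewrite normrM (ger0_norm (eta_ge0 x y r0)) ler_wpM2r// eta_ge0.
Qed.

Lemma avg_cvg f (rho : R) x : 0 < rho -> leb.-integrable setT (EFin \o f) -> {for x, continuous f} ->
  avg f (rad rho k) x @[k --> \oo] --> f x.
Proof.
move=> rho0 If cf; apply/cvgrPdist_le => e e0.
have : \forall y \near x, `|f x - f y| < e by move/cvgrPdist_lt : cf; apply.
move=> /nbhs_ballP[d /= d0 dP].
have [k kd] : exists k, rad rho k < d.
  have [k Hk] : exists k : nat, rho / d < k%:R.
    by exists (Num.truncn (rho / d)).+1; exact: truncnS_gt.
  exists k; rewrite /rad ltr_pdivrMr ?exprn_gt0// mulrC -ltr_pdivrMr//.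
  by apply: lt_trans Hk _; rewrite -natrX ltr_nat ltn_expl.
exists k => // j /= kj; rewrite distrC; apply: avg_near => //; first exact: rad_gt0.
move=> y xy; rewrite distrC ltW//; apply: dP.
apply: cube_ball xy => //; exact: le_lt_trans (rad_le rho0 kj) kd.
Qed.

End averages.

Section young.
Context {R : realType} (G g h : R -> R) (C i : R) (q : nat) (cg : conjugate_growth G g h C i q).

(** Induction on N, with s the full sum. If h s < t then s <= g t, and t * s <= t * g t <= C * G t
    at once; otherwise t <= h s and the last term on the left is at most the last one on the right.
    The sum on the right replaces the conjugate function of G and, unlike it, has products of
    densities that Fubini can integrate. *)
Lemma young_sum (t : R) (d : nat -> R) N : 0 <= t -> (forall k, 0 <= d k) ->
  t * \sum_(k < N) d k <= C * G t + \sum_(k < N) d k * h (\sum_(j < k.+1) d j).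
Proof.
move=> t0 d0; elim: N => [|N IH].
  by rewrite !big_ord0 mulr0 addr0 mulr_ge0 ?(G_ge0 cg)// (C_ge0 cg).
set s := \sum_(k < N.+1) d k.
have T0 : 0 <= \sum_(k < N.+1) d k * h (\sum_(j < k.+1) d j).
  by apply: sumr_ge0 => k _; rewrite mulr_ge0// (h_ge0 cg).
have [hs|hs] := ltP (h s) t.
  have tg : t * s <= t * g t by apply: ler_wpM2l => //; exact: cg_h_lt cg _ _ hs.
  by have := cg_young cg t0; lra.
rewrite /s big_ord_recr/= [X in _ <= _ + X]big_ord_recr/= mulrDr addrA; apply: lerD => //.
by rewrite mulrC ler_wpM2l.
Qed.

Lemma young_le (t s : R) : 0 <= t -> 0 <= s -> t * s <= C * G t + s * h s.
Proof.
by move=> t0 s0; have := @young_sum t (fun=> s) 1 t0 (fun=> s0); rewrite !big_ord1.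
Qed.

End young.

Lemma integrable_Rsum d (T : measurableType d) (R : realType) (m : {measure set T -> \bar R})
    (D : set T) I (s : seq I) (f : I -> T -> R) : measurable D ->
  (forall i, m.-integrable D (EFin \o f i)) ->
  m.-integrable D (EFin \o (fun x => \sum_(i <- s) f i x)) /\
  \int[m]_(x in D) (\sum_(i <- s) f i x) = \sum_(i <- s) \int[m]_(x in D) f i x.
Proof.
move=> mD If; elim: s => [|i s [IH1 IH2]].
  rewrite big_nil; have E : (fun x : T => \sum_(i <- [::]) f i x) = cst 0.
    by apply/funext => x; rewrite big_nil.
  rewrite E; split; first by rewrite (_ : _ \o _ = cst 0%E)//; exact: integrable0.
  by rewrite Rintegral_cst// mul0r.
have E : (fun x : T => \sum_(j <- i :: s) f j x) = (fun x => f i x + \sum_(j <- s) f j x).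
  by apply/funext => x; rewrite big_cons.
rewrite E big_cons; split; last by rewrite RintegralD// IH2.
have := integrableD mD (If i) IH1.
by rewrite (_ : (_ \+ _)%E = EFin \o (fun x => f i x + \sum_(j <- s) f j x)).
Qed.

(** * Variation of the averages across scales *)

Section wolff_to_dual.
Context {R : realType} {n : nat} (n0 : (0 < n)%N) (mu : {finite_measure set 'rV[R]_n -> \bar R}).
Local Notation V := 'rV[R]_n.
Local Notation leb := (lebesgue_measure_rV R n).
Context (G g h : R -> R) (C i : R) (q : nat) (cg : conjugate_growth G g h C i q).
Context (Omega : set V) (oO : open Omega) (Ofin : (leb Omega < +oo)%E).
Context (S : set V) (mS : measurable S).
Context (rho : R) (rho0 : 0 < rho) (SO : forall x, S x -> cube x rho `<=` Omega).
Implicit Types (u f : V -> R) (x y : V) (l : R) (k : nat).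

Let mO : measurable Omega. Proof. exact: open_measurable_rV. Qed.

Let rk k : 0 < rad rho k. Proof. exact: rad_gt0. Qed.

(** Young's inequality with second argument 1 gives |f| / l <= C * G (|f| / l) + h 1, and Omega has
    finite volume. *)
Lemma modular_integrable : exists D, 0 <= D /\ forall f l, 0 < l -> measurable_fun Omega f ->
  (orlicz_modular G Omega f l <= 1)%E ->
  leb.-integrable setT (EFin \o (f \_ Omega)) /\ \int[leb]_x `|(f \_ Omega) x| <= D * l.
Proof.
pose b := fine (leb Omega).
have bE : leb Omega = b%:E by rewrite fineK// ge0_fin_numE.
have b0 : 0 <= b by exact: fine_ge0.
have C0 := C_ge0 cg; have h1 : 0 <= h 1 by exact: h_ge0 cg _.
exists (C + h 1 * b); split=> [|f l l0 mf fl]; first by rewrite addr_ge0 ?mulr_ge0.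
have mG : measurable_fun Omega (fun x => (G (`|f x| / l))%:E).
  apply: (measurable_G cg) => [x|]; first by rewrite divr_ge0// ltW.
  by apply: measurable_funM => //; exact: measurableT_comp.
have I : (\int[leb]_(x in Omega) `|(f x)%:E| <= ((C + h 1 * b) * l)%:E)%E.
  apply: (@le_trans _ _ (\int[leb]_(x in Omega) (l%:E * (C%:E * (G (`|f x| / l))%:E + (h 1)%:E)))%E).
    apply: ge0_le_integral_nomeas => // x _; rewrite lee_fin.
    have := @young_le _ _ _ _ _ _ _ cg (`|f x| / l) 1.
    rewrite mulr1 mul1r ler01 divr_ge0 ?(ltW l0)// => /(_ isT isT).
    by rewrite ler_pdivrMr// mulrC.
  rewrite ge0_integralZl//; last 3 first.
  - apply: emeasurable_funD => //; exact: emeasurable_funM.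
  - by move=> x _; rewrite -EFinM -EFinD lee_fin addr_ge0// mulr_ge0// (G_ge0 cg) ?divr_ge0// ltW.
  - by rewrite lee_fin ltW.
  rewrite ge0_integralD//; last 2 first.
  - by move=> x _; rewrite -EFinM lee_fin mulr_ge0// (G_ge0 cg) ?divr_ge0// ltW.
  - exact: emeasurable_funM.
  rewrite ge0_integralZl//; last first.
  - by move=> x _; rewrite lee_fin (G_ge0 cg) ?divr_ge0// ltW.
  have -> : (\int[leb]_(x in Omega) (h 1)%:E = (h 1 * b)%:E)%E.
    by rewrite integral_cst// EFinM; congr (_ * _)%E; exact: bE.
  rewrite (mulrC _ l) [leRHS]EFinM; apply: lee_wpmul2l; first by rewrite lee_fin ltW.
  rewrite EFinD leeD2r// -[leRHS]mule1; apply: lee_wpmul2l => //.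
have If : leb.-integrable Omega (EFin \o f).
  apply/integrableP; split; first exact/measurable_EFinP.
  by apply: le_lt_trans I _; exact: ltry.
have E : EFin \o (f \_ Omega) = (EFin \o f) \_ Omega.
  by apply/funext => x; rewrite /patch /=; case: ifP.
have If' : leb.-integrable setT (EFin \o (f \_ Omega)).
  by rewrite E; apply/(integrable_mkcond _ mO).
split=> //; rewrite -lee_fin /Rintegral fineK; last first.
  exact: (integrable_fin_num measurableT (integrable_abse If')).
apply: le_trans I; rewrite [leRHS]integral_mkcond le_eqVlt; apply/orP; left; apply/eqP.
by apply: eq_integral => x _; rewrite /patch; case: ifP => //; rewrite normr0.
Qed.


Let e u : V -> R := (norm_gradient Omega u) \_ Omega.

Let e_ge0 u y : 0 <= e u y.
Proof. by rewrite /e /patch; case: ifP => // _; exact: sqrtr_ge0. Qed.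

Let me u : sobolev11_loc Omega u -> measurable_fun setT (e u).
Proof.
by move=> su; apply: (measurable_restrictT _ mO).1; apply: measurable_norm_gradient.
Qed.

(** For x in S the cube about x lies in Omega, so the kernels [kerK] are test functions there and
    the definition of the weak gradient applies to them. The bound thus holds at every point of S,
    which a singular mu requires. *)
Lemma avg_diff : exists K : R, 0 <= K /\ forall u x k, sobolev11_loc Omega u ->
  leb.-integrable setT (EFin \o (u \_ Omega)) -> S x ->
  (`|avg (u \_ Omega) (rad rho k) x - avg (u \_ Omega) (rad rho k.+1) x|%:E <=
   (K / rad rho k ^+ n.-1)%:E * \int[leb]_y (\1_(cube x (rad rho k)) y * e u y)%:E)%E.
Proof.
have [B [B1 HB]] := @kernel_bounds R n.
exists (n%:R * B ^+ n.-1); split=> [|u x k su Iu Sx].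
  by rewrite mulr_ge0// exprn_ge0//; lra.
have rxO : cube x (rad rho k) `<=` Omega.
  apply: subset_trans (SO Sx); apply: cube_le.
  by have := rad_le rho0 (leq0n k); rewrite {2}/rad expr0 divr1.
have rS : rad rho k.+1 = rad rho k / 2 by rewrite (radS rho k) mulrC mulKf.
have [lv wv] := @weak_gradientP _ _ Omega u su.2.
set v := weak_gradient Omega u in lv wv.
have tk j := test_function_kerK j (rk k) rxO.
pose w j y := (u \_ Omega) y * partial j (kerK (rad rho k) j x) y.
have Iw j : leb.-integrable setT (EFin \o w j).
  have [M [_ pM]] := test_function_vanishes (tk j).
  have cp : continuous (partial j (kerK (rad rho k) j x)).
    by apply: smooth_continuous; apply: smooth_partial; have [] := tk j.
  have [b [_ bP]] := continuous_bounded_off cp (pM j).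
  by apply: integrable_mul_bounded Iu _ bP; exact: continuous_measurable_rV.
have [_ [_ /(_ _ _ x (rk k) Iu)[I1 _]]] := @avg_le R n.
have [_ [_ /(_ _ _ x (rk k.+1) Iu)[I2 _]]] := @avg_le R n.
have wE j : \int[leb]_y w j y =
    - \int[leb]_(y in Omega) (v y ord0 j * kerK (rad rho k) j x y).
  rewrite -wv; last exact: tk.
  rewrite [RHS]Rintegral_mkcond; apply: eq_Rintegral => y _.
  by rewrite /w /patch; case: ifP => // _; rewrite mul0r.
have -> : avg (u \_ Omega) (rad rho k) x - avg (u \_ Omega) (rad rho k.+1) x =
    \sum_(j < n) \int[leb]_(y in Omega) (v y ord0 j * kerK (rad rho k) j x y).
  rewrite /avg -RintegralB//.
  transitivity (\int[leb]_y (- 1 * \sum_(j < n) w j y)).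
    apply: eq_Rintegral => y _; rewrite -mulrBr rS eta_telescope mulN1r mulrN -mulr_sumr.
    by [].
  have [IS ES] := integrable_Rsum (index_enum 'I_n) measurableT Iw.
  rewrite RintegralZl// ES mulN1r -sumrN; apply: eq_bigr => j _.
  by rewrite wE opprK.
have Ivk j := integrable_loc_test oO (lv j) (tk j).
apply: (@le_trans _ _ (\sum_(j < n) `|\int[leb]_(y in Omega) (v y ord0 j * kerK (rad rho k) j x y)|%:E)%E).
  by rewrite sumEFin lee_fin; exact: ler_norm_sum.
set J := (\int[leb]_y (\1_(cube x (rad rho k)) y * e u y)%:E)%E.
apply: (@le_trans _ _ (\sum_(j < n) ((B / rad rho k) ^+ n.-1)%:E * J)%E); last first.
  rewrite -ge0_sume_distrl; last by move=> j _; rewrite lee_fin exprn_ge0// divr_ge0 ?(ltW (rk k))//; lra.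
  apply: lee_wpmul2r.
    by apply: integral_ge0 => y _; rewrite lee_fin mulr_ge0// indicE.
  rewrite sumEFin lee_fin sumr_const card_ord expr_div_n -[leLHS]mulr_natl.
  by rewrite mulrA.
apply: lee_sum => j _; rewrite EFin_normr_Rintegral//; last exact: Ivk.
apply: le_trans (le_abse_integral _ mO (measurable_int _ (Ivk j))) _.
rewrite -ge0_integralZT//; last 3 first.
- apply: measurable_funM; last exact: me.
  by apply: measurable_indic; exact: measurable_cube.
- by move=> y; rewrite mulr_ge0// indicE.
- by rewrite exprn_ge0// divr_ge0 ?(ltW (rk k))//; lra.
rewrite integral_mkcond; apply: ge0_le_integral_nomeas => // y _.
  by rewrite /patch; case: ifP.
rewrite [X in (X <= _)%E]/patch; case: ifPn => yO; last first.
  have B0 : 0 <= B by lra.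
  have i0 : 0 <= \1_(cube x (rad rho k)) y * e u y by rewrite mulr_ge0// indicE.
  by rewrite lee_fin mulr_ge0// exprn_ge0// divr_ge0// ltW.
rewrite lee_fin /e /patch yO indicE.
have [xy|xy] := pselect (cube x (rad rho k) y); last by rewrite (kerK_off j (rk k) xy) mulr0 normr0 memNset// mul0r mulr0.
rewrite mem_set// mul1r normrM mulrC; apply: ler_pM => //.
  by have [_ H] := HB _ x y (rk k); exact: H.
exact: coord_le_eucl_norm.
Qed.


(** Tonelli moves mu onto the kernels, turning cubes into densities. Young's inequality is applied
    to the gradient divided by l, so that the bound is linear in l. The factor 2 in the hypothesis
    comes from Fubini applied to densities of factor 1. *)
Lemma variation_le (B : R) : (forall N, \sum_(k < N) rad rho k * wsum mu h rho 2 k <= B) ->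
  exists D : R, 0 <= D /\ forall u l, 0 < l -> sobolev11_loc Omega u ->
  leb.-integrable setT (EFin \o (u \_ Omega)) ->
  (orlicz_modular G Omega (norm_gradient Omega u) l <= 1)%E -> forall N,
  (\sum_(k < N) \int[mu]_(x in S)
    `|avg (u \_ Omega) (rad rho k) x - avg (u \_ Omega) (rad rho k.+1) x|%:E <= (D * l)%:E)%E.
Proof.
move=> HB; have [K [K0 HK]] := avg_diff.
have [K' [K'0 HK']] := integral_dens_sum n0 mu cg rho0 (ltr01 : (0 < 1 :> R)).
have C0 := C_ge0 cg.
have B0 : 0 <= B by have := HB 0%N; rewrite big_ord0.
exists (K * (C + K' * B)); split=> [|u l l0 su Iu El N]; first by rewrite mulr_ge0// addr_ge0// mulr_ge0.
have i0 x k y : 0 <= \1_(cube x (rad rho k)) y * e u y by rewrite mulr_ge0// indicE.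
have d0 k y : 0 <= dens mu rho 1 k y by exact: dens_ge0.
have md k : measurable_fun setT (dens mu rho 1 k) by exact: measurable_dens.
have S1 k : (\int[mu]_(x in S)
    `|avg (u \_ Omega) (rad rho k) x - avg (u \_ Omega) (rad rho k.+1) x|%:E <=
    (K%:E * \int[leb]_y (dens mu rho 1 k y * e u y)%:E))%E.
  have c0 : 0 <= K / rad rho k ^+ n.-1 by rewrite divr_ge0// exprn_ge0// ltW.
  apply: (@le_trans _ _ (\int[mu]_(x in S) ((K / rad rho k ^+ n.-1)%:E *
      \int[leb]_y (\1_(cube x (rad rho k)) y * e u y)%:E))%E).
    by apply: ge0_le_integral_nomeas => // x Sx; exact: HK.
  apply: (@le_trans _ _ (\int[mu]_x ((K / rad rho k ^+ n.-1)%:E *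
      \int[leb]_y (\1_(cube x (rad rho k)) y * e u y)%:E))%E).
    rewrite integral_mkcond; apply: ge0_le_integral_nomeas => // x _.
      rewrite /patch; case: ifP => // _; rewrite mule_ge0 ?lee_fin//.
      by apply: integral_ge0 => y _; rewrite lee_fin.
    rewrite /patch; case: ifP => // _; rewrite mule_ge0 ?lee_fin//.
    by apply: integral_ge0 => y _; rewrite lee_fin.
  have me' : measurable_fun setT (fun y => K / rad rho k ^+ n.-1 * e u y).
    by apply: measurable_funM => //; exact: me.
  have := @integral_mass _ _ mu (rad rho k) _ me' (fun y => mulr_ge0 c0 (e_ge0 u y)).
  rewrite -ge0_integralZT//; last 2 first.
  - by apply: measurable_funM; [exact: md|exact: me].
  - by move=> y; rewrite mulr_ge0.
  have -> : (\int[leb]_y (mass mu y (rad rho k) * (K / rad rho k ^+ n.-1 * e u y))%:E =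
      \int[leb]_y (K * (dens mu rho 1 k y * e u y))%:E)%E.
    by apply: eq_integral => y _; rewrite /dens mul1r; congr EFin; ring.
  move=> ->; apply: ge0_le_integral_nomeas => // x _.
    by rewrite mule_ge0 ?lee_fin//; apply: integral_ge0 => y _; rewrite lee_fin.
  rewrite -ge0_integralZT//; last first.
    by apply: measurable_funM; [apply: measurable_indic; exact: measurable_cube|exact: me].
  by rewrite le_eqVlt; apply/orP; left; apply/eqP; apply: eq_integral => y _; rewrite mulrCA.
apply: (@le_trans _ _ (\sum_(k < N) (K%:E * \int[leb]_y (dens mu rho 1 k y * e u y)%:E))%E).
  by apply: lee_sum => k _; exact: S1.
have mde k : measurable_fun setT (fun y => dens mu rho 1 k y * e u y).
  by apply: measurable_funM; [exact: md|exact: me].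
have de0 k y : 0 <= dens mu rho 1 k y * e u y by rewrite mulr_ge0.
rewrite -ge0_sume_distrr; last by move=> k _; apply: integral_ge0 => y _; rewrite lee_fin.
rewrite -mulrA EFinM; apply: lee_wpmul2l; first by rewrite lee_fin.
rewrite -ge0_integral_sum//; last 2 first.
- by move=> k; exact/measurable_EFinP.
- by move=> k y _; rewrite lee_fin.
pose Y y := \sum_(k < N) dens mu rho 1 k y * h (\sum_(j < k.+1) dens mu rho 1 j y).
have Y0 y : 0 <= Y y by apply: sumr_ge0 => k _; rewrite mulr_ge0// (h_ge0 cg).
have mY : measurable_fun setT Y.
  apply: measurable_sum => k; apply: measurable_funM; first exact: md.
  by apply: (homo_measurable (cg_h_le cg)); apply: measurable_sum => j; exact: md.
have El0 y : 0 <= e u y / l by rewrite divr_ge0// ltW.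
have mGe : measurable_fun setT (fun y => G (e u y / l)).
  apply/measurable_EFinP; apply: (measurable_G cg) => //.
  by apply: measurable_funM => //; exact: me.
have G0 y : 0 <= G (e u y / l) by exact: (G_ge0 cg).
apply: (@le_trans _ _ (\int[leb]_y (l * (C * G (e u y / l) + Y y))%:E)%E).
  apply: ge0_le_integral_nomeas => // y _.
    by rewrite sumEFin lee_fin; apply: sumr_ge0.
  rewrite sumEFin lee_fin -mulr_suml.
  have := @young_sum _ _ _ _ _ _ _ cg (e u y / l) (fun k => dens mu rho 1 k y) N (El0 y) (fun k => d0 k y).
  by rewrite mulrAC ler_pdivrMr// (mulrC _ l) (mulrC (e u y) (\sum_(k < N) _)).
have mCG : measurable_fun setT (fun y => C * G (e u y / l)) by exact: measurable_funM.
rewrite ge0_integralZT//; last 3 first.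
- exact: measurable_funD.
- by move=> y; rewrite addr_ge0// mulr_ge0.
- exact: ltW.
rewrite mulrC EFinM; apply: lee_wpmul2l; first by rewrite lee_fin ltW.
under eq_integral do rewrite EFinD.
rewrite ge0_integralD//; last 4 first.
- by move=> y _; rewrite lee_fin mulr_ge0.
- exact/measurable_EFinP.
- by move=> y _; rewrite lee_fin.
- exact/measurable_EFinP.
rewrite EFinD; apply: leeD; last first.
  apply: le_trans (HK' N) _; rewrite mulr1 lee_fin ler_wpM2l//.
rewrite ge0_integralZT// -[leRHS]mule1; apply: lee_wpmul2l; first by rewrite lee_fin.
apply: le_trans El; rewrite /orlicz_modular [leRHS]integral_mkcond.
apply: ge0_le_integral_nomeas => // y _; first by rewrite lee_fin.
rewrite /e /patch; case: ifP => _; last by rewrite mul0r (cg_G0 cg).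
by rewrite ger0_norm// sqrtr_ge0.
Qed.

End wolff_to_dual.

(** * The functional as a limit of smoothed integrals *)

Section functional.
Context {R : realType} {n : nat} (n0 : (0 < n)%N) (mu : {finite_measure set 'rV[R]_n -> \bar R}).
Local Notation V := 'rV[R]_n.
Local Notation leb := (lebesgue_measure_rV R n).
Context (G g h : R -> R) (C i : R) (q : nat) (cg : conjugate_growth G g h C i q).
Context (Omega : set V) (oO : open Omega) (Ofin : (leb Omega < +oo)%E).
Context (S : set V) (mS : measurable S) (muS : mu (~` S) = 0%E).
Context (rho : R) (rho0 : 0 < rho) (SO : forall x, S x -> cube x rho `<=` Omega).
Context (B : R) (HB : forall N, \sum_(k < N) rad rho k * wsum mu h rho 2 k <= B).
Implicit Types (u w f : V -> R) (x y : V) (l : R) (k : nat).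

Let mO : measurable Omega. Proof. exact: open_measurable_rV. Qed.

Let rk k : 0 < rad rho k. Proof. exact: rad_gt0. Qed.

(** The extension by zero makes the average depend on u in Omega only. *)
Definition smoothed_integral u k : R :=
  \int[mu]_(x in S) avg (u \_ Omega) (rad rho k) x.
Local Notation I := smoothed_integral.

Let admissible u l := [/\ 0 < l, measurable_fun Omega u, (orlicz_modular G Omega u l <= 1)%E &
  (orlicz_modular G Omega (norm_gradient Omega u) l <= 1)%E].

(** The average at scale 0 is controlled by the L^1 norm of u, the passage to the limit by the
    variation. As the bound holds for every admissible l, the norm is reached by an infimum over
    l. *)
Lemma functional_bound : exists D : R, 0 <= D /\ forall u l, sobolev11_loc Omega u ->
  admissible u l -> cvgn (I u) /\ `|limn (I u)| <= D * l.
Proof.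
have [D1 [D10 H1]] := modular_integrable cg oO Ofin.
have [D2 [D20 H2]] := variation_le n0 cg oO mS rho0 SO HB.
have [b [b0 Hb]] := @avg_le R n.
pose m := fine (mu S).
exists ((b / rad rho 0) ^+ n * D1 * m + D2); split.
  by rewrite addr_ge0// !mulr_ge0 ?fine_ge0// exprn_ge0// divr_ge0// ltW.
move=> u l su [l0 mu_u ul gl].
have [Iu nu] := H1 u l l0 mu_u ul.
have IA k := integrable_avg mu (rk k) mS Iu.
have HV N : \sum_(k < N) `|I u k - I u k.+1| <= D2 * l.
  rewrite -lee_fin; apply: le_trans (H2 u l l0 su Iu gl N); rewrite -sumEFin.
  apply: lee_sum => k _; rewrite /smoothed_integral -RintegralB//; last 2 first.
  - exact: IA.
  - exact: IA.
  have IB : mu.-integrable S (EFin \o (fun x => avg (u \_ Omega) (rad rho k) x -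
      avg (u \_ Omega) (rad rho k.+1) x)).
    have := integrableB mS (IA k) (IA k.+1).
    by rewrite (_ : (_ \- _)%E = EFin \o (fun x => avg (u \_ Omega) (rad rho k) x -
      avg (u \_ Omega) (rad rho k.+1) x)).
  rewrite EFin_normr_Rintegral//.
  exact: (le_abse_integral _ mS (measurable_int _ IB)).
have [cI lI] := cvg_bounded_variation HV.
split=> //; apply: le_trans lI _; rewrite mulrDl lerD2r.
have AB x : `|avg (u \_ Omega) (rad rho 0) x| <= (b / rad rho 0) ^+ n * (D1 * l).
  have [Ia Ha] := Hb _ _ x (rk 0%N) Iu.
  apply: le_trans (le_normr_Rintegral measurableT Ia) _; apply: le_trans Ha _.
  by rewrite ler_wpM2l// exprn_ge0// divr_ge0// ltW.
apply: le_trans (le_normr_Rintegral mS (IA 0%N)) _.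
apply: (@le_trans _ _ (\int[mu]_(x in S) ((b / rad rho 0) ^+ n * (D1 * l)))).
  apply: le_Rintegral => //.
  - exact: (integrable_abse (IA 0%N)).
  - exact: finite_measure_integrable_cst.
rewrite Rintegral_cst//.
by rewrite le_eqVlt; apply/orP; left; apply/eqP; rewrite /m; ring.
Qed.

Lemma sobolev_admissible u : sobolev G Omega u -> exists l, admissible u l.
Proof.
move=> [_ [mu_u /ereal_inf_lt[_ [l1 [l10 h1] <-] _]] [mgu /ereal_inf_lt[_ [l2 [l20 h2] <-] _]]].
have mono f l l' : 0 < l -> l <= l' -> (orlicz_modular G Omega f l <= 1)%E ->
    (orlicz_modular G Omega f l' <= 1)%E.
  move=> l0 ll'; apply: le_trans; apply: ge0_le_integral_nomeas => // x _.
    by rewrite lee_fin (G_ge0 cg)// divr_ge0// (le_trans (ltW l0)).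
  rewrite lee_fin; apply: (cg_G_le cg); first by rewrite divr_ge0// (le_trans (ltW l0)).
  by rewrite ler_wpM2l// lef_pV2// posrE (lt_le_trans l0).
exists (Num.max l1 l2); split=> //.
- by rewrite lt_max l10.
- by apply: mono h1 => //; rewrite le_max lexx.
- by apply: mono h2 => //; rewrite le_max lexx orbT.
Qed.

Lemma functional_linear : exists L : (V -> R) -> R, bounded_linear_functional G Omega L /\
  forall u, L u = limn (I u).
Proof.
have [D [D0 HD]] := functional_bound.
have [D1 [D10 H1]] := modular_integrable cg oO Ofin.
exists (fun u => limn (I u)); split=> //; split.
  move=> a u w [su _] [sw _].
  have [lu alu] := sobolev_admissible su; have [lw alw] := sobolev_admissible sw.
  have [su1 _ _] := su; have [sw1 _ _] := sw.
  have [cu _] := HD u lu su1 alu; have [cw _] := HD w lw sw1 alw.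
  have Iu : leb.-integrable setT (EFin \o (u \_ Omega)).
    by have [h1 h2 h3 _] := alu; have [] := H1 u lu h1 h2 h3.
  have Iw : leb.-integrable setT (EFin \o (w \_ Omega)).
    by have [h1 h2 h3 _] := alw; have [] := H1 w lw h1 h2 h3.
  have E k : I (fun x => a * u x + w x) k = a * I u k + I w k.
    rewrite /smoothed_integral -RintegralZl//; last exact: integrable_avg.
    rewrite -RintegralD//; last 2 first.
    - exact: (integrableZl mS _ (integrable_avg mu (rk k) mS Iu)).
    - exact: integrable_avg.
    apply: eq_Rintegral => x _; rewrite -avg_linear//; congr (avg _ _ _).
    by apply/funext => y; rewrite /patch; case: ifP => // _; rewrite mulr0 addr0.
  apply/cvg_lim => //; rewrite (_ : I _ = (fun k => a * I u k + I w k)); last exact/funext.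
  have c1 : a * I u k @[k --> \oo] --> a * limn (I u) by apply: cvgMr; exact: cu.
  exact: (cvgD c1 cw).
(* D + 1 is positive, so the inequality can be divided by it before the infimum is taken. *)
exists (D + 1) => u [su _]; have [su1 _ _] := su.
have D1p : 0 < D + 1 by lra.
rewrite muleC -lee_pdivrMr//.
apply: le_ereal_inf_tmp => _ [l [l0 lE] <-].
rewrite -EFinM lee_fin ler_pdivrMr// mulrC.
have m0 f : (0 <= orlicz_modular G Omega f l)%E.
  by apply: integral_ge0 => x _; rewrite lee_fin (G_ge0 cg)// divr_ge0// ltW.
have al : admissible u l.
  split=> //; first by have [_ []] := su.
    by apply: le_trans lE; rewrite leeDl.
  by apply: le_trans lE; rewrite leeDr.
have [_ H] := HD u l su1 al; apply: le_trans H _; rewrite ler_wpM2r//; [exact: ltW|lra].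
Qed.

(** The averages of phi converge to it pointwise and are bounded by its supremum, and mu is finite
    and carried by S: dominated convergence applies. *)
Lemma functional_test phi : test_function Omega phi ->
  limn (I phi) = \int[mu]_(x in Omega) phi x.
Proof.
move=> tphi.
have SO' : S `<=` Omega by move=> x Sx; apply: (SO Sx) => j; rewrite subrr normr0 ltW.
have [sphi _ _] := tphi; have cphi := smooth_continuous sphi.
have [M [phiM _]] := test_function_vanishes tphi.
have Iphi := integrable_continuous_off cphi phiM.
have [b [b0 Hb]] := continuous_bounded_off cphi phiM.
have phiO : phi \_ Omega = phi.
  by apply/funext => x; rewrite /patch; case: ifPn => // /negP xO; rewrite (test_function_off tphi)// => Ox; apply: xO; rewrite inE.
have mphi : measurable_fun setT phi by exact: continuous_measurable_rV.
have mufin A : measurable A -> (mu A < +oo)%E by move=> mA; rewrite -ge0_fin_numE// fin_num_measure.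
have IphiO A : measurable A -> mu.-integrable A (EFin \o phi).
  move=> mA; apply: (@integrable_bounded _ _ _ _ _ _ b) => //; last exact: measurable_funTS.
  exact: mufin.
have -> : \int[mu]_(x in Omega) phi x = \int[mu]_(x in S) phi x.
  rewrite /Rintegral; congr fine.
  rewrite (@negligible_integral _ _ _ mu Omega (Omega `\` S))//.
  - by rewrite setDD setIidr.
  - exact: measurableD.
  - exact: IphiO.
  - apply/eqP; rewrite eq_le measure_ge0 andbT -muS; apply: le_measure; rewrite ?inE.
    + exact: measurableD.
    + exact: measurableC.
    + by move=> x [].
apply/cvg_lim => //.
rewrite /smoothed_integral phiO.
have IA k := integrable_avg mu (rk k) mS Iphi.
have Ib : mu.-integrable S (cst b%:E) by exact: finite_measure_integrable_cst.
have [||||_ _] := @dominated_convergence _ _ _ mu _ mS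
  (fun k x => (avg phi (rad rho k) x)%:E) (fun x => (phi x)%:E) (cst b%:E) _ _ _ Ib.
- by move=> k; exact: measurable_int (IA k).
- by apply/measurable_EFinP; exact: measurable_funTS.
- apply: aeW => x _; apply: cvg_EFin; first exact: nearW.
  by apply: avg_cvg => //; exact: cphi.
- apply: aeW => x k _; rewrite lee_fin.
  exact: avg_bounded.
have fin : (\int[mu]_(x in S) (phi x)%:E)%E \is a fin_num.
  exact: (integrable_fin_num mS (IphiO _ mS)).
by rewrite -(fineK fin) => /fine_cvg.
Qed.

End functional.

(** Restriction to the whole space yields a copy of mu with the structure of a finite measure, on
    which the Fubini lemmas rely. *)
Lemma finite_measure_of d (T : measurableType d) (R : realType) (mu : {measure set T -> \bar R}) :
  (mu setT < +oo)%E -> exists m : {finite_measure set T -> \bar R}, forall A, m A = mu A.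
Proof.
move=> mufin.
by exists (mfrestr measurableT mufin) => A; rewrite /= /mfrestr /mrestr setIT.
Qed.

Theorem theorem2 (R : realType) (n : nat) (hn : (2 <= n)%N)
  (G : R -> R) (hN : N_function G) (hC1 : C1_pos G) (hG : Delta2_nabla2 G)
  (hg : forall s t : R, 0 < s -> s < t -> derive1 G s < derive1 G t)
  (Omega : set 'rV[R]_n) (hopen : open Omega) (hbnd : bounded_set Omega)
  (mu : {measure set 'rV[R]_n -> \bar R})
  (hradon : radon mu) (hfin : (mu setT < +oo)%E)
  (hsupp : compactly_supported_in mu Omega) :
  in_dual G Omega mu <->
  exists r0 : R, 0 < r0 /\
    (\int[mu]_(x in Omega) wolff_potential mu G x r0 < +oo)%E.
Proof.
have n0 : (0 < n)%N by exact: leq_trans hn.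
have [C [i [q cg]]] := conjugate_growth_exists hN hC1 hG hg.
have [m mE] := finite_measure_of hfin.
have int_eq D f : (\int[mu]_(x in D) f x = \int[m]_(x in D) f x)%E.
  by apply: eq_measure_integral => A _ _; exact: esym (mE A).
have wE x r : wolff_potential mu G x r = wolff m (inverse_pos (derive1 G)) x r.
  by apply: eq_integral => s _; rewrite -mE.
have [muO cS SO] := hsupp; set S := measure_support mu in cS SO.
have mS : measurable S := compact_measurable_rV cS.
have mO : measurable Omega := open_measurable_rV hopen.
have muS : m (~` S) = 0%E by rewrite mE; exact: measure_support_null.
split.
  move=> [L [bL Lphi]].
  have dm : in_dual G Omega m.
    exists L; split=> // phi tphi; rewrite Lphi// /Rintegral; congr fine; exact: int_eq.
  have [rho [B [rho0 HB]]] := dual_sum_bounded n0 cg hopen cS SO muS dm.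
  have [K [K0 HK]] := integral_wolff_le m cg.
  exists rho; split=> //.
  rewrite int_eq integral_mkcond; apply: (@le_lt_trans _ _ (K * B)%:E); last exact: ltry.
  apply: le_trans (HK rho B rho0 HB).
  have w0 x : (0 <= wolff m (inverse_pos (derive1 G)) x rho)%E.
    by apply: integral_ge0 => r _; rewrite lee_fin (h_ge0 cg).
  by apply: ge0_le_integral_nomeas => // x _; rewrite /patch; case: ifP => // _; rewrite wE.
move=> [r0 [r00 wfin]].
have wfin' : (\int[m]_(x in Omega) wolff m (inverse_pos (derive1 G)) x r0 < +oo)%E.
  by rewrite -int_eq; under eq_integral do rewrite -wE.
have muO' : m (~` Omega) = 0%E by rewrite mE.
(* The factor 2 is that of the energy in [variation_le]. *)
have [rho1 [B [rho10 B0 HB]]] := sum_le_integral_wolff cg mO muO' (ltr0n R 2) r00 wfin'.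
have [d d0 dO] := compact_margin hopen cS SO.
pose rho := Num.min rho1 d.
have rho0 : 0 < rho by rewrite lt_min rho10.
have SO' x : S x -> cube x rho `<=` Omega.
  by move=> Sx; apply: subset_trans (dO x Sx); apply: cube_le; rewrite ge_min lexx orbT.
have rho1' : rho <= rho1 by rewrite ge_min lexx.
have Ofin := bounded_lebesgue_fin mO hbnd.
have HB' := HB rho rho0 rho1'.
have [L [bL LE]] := functional_linear n0 cg hopen Ofin mS rho0 SO' HB'.
exists L; split=> // phi tphi.
rewrite LE (functional_test hopen mS muS rho0 SO' tphi) /Rintegral.
by congr fine; apply/esym; exact: int_eq.
Qed.
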